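(* Let $\Theta$ be the torsion-free $\mathrm{Spin}(7)$-structure on $E$ described in the context, and let $A$ be a $\mathrm{Spin}(7)$-instanton for $\Theta$, smooth on $E$, which on $E\setminus Z\cong(0,\infty)_r\times X$ may be written in radial gauge as $A=x(r)\sum_{i=1}^3\eta_i\otimes T_i$ for a real function $x(r)$. Then $A$ is asymptotic as $r\to+\infty$ to the canonical $\mathrm{G}_2$-instanton $a_\infty=\frac35\sum_{i=1}^3\eta_i\otimes T_i$ of the nearly parallel $X$, and either: (1) $A|_Z$ is the connection on $E\to Z$ induced by the Levi-Civita connection of the anti-self-dual Einstein metric on $Z$; in this case there is a unique $\mathrm{Spin}(7)$-instanton $A_{\lim}$, on $\pi^*E\to E$, with this property; or (2) $A|_Z$ is the flat connection on the trivial $\mathbb{C}^2$-bundle over $Z$; in this case there is a real $1$-parameter family of such $\mathrm{Spin}(7)$-instantons with this property. These live on the trivial bundle $E\times\mathbb{C}^2$, are parametrized by $y_0\in[0,+\infty)$, and can be written as $$A_{y_0}=r^2\,\tilde y(r)\sum_{i=1}^3\eta_i\otimes T_i$$ for some real analytic function $\tilde y$ of $r$ with $\tilde y(0)=y_0\ge0$. For $y_0<0$ one obtains $\mathrm{Spin}(7)$-instantons which are only locally defined in a neighbourhood of $Z$.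
   Context: Geometry. $(Z,g_Z)$ is a compact oriented spin Einstein $4$-orbifold with scalar curvature $s>0$ and anti-self-dual Weyl curvature; smoothness is understood in the orbifold sense at singular points. $X\to Z$ is the principal $\mathrm{SU}(2)$-(orbi)bundle lifting the $\mathrm{SO}(3)$-frame bundle of $\Lambda^2_+Z$, and $E=X\times_{\mathrm{SU}(2)}\mathbb{C}^2$ is the positive spinor bundle, with projection $\pi:E\to Z$; $Z\subset E$ is the zero section. Fixing a unit vector $e\in\mathbb{C}^2$, the map $(r,p)\mapsto[p,re]$ identifies $(0,\infty)_r\times X\cong E\setminus Z$. Let $T_1,T_2,T_3$ be the basis of $\mathfrak{su}(2)$ with $[T_i,T_j]=2\epsilon_{ijk}T_k$, and let $\eta=\sum_i\eta_i\otimes T_i\in\Omega^1(X,\mathfrak{su}(2))$ be the connection on $X$ induced by the Levi-Civita connection of $g_Z$. The horizontal $2$-forms $\omega_i$ are defined by $F_\eta=d\eta+\frac12[\eta\wedge\eta]=-\frac{s}{24}\sum_i\omega_i\otimes T_i$, i.e. $d\eta_i=-\frac{s}{24}\omega_i-2\eta_j\wedge\eta_k$ for $(i,j,k)$ cyclic; they form an orthogonal basis of the self-dual $2$-forms on $\ker\eta$ with $|\omega_i|=\sqrt2$ with respect to $\pi^*g_Z$. Fix $\nu_0>0$ and let $t(r),\nu(r)$, $r\ge0$, solve $\frac{d}{dr}\nu^2=6t$, $\frac{dt}{dr}=1-\frac{2t^2}{\nu^2}$ with $t(0)=0$, $\nu(0)=\nu_0$ (so $\nu^4(\nu^2-5t^2)^3=\nu_0^{10}$).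 Set $\varphi=t^3\eta_{123}-t\nu^2\frac{s}{48}\sum_i\eta_i\wedge\omega_i$, $\ \psi=\frac{\nu^4}{6}(\frac{s}{48})^2\sum_i\omega_i\wedge\omega_i-\nu^2t^2\frac{s}{48}(\eta_{12}\wedge\omega_3+\eta_{23}\wedge\omega_1+\eta_{31}\wedge\omega_2)$, $\ \Theta=dr\wedge\varphi+\psi$. Then $\Theta$ is closed and extends smoothly over the zero section $Z=\{r=0\}$ to a torsion-free $\mathrm{Spin}(7)$-structure on $E$ with metric $g_\Theta=dr^2+t^2\sum_i\eta_i\otimes\eta_i+\frac{s\nu^2}{48}\pi^*g_Z$ and orientation $\Theta\wedge\Theta$. Gauge theory. A connection $A$ is a $\mathrm{Spin}(7)$-instanton if $*F_A=-F_A\wedge\Theta$. Over $E\setminus Z$ the bundle $V=\pi^*E$ is tautologically trivialized (at $(r,p)$ the frame $p$ identifies $E_{\pi(p)}\cong\mathbb{C}^2$), so connections are $\mathfrak{su}(2)$-valued $1$-forms; $V$ extends over $E$ either as the trivial bundle $E\times\mathbb{C}^2$ or as $\pi^*E\to E$. ''Smooth on $E$'' means that, up to gauge, $A$ extends smoothly across $Z$ as a connection on one of these bundles. A connection $x(r)\sum_i\eta_i\otimes T_i$ on $E\setminus Z$ is a $\mathrm{Spin}(7)$-instanton if and only if $\frac{dx}{dr}=-\frac{2}{t}x\left(x-\left(1-\frac{2t^2}{\nu^2}\right)\right)$. Uniqueness and parametrization are within the class of instantons of this form. $a_\infty$ is regarded as a connection on the trivial $\mathbb{C}^2$-bundle over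 $X$, pulled back to $(0,\infty)\times X$; that $A$ is asymptotic to $a_\infty$ means $\lim_{r\to+\infty}x(r)=\frac35$.
   Formalization: The claim that A is asymptotic to a_∞ (x(r) → 3/5) is asserted only for A with x not identically zero, since the family member y0 = 0 is the flat connection x = 0, whose limit is 0; it remains in the family and in all the other claims. *)

(* Defs.v *)
From HB Require Import structures.
From mathcomp Require Import all_boot all_order all_algebra all_fingroup.
From mathcomp Require Import all_classical all_reals all_analysis.
Set Implicit Arguments.
Unset Strict Implicit.
Unset Printing Implicit Defensive.
Import Order.TTheory GRing.Theory Num.Theory.
Import numFieldNormedType.Exports.
Local Open Scope classical_set_scope.
Local Open Scope ring_scope.

Section Forms.
Context {R : realType}.

Definition basis_vec n (i : 'I_n) : 'rV[R]_n := delta_mx 0 i.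

Definition iter_partial n (s : seq 'I_n) (f : 'rV[R]_n -> R) : 'rV[R]_n -> R :=
  foldr (fun i (g : 'rV[R]_n -> R) x => 'D_(basis_vec i) g x) f s.

                                                                           
                                                  
Definition smooth_on n (D : set 'rV[R]_n) (f : 'rV[R]_n -> R) : Prop :=
  forall (s : seq 'I_n) (x : 'rV[R]_n), D x ->
    {for x, continuous (iter_partial s f)} /\
    forall i : 'I_n, derivable (iter_partial s f) x (basis_vec i).

Definition smooth_map_on m n (D : set 'rV[R]_m) (h : 'rV[R]_m -> 'rV[R]_n) :=
  forall j : 'I_n, smooth_on D (fun x => h x 0 j).

                                                               
                                                           
Definition ext n := {ffun {set 'I_n} -> R}.

                                                                   
Definition shuffle_sign n (S T : {set 'I_n}) : R :=
  (-1) ^+ #|[pred p : 'I_n * 'I_n | [&& p.1 \in S, p.2 \in T & (p.2 < p.1)%N]]|.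

Definition ext_const n (c : R) : ext n :=
  [ffun S : {set 'I_n} => if S == finset.set0 then c else 0].

Definition ext_wedge n (a b : ext n) : ext n :=
  [ffun S : {set 'I_n} => \sum_(T : {set 'I_n} | T \subset S)
     shuffle_sign T (S :\: T)%SET * a T * b (S :\: T)%SET].

Definition form n := 'rV[R]_n -> ext n.

Definition fun_form n (f : 'rV[R]_n -> R) : form n := fun x => ext_const n (f x).

Definition wedge n (a b : form n) : form n := fun x => ext_wedge (a x) (b x).

Definition fscale n (f : 'rV[R]_n -> R) (a : form n) : form n :=
  fun x => f x *: a x.

Definition dx n (i : 'I_n) : ext n :=
  [ffun S : {set 'I_n} => (S == finset.set1 i)%:R].

Definition ext_d n (a : form n) : form n := fun x =>
  \sum_(i < n) ext_wedge (dx i)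
    [ffun S : {set 'I_n} => 'D_(basis_vec i) (fun y => a y S) x].

Definition homogeneous_on n (D : set 'rV[R]_n) (k : nat) (a : form n) :=
  forall x, D x -> forall S : {set 'I_n}, #|S| != k -> a x S = 0.

Definition smooth_form_on n (D : set 'rV[R]_n) (a : form n) :=
  forall S : {set 'I_n}, smooth_on D (fun x => a x S).

                                                                       
Definition pullback1 m n (h : 'rV[R]_m -> 'rV[R]_n) (a : form n) : form m :=
  fun x => \sum_(j < n) a (h x) (finset.set1 j) *: ext_d (fun_form (fun y => h y 0 j)) x.

                                                      
Definition coframe_wedge n (f : 'I_n -> ext n) (S : {set 'I_n}) : ext n :=
  \big[@ext_wedge n/ext_const n 1]_(i <- enum S) f i.

                                                                               
                                                                             
                                                   
Definition is_hodge_dual n (f : 'I_n -> ext n) (o a b : ext n) : Prop :=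
  let sg := Num.sg (o finset.setT * coframe_wedge f finset.setT finset.setT) in
  exists c : {set 'I_n} -> R,
    a = \sum_(S : {set 'I_n}) c S *: coframe_wedge f S /\
    b = \sum_(S : {set 'I_n})
          (sg * shuffle_sign S (~: S)%SET * c S) *: coframe_wedge f (~: S)%SET.

End Forms.

Arguments ext R n : clear implicits.
Arguments form R n : clear implicits.
Arguments dx R {n} i.

                                                                   
                                                                   
                                                                    
                                         
Record quat (T : Type) := Quat { q0 : T; q1 : T; q2 : T; q3 : T }.

Definition qmap (A B : Type) (f : A -> B) (x : quat A) : quat B :=
  Quat (f (q0 x)) (f (q1 x)) (f (q2 x)) (f (q3 x)).

Definition qall (A : Type) (P : A -> Prop) (x : quat A) : Prop :=
  [/\ P (q0 x), P (q1 x), P (q2 x) & P (q3 x)].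

                                                             
Definition qprod (A B : Type) (C : zmodType) (op : A -> B -> C)
    (x : quat A) (y : quat B) : quat C :=
  Quat (op (q0 x) (q0 y) - op (q1 x) (q1 y) - op (q2 x) (q2 y) - op (q3 x) (q3 y))
       (op (q0 x) (q1 y) + op (q1 x) (q0 y) + op (q2 x) (q3 y) - op (q3 x) (q2 y))
       (op (q0 x) (q2 y) - op (q1 x) (q3 y) + op (q2 x) (q0 y) + op (q3 x) (q1 y))
       (op (q0 x) (q3 y) + op (q1 x) (q2 y) - op (q2 x) (q1 y) + op (q3 x) (q0 y)).

Definition qadd (A : zmodType) (x y : quat A) : quat A :=
  Quat (q0 x + q0 y) (q1 x + q1 y) (q2 x + q2 y) (q3 x + q3 y).

Definition qconj (A : zmodType) (x : quat A) : quat A :=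
  Quat (q0 x) (- q1 x) (- q2 x) (- q3 x).

Definition qim (A : zmodType) (x : quat A) : quat A :=
  Quat 0 (q1 x) (q2 x) (q3 x).

Section QuatForms.
Context {R : realType}.

Definition qmul (x y : quat R) : quat R := qprod *%R x y.

Definition qnorm2 (x : quat R) : R :=
  q0 x ^+ 2 + q1 x ^+ 2 + q2 x ^+ 2 + q3 x ^+ 2.

Definition o4 (k : nat) : 'I_4 := inord k.

Definition quat_of_row (v : 'rV[R]_4) : quat R :=
  Quat (v 0 (o4 0)) (v 0 (o4 1)) (v 0 (o4 2)) (v 0 (o4 3)).

Definition row_of_quat (x : quat R) : 'rV[R]_4 :=
  \row_(k < 4) nth 0 [:: q0 x; q1 x; q2 x; q3 x] k.

                                                            
Definition qfun n := quat ('rV[R]_n -> R).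

Definition qeval n (u : qfun n) (x : 'rV[R]_n) : quat R :=
  qmap (fun f : 'rV[R]_n -> R => f x) u.

Definition qfun_mul n (u v : qfun n) : qfun n := qprod (fun f g x => f x * g x) u v.

Definition unit_on n (D : set 'rV[R]_n) (u : qfun n) :=
  forall x, D x -> qnorm2 (qeval u x) = 1.

Definition hform n := quat (form R n).

Definition hfun n (u : qfun n) : hform n := qmap (@fun_form R n) u.
Definition hwedge n (a b : hform n) : hform n := qprod (@wedge R n) a b.
Definition hd n (a : hform n) : hform n := qmap (@ext_d R n) a.
Definition heval n (a : hform n) (x : 'rV[R]_n) : quat (ext R n) :=
  qmap (fun f : form R n => f x) a.

Definition curv n (A : hform n) : hform n := qadd (hd A) (hwedge A A).

                                                                   
                             
Definition gauge_act n (u : qfun n) (A : hform n) : hform n :=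
  qadd (hwedge (hwedge (qconj (hfun u)) A) (hfun u))
       (hwedge (qconj (hfun u)) (hd (hfun u))).

End QuatForms.

Section Orbifold.
Context {R : realType}.

                                                                             
Record orbifold_atlas (Z : topologicalType) := OrbifoldAtlas {
  chart : Type;
  cdom : chart -> set 'rV[R]_4;
  cproj : chart -> 'rV[R]_4 -> Z;
  cgrp : chart -> finGroupType;
  cact : forall i : chart, cgrp i -> 'rV[R]_4 -> 'rV[R]_4;
  cdom_open : forall i, open (cdom i);
  cdom_connected : forall i, connected (cdom i);
  cproj_continuous : forall i, {within cdom i, continuous (cproj i)};
  cproj_open : forall i (V : set 'rV[R]_4),
    open V -> V `<=` cdom i -> open (cproj i @` V);
  cproj_cover : forall y : Z, exists i z, cdom i z /\ cproj i z = y;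
  cact_dom : forall i g z, cdom i z -> cdom i (cact (i := i) g z);
  cact_smooth : forall i (g : cgrp i), smooth_map_on (cdom i) (cact g);
  cact1 : forall i z, cdom i z -> cact (1%g : cgrp i) z = z;
  cactM : forall i (g h : cgrp i) z, cdom i z ->
    cact (g * h)%g z = cact g (cact h z);
  cact_effective : forall i (g : cgrp i),
    (forall z, cdom i z -> cact g z = z) -> g = 1%g;
  cproj_orbit : forall i z w, cdom i z -> cdom i w ->
    (cproj i z = cproj i w <-> exists g : cgrp i, w = cact g z)
}.

                                                                              
                                  
Definition chart_change (Z : topologicalType) (O : orbifold_atlas Z)
    (i j : chart O) (W : set 'rV[R]_4) (h : 'rV[R]_4 -> 'rV[R]_4) : Prop :=
  [/\ open W, W `<=` cdom i, smooth_map_on W h &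
      forall z, W z -> cdom j (h z) /\ cproj j (h z) = cproj i z].

Record orbifold (Z : topologicalType) := Orbifold {
  atlas :> orbifold_atlas Z;
  atlas_compat : forall (i j : chart atlas) z w, cdom i z -> cdom j w ->
    cproj i z = cproj j w ->
    exists W h, [/\ chart_change i j W h, W z & h z = w]
}.

                                                                          
                                                                              
                                                             
                                                                               
                                                                           
                                                                          
                                                                         
                                                                 
Record spin_metric (Z : topologicalType) (O : orbifold Z) := SpinMetric {
  coframe : chart O -> hform (R := R) 4;
  lift_pos : chart O -> chart O -> ('rV[R]_4 -> 'rV[R]_4) -> qfun (R := R) 4;
  lift_neg : chart O -> chart O -> ('rV[R]_4 -> 'rV[R]_4) -> qfun (R := R) 4;
  coframe_degree : forall i, qall (homogeneous_on (cdom i) 1) (coframe i);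
  coframe_smooth : forall i, qall (smooth_form_on (cdom i)) (coframe i);
  coframe_indep : forall i z, cdom i z ->
    wedge (wedge (q0 (coframe i)) (q1 (coframe i)))
          (wedge (q2 (coframe i)) (q3 (coframe i))) z finset.setT != 0;
  lift_smooth : forall i j W h, chart_change i j W h ->
    qall (smooth_on W) (lift_pos i j h) /\ qall (smooth_on W) (lift_neg i j h);
  lift_unit : forall i j W h, chart_change i j W h ->
    unit_on W (lift_pos i j h) /\ unit_on W (lift_neg i j h);
  lift_rotation : forall i j W h, chart_change i j W h -> forall z, W z ->
    heval (qmap (pullback1 h) (coframe j)) z =
    heval (hwedge (hwedge (hfun (lift_pos i j h)) (coframe i))
                  (qconj (hfun (lift_neg i j h)))) z;
  lift_germ : forall i j W h h', chart_change i j W h -> chart_change i j W h' ->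
    (forall z, W z -> h z = h' z) -> forall z, W z ->
    qeval (lift_pos i j h) z = qeval (lift_pos i j h') z /\
    qeval (lift_neg i j h) z = qeval (lift_neg i j h') z;
  lift_cocycle : forall i j k W W' h h',
    chart_change i j W h -> chart_change j k W' h' ->
    forall z, W z -> W' (h z) ->
    qeval (lift_pos i k (h' \o h)) z =
      qmul (qeval (lift_pos j k h') (h z)) (qeval (lift_pos i j h) z) /\
    qeval (lift_neg i k (h' \o h)) z =
      qmul (qeval (lift_neg j k h') (h z)) (qeval (lift_neg i j h) z)
}.

Definition cofr (Z : topologicalType) (O : orbifold Z) (M : spin_metric O)
    (i : chart O) (a : 'I_4) : form R 4 :=
  nth 0 [:: q0 (coframe M i); q1 (coframe M i);
            q2 (coframe M i); q3 (coframe M i)] a.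

                                                                            
                                                                     
                                
Record levi_civita (Z : topologicalType) (O : orbifold Z) (M : spin_metric O) :=
LeviCivita {
  lc : chart O -> 'I_4 -> 'I_4 -> form R 4;
  Rm : chart O -> 'rV[R]_4 -> 'I_4 -> 'I_4 -> 'I_4 -> 'I_4 -> R;
  lc_degree : forall i a b, homogeneous_on (cdom i) 1 (lc i a b);
  lc_smooth : forall i a b, smooth_form_on (cdom i) (lc i a b);
  lc_antisym : forall i a b z, cdom i z -> lc i a b z = - lc i b a z;
  lc_torsion_free : forall i a z, cdom i z ->
    ext_d (cofr M i a) z = - \sum_(b < 4) wedge (lc i a b) (cofr M i b) z;
  Rm_antisym : forall i z a b c d, cdom i z -> Rm i z a b c d = - Rm i z a b d c;
  Rm_curvature : forall i z a b, cdom i z ->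
    ext_d (lc i a b) z + \sum_(c < 4) wedge (lc i a c) (lc i c b) z =
    \sum_(c < 4) \sum_(d < 4)
      (Rm i z a b c d / 2) *: wedge (cofr M i c) (cofr M i d) z
}.

Section Curvature.
Context (Z : topologicalType) (O : orbifold Z) (M : spin_metric O).
Variable L : levi_civita M.

Definition Ric (i : chart O) z (b d : 'I_4) : R := \sum_(a < 4) Rm L i z a b a d.

Definition scal (i : chart O) z : R := \sum_(b < 4) Ric i z b b.

Definition kd (a b : 'I_4) : R := (a == b)%:R.

Definition Weyl (i : chart O) z (a b c d : 'I_4) : R :=
  Rm L i z a b c d
  - (kd a c * Ric i z b d - kd a d * Ric i z b c
     - kd b c * Ric i z a d + kd b d * Ric i z a c) / 2
  + scal i z / 6 * (kd a c * kd b d - kd a d * kd b c).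

Definition einstein (s : R) : Prop :=
  forall i z, cdom i z ->
    scal i z = s /\ forall b d, Ric i z b d = scal i z / 4 * kd b d.

                                                                           
                                                                
Definition anti_self_dual : Prop :=
  forall i z, cdom i z -> forall c d,
    [/\ Weyl i z (o4 0) (o4 1) c d + Weyl i z (o4 2) (o4 3) c d = 0,
        Weyl i z (o4 0) (o4 2) c d + Weyl i z (o4 3) (o4 1) c d = 0 &
        Weyl i z (o4 0) (o4 3) c d + Weyl i z (o4 1) (o4 2) c d = 0].

                                                                             
                                                                               
                                                                            
Definition spin_connection (i : chart O) : hform (R := R) 4 :=
  Quat 0
    (fun z => - (1 / 2) *: (lc L i (o4 0) (o4 1) z + lc L i (o4 2) (o4 3) z))
    (fun z => - (1 / 2) *: (lc L i (o4 0) (o4 2) z + lc L i (o4 3) (o4 1) z))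
    (fun z => - (1 / 2) *: (lc L i (o4 0) (o4 3) z + lc L i (o4 1) (o4 2) z)).

End Curvature.
End Orbifold.

Arguments orbifold R Z : clear implicits.

Section Spin7.
Context {R : realType} (Z : topologicalType) (O : orbifold R Z).
Context (M : spin_metric O) (L : levi_civita M).

                                                                           
                                                                        
Definition base (p : 'rV[R]_(4 + 4)) : 'rV[R]_4 := lsubmx p.
Definition fibre (p : 'rV[R]_(4 + 4)) : quat R := quat_of_row (rsubmx p).

Definition radius (p : 'rV[R]_(4 + 4)) : R := Num.sqrt (qnorm2 (fibre p)).

Definition fibre_coord : qfun (R := R) (4 + 4) :=
  Quat (fun p => q0 (fibre p)) (fun p => q1 (fibre p))
       (fun p => q2 (fibre p)) (fun p => q3 (fibre p)).

Definition unit_fibre : qfun (R := R) (4 + 4) :=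
  Quat (fun p => q0 (fibre p) / radius p) (fun p => q1 (fibre p) / radius p)
       (fun p => q2 (fibre p) / radius p) (fun p => q3 (fibre p) / radius p).

                                                                       
                                                   
Definition annulus (J : set R) (i : chart O) : set 'rV[R]_(4 + 4) :=
  [set p | cdom i (base p) /\ J (radius p)].
Definition tube (J : set R) (i : chart O) : set 'rV[R]_(4 + 4) :=
  [set p | cdom i (base p) /\ (radius p = 0 \/ J (radius p))].

                                                                            
                                   
Definition eta (i : chart O) : hform (R := R) (4 + 4) :=
  qmap (fscale (fun p => (radius p ^+ 2)^-1))
    (qim (hwedge (qconj (hfun fibre_coord))
      (qadd (hd (hfun fibre_coord))
        (hwedge (qmap (pullback1 base) (spin_connection L i))
                (hfun fibre_coord))))).

Section Structure.
Variables (s : R) (t nu : R -> R).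

Definition omega (i : chart O) : hform (R := R) (4 + 4) :=
  qmap (fscale (fun=> - (24 / s))) (curv (eta i)).

Definition dr : form R (4 + 4) := ext_d (fun_form radius).

Definition phi (i : chart O) : form R (4 + 4) :=
  let e1 := q1 (eta i) in let e2 := q2 (eta i) in let e3 := q3 (eta i) in
  let w1 := q1 (omega i) in let w2 := q2 (omega i) in let w3 := q3 (omega i) in
  fscale (fun p => t (radius p) ^+ 3) (wedge e1 (wedge e2 e3))
  - fscale (fun p => t (radius p) * nu (radius p) ^+ 2 * (s / 48))
      (wedge e1 w1 + wedge e2 w2 + wedge e3 w3).

Definition psi (i : chart O) : form R (4 + 4) :=
  let e1 := q1 (eta i) in let e2 := q2 (eta i) in let e3 := q3 (eta i) in
  let w1 := q1 (omega i) in let w2 := q2 (omega i) in let w3 := q3 (omega i) in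
  fscale (fun p => nu (radius p) ^+ 4 / 6 * (s / 48) ^+ 2)
    (wedge w1 w1 + wedge w2 w2 + wedge w3 w3)
  - fscale (fun p => nu (radius p) ^+ 2 * t (radius p) ^+ 2 * (s / 48))
      (wedge (wedge e1 e2) w3 + wedge (wedge e2 e3) w1 + wedge (wedge e3 e1) w2).

Definition Theta (i : chart O) : form R (4 + 4) := wedge dr (phi i) + psi i.

                         
                                                                          
Definition coframe_Theta (i : chart O) (a : 'I_(4 + 4)) : form R (4 + 4) :=
  let tr p := t (radius p) in
  let nr p := Num.sqrt (s / 48) * nu (radius p) in
  nth 0 [:: dr;
            fscale tr (q1 (eta i)); fscale tr (q2 (eta i)); fscale tr (q3 (eta i));
            fscale nr (pullback1 base (q0 (coframe M i)));
            fscale nr (pullback1 base (q1 (coframe M i)));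
            fscale nr (pullback1 base (q2 (coframe M i)));
            fscale nr (pullback1 base (q3 (coframe M i)))] a.

                                                                          
Definition spin7_instanton (J : set R) (A : chart O -> hform (R := R) (4 + 4)) : Prop :=
  forall i, qall (smooth_form_on (annulus J i)) (A i) /\
    forall p, annulus J i p ->
      qall (fun F : form R (4 + 4) =>
              is_hodge_dual (fun a => coframe_Theta i a p)
                (wedge (Theta i) (Theta i) p) (F p) (- wedge F (Theta i) p))
           (curv (A i)).

End Structure.

                                                                           
Definition radial_connection (x : R -> R) (i : chart O) : hform (R := R) (4 + 4) :=
  qmap (fscale (fun p => x (radius p))) (eta i).

                                                                      
                                                  
Definition gauge_transformation (J : set R) (u : chart O -> qfun (R := R) (4 + 4)) :=
  [/\ forall i, qall (smooth_on (annulus J i)) (u i),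
      forall i, unit_on (annulus J i) (u i) &
      forall i j W h, chart_change i j W h ->
        forall p, W (base p) -> J (radius p) ->
        qeval (u j) (row_mx (h (base p))
                 (row_of_quat (qmul (qeval (lift_pos M i j h) (base p)) (fibre p))))
        = qeval (u i) p].

Inductive extension_bundle := TrivialBundle | PullbackE.

                                                                           
                                                                            
                                      
Definition frame_change (b : extension_bundle) : qfun (R := R) (4 + 4) :=
  match b with
  | TrivialBundle => Quat (fun=> 1) (fun=> 0) (fun=> 0) (fun=> 0)
  | PullbackE => qconj unit_fibre
  end.

                                                                            
                                       
Definition extends_to (J : set R) (b : extension_bundle)
    (A B : chart O -> hform (R := R) (4 + 4)) : Prop :=
  (forall i, qall (smooth_form_on (tube J i)) (B i)) /\
  exists2 u, gauge_transformation J u &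
    forall i p, annulus J i p ->
      heval (B i) p = heval (gauge_act (frame_change b) (gauge_act (u i) (A i))) p.

Definition smooth_on_E (J : set R) (A : chart O -> hform (R := R) (4 + 4)) : Prop :=
  exists b B, extends_to J b A B.

Definition zero_section_restr (B : hform (R := R) (4 + 4)) : hform (R := R) 4 :=
  qmap (pullback1 (fun z : 'rV[R]_4 => row_mx z (0 : 'rV[R]_4))) B.

                                                   
Definition restricts_to_LC (J : set R) (A : chart O -> hform (R := R) (4 + 4)) :=
  exists2 B, extends_to J PullbackE A B &
    forall i z, cdom i z ->
      heval (zero_section_restr (B i)) z = heval (spin_connection L i) z.

                                                
Definition restricts_to_flat (J : set R) (A : chart O -> hform (R := R) (4 + 4)) :=
  exists2 B, extends_to J TrivialBundle A B &
    forall i z, cdom i z ->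
      heval (zero_section_restr (B i)) z = Quat 0 0 0 0.

End Spin7.

Section Profile.
Context {R : realType}.

Record profile_solution (nu0 : R) (t nu : R -> R) : Prop := ProfileSolution {
  profile_t0 : t 0 = 0;
  profile_nu0 : nu 0 = nu0;
  profile_pos : forall r : R, 0 <= r -> 0 < nu r;
  profile_t_right_cont : t r @[r --> 0^'+] --> t 0;
  profile_nu_right_cont : nu r @[r --> 0^'+] --> nu 0;
  profile_dnu2 : forall r : R, 0 < r -> is_derive r 1 (fun q : R => nu q ^+ 2) (6 * t r);
  profile_dt : forall r : R, 0 < r -> is_derive r 1 t (1 - 2 * t r ^+ 2 / nu r ^+ 2)
}.

Definition real_analytic_on (D : set R) (f : R -> R) : Prop :=
  forall r0, D r0 -> exists (a : nat -> R) (d : R), 0 < d /\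
    forall r, D r -> `|r - r0| < d ->
      (\sum_(0 <= k < n) a k * (r - r0) ^+ k) @[n --> \oo] --> f r.

End Profile.

(* Main.v *)
Require Import Defs.
From HB Require Import structures.
From mathcomp Require Import all_boot all_order all_algebra.
From mathcomp Require Import all_classical all_reals all_analysis.
From mathcomp Require Import ring lra.
Set Implicit Arguments.
Unset Strict Implicit.
Unset Printing Implicit Defensive.
Import Order.TTheory GRing.Theory Num.Theory.
Import numFieldNormedType.Exports.
Local Open Scope classical_set_scope.
Local Open Scope ring_scope.

(* In the trivialization of V over E \ Z the instanton equation for x eta is the Riccati equation
   x' = 2x(t' - x)/t with t' = 1 - 2t^2/nu^2.  Indeed eta is the gauge transform of the pulled back
   spin connection Sigma by the unit quaternion u = q/|q|, so its curvature is u^-1 F_Sigma u, and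
   the Einstein and anti-self-duality conditions make F_Sigma equal to -s/24 times the standard
   basis of self-dual 2-forms.  Since (t^2/x)' = 2t = (nu^2/3)', the solutions on (0, oo) are x = 0
   and x = t^2/(nu^2/3 + C) with C >= -nu0^2/3: for C = -nu0^2/3 one gets x -> 1 at Z and the
   extension to pi^*E, for C > -nu0^2/3 one gets x = y0 r^2 + ... and the extension to the trivial
   bundle, with y0 = 1/(C + nu0^2/3).  The smoothness of the extensions across r = 0 comes from the
   parity in r of the Taylor expansion of the profile functions.  The two cases exclude each other
   because the gauge-invariant norm of the curvature in the base directions,
   |x F_Sigma + (x^2 - x)[Sigma, Sigma]|, tends to |F_Sigma| <> 0 or to 0 at the zero section. *)

(** The Hodge condition is linear algebra at a point: in a coframe adapted to [Theta] each imaginary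
    component of the curvature has the form p e0^ei + b Wi + c ej^ek, and duality becomes the single
    relation p + c = 2b, the same for all three components by cyclic symmetry. The profile functions
    t and nu are given only with one-sided limits at r = 0, so their expansions there have to be
    produced. Adjoining t/nu^2, 1/nu^2 and similar quotients makes the equations a quadratic system:
    its Taylor coefficients follow from a recursion, grow at most geometrically, and moving the
    centre of the Taylor polynomial bounds the remainder. The limit 3/5 comes from the conserved
    quantity nu^4 (nu^2 - 5t^2)^3, which forces t^2/nu^2 to tend to 1/5. To exclude an extension one
    must rule out every gauge transformation on E minus Z, none of which is controlled near Z; hence
    the comparison through a gauge-invariant norm, made along a ray on which the unit quaternion is
    1. *)

Local Notation "a \w b" := (ext_wedge a b) (at level 40, left associativity).

(** * Exterior algebra and the Hodge dual *)

Section ExtAlgebra.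
Import mathcomp.boot.fintype mathcomp.boot.finset.
Local Close Scope classical_set_scope.
Context {R : realType} (n : nat).
Implicit Types (a b c : ext R n) (S T U V : {set 'I_n}).

Definition cross_sign (i j : 'I_n) : R := if (j < i)%N then -1 else 1.

(** As a double product the sign is visibly multiplicative in each argument over disjoint unions,
    and associativity of the wedge needs nothing else about it. *)
Lemma shuffle_signE S T :
  shuffle_sign S T = \prod_(i in S) \prod_(j in T) cross_sign i j :> R.
Proof.
rewrite /shuffle_sign -prodr_const pair_big /= [RHS]big_mkcond /= [LHS]big_mkcond.
apply: eq_bigr => -[i j] _ /=; rewrite inE /= /cross_sign.
by case: (i \in S); case: (j \in T); case: ifP.
Qed.

Lemma shuffle_sign0s S : shuffle_sign finset.set0 S = 1 :> R.
Proof. by rewrite shuffle_signE big_set0. Qed.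

Lemma shuffle_signs0 S : shuffle_sign S finset.set0 = 1 :> R.
Proof. by rewrite shuffle_signE big1 // => i _; rewrite big_set0. Qed.

Lemma shuffle_signUl S T U : [disjoint S & T] ->
  shuffle_sign (S :|: T)%SET U = shuffle_sign S U * shuffle_sign T U :> R.
Proof.
move=> dST; rewrite !shuffle_signE (eq_bigl [predU S & T]) ?bigU // => i.
by rewrite !inE.
Qed.

Lemma shuffle_signUr S T U : [disjoint S & T] ->
  shuffle_sign U (S :|: T)%SET = shuffle_sign U S * shuffle_sign U T :> R.
Proof.
move=> dST; rewrite !shuffle_signE -big_split.
apply: eq_bigr => i _; rewrite (eq_bigl [predU S & T]) ?bigU // => j.
by rewrite !inE.
Qed.

(** Both sides sum over the splittings of [S] into three disjoint blocks, and in both the sign is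
    the product of the three pairwise signs. *)
Lemma ext_wedgeA a b c : a \w (b \w c) = (a \w b) \w c.
Proof.
apply/ffunP => S; rewrite !ffunE.
under [RHS]eq_bigr => T _ do rewrite ffunE mulr_sumr mulr_suml.
rewrite (exchange_big_dep (fun U => U \subset S)) /=; last first.
  by move=> T U TS UT; exact: fintype.subset_trans UT TS.
apply: eq_bigr => U US; rewrite ffunE mulr_sumr.
(* With the first block [U] fixed, [T] is the union of the first two blocks and [V] is the second
   one. *)
rewrite [RHS](reindex_onto (fun V => U :|: V)%SET (fun T => T :\: U)%SET) /=; last first.
  move=> T /andP[_ UT]; apply/setP => i; rewrite !inE.
  by case: (boolP (i \in U)) => //= /(subsetP UT) ->.
apply: eq_big => [V|V].
  rewrite subsetD subUset US subsetUl /= finset.setDUl finset.setDv set0U.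
  case: (V \subset S) => //=; apply/idP/eqP => [dVU|<-].
    by apply/setDidPl.
  by rewrite disjoint_sym disjoints_subset finset.setCD subsetUr.
rewrite subsetD => /andP[VS dVU].
have dUV : [disjoint U & V] by rewrite disjoint_sym.
have -> : ((U :|: V) :\: U = V)%SET.
  by rewrite finset.setDUl finset.setDv set0U; apply/setDidPl.
have -> : (S :\: (U :|: V) = S :\: U :\: V)%SET by rewrite finset.setDDl.
have {1}-> : (S :\: U = V :|: (S :\: U :\: V))%SET.
  apply/setP => i; rewrite !inE; case: (boolP (i \in V)) => //= iV.
  by rewrite (subsetP VS) // andbT; move/pred0P: dUV => /(_ i) /=; rewrite iV andbT => ->.
rewrite shuffle_signUr ?shuffle_signUl //; last first.
  by apply/pred0P => i; rewrite /= !inE; case: (i \in V).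
ring.
Qed.

Lemma ext_addE a b S : (a + b) S = a S + b S. Proof. exact: ffunE. Qed.

Lemma ext_scaleE x a S : (x *: a) S = x * a S. Proof. exact: ffunE. Qed.

Lemma ext_oppE a S : (- a) S = - a S. Proof. exact: ffunE. Qed.

Lemma ext_wedgeE a b S : (a \w b) S =
  \sum_(T : {set 'I_n} | T \subset S) shuffle_sign T (S :\: T)%SET * a T * b (S :\: T)%SET.
Proof. exact: ffunE. Qed.

Lemma ext_wedgeDl a b c : (a + b) \w c = a \w c + b \w c.
Proof.
apply/ffunP => S; rewrite ext_addE !ext_wedgeE -big_split; apply: eq_bigr => T _ /=.
by rewrite ext_addE; ring.
Qed.

Lemma ext_wedgeDr a b c : a \w (b + c) = a \w b + a \w c.
Proof.
apply/ffunP => S; rewrite ext_addE !ext_wedgeE -big_split; apply: eq_bigr => T _ /=.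
by rewrite ext_addE; ring.
Qed.

Lemma ext_wedgeZl x a b : (x *: a) \w b = x *: (a \w b).
Proof.
apply/ffunP => S; rewrite ext_scaleE !ext_wedgeE mulr_sumr; apply: eq_bigr => T _.
by rewrite ext_scaleE; ring.
Qed.

Lemma ext_wedgeZr x a b : a \w (x *: b) = x *: (a \w b).
Proof.
apply/ffunP => S; rewrite ext_scaleE !ext_wedgeE mulr_sumr; apply: eq_bigr => T _.
by rewrite ext_scaleE; ring.
Qed.

Lemma ext_wedgeNl a b : (- a) \w b = - (a \w b).
Proof. by rewrite -scaleN1r ext_wedgeZl scaleN1r. Qed.

Lemma ext_wedgeNr a b : a \w (- b) = - (a \w b).
Proof. by rewrite -scaleN1r ext_wedgeZr scaleN1r. Qed.

Lemma ext_wedge0l a : 0 \w a = 0.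
Proof. by rewrite -(scale0r 0) ext_wedgeZl !scale0r. Qed.

Lemma ext_wedge0r a : a \w 0 = 0.
Proof. by rewrite -(scale0r 0) ext_wedgeZr !scale0r. Qed.

Lemma ext_wedge_suml (I : Type) (r : seq I) (P : pred I) (F : I -> ext R n) b :
  (\sum_(i <- r | P i) F i) \w b = \sum_(i <- r | P i) F i \w b.
Proof.
exact: (big_morph (fun a => a \w b) (fun a a' => ext_wedgeDl a a' b) (ext_wedge0l b)).
Qed.

Lemma ext_wedge_sumr (I : Type) (r : seq I) (P : pred I) (F : I -> ext R n) b :
  b \w (\sum_(i <- r | P i) F i) = \sum_(i <- r | P i) b \w F i.
Proof. exact: (big_morph (ext_wedge b) (ext_wedgeDr b) (ext_wedge0r b)). Qed.

Lemma ext_wedge_constl x a : ext_const n x \w a = x *: a.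
Proof.
apply/ffunP => S; rewrite !ffunE (bigD1 finset.set0) ?finset.sub0set //=.
rewrite shuffle_sign0s ffunE eqxx mul1r finset.setD0 big1 ?addr0 // => T.
by case/andP=> _ /negPf T0; rewrite ffunE T0 mulr0 mul0r.
Qed.

Lemma ext_wedge_constr x a : a \w ext_const n x = x *: a.
Proof.
apply/ffunP => S; rewrite !ffunE (bigD1 S) ?subxx //=.
rewrite finset.setDv shuffle_signs0 ffunE eqxx mul1r mulrC big1 ?addr0 // => T.
case/andP=> TS TneS; rewrite ffunE; case: eqP => [|_]; last by rewrite mulr0.
move/eqP; rewrite finset.setD_eq0 => ST; case/negP: TneS.
by rewrite eqEsubset TS ST.
Qed.

Lemma ext_wedge1l : left_id (ext_const n 1) (@ext_wedge R n).
Proof. by move=> a; rewrite ext_wedge_constl scale1r. Qed.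

Lemma ext_wedge1r : right_id (ext_const n 1) (@ext_wedge R n).
Proof. by move=> a; rewrite ext_wedge_constr scale1r. Qed.

(** Makes [big_cat] and its companions available for the iterated wedges in [coframe_wedge]. *)
HB.instance Definition _ :=
  Monoid.isLaw.Build (ext R n) (ext_const n 1) (@ext_wedge R n)
    ext_wedgeA ext_wedge1l ext_wedge1r.

Definition ext_degree (k : nat) a := forall S, #|S| != k -> a S = 0.

Lemma ext_degree_const x : ext_degree 0 (ext_const n x).
Proof. by move=> S; rewrite cards_eq0 ffunE => /negPf ->. Qed.

Lemma ext_degree_wedge k l a b :
  ext_degree k a -> ext_degree l b -> ext_degree (k + l) (a \w b).
Proof.
move=> ka lb S Skl; rewrite ffunE big1 // => T TS.
have [Tk|Tk] := eqVneq #|T| k; last by rewrite ka // mulr0 mul0r.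
rewrite (lb (S :\: T)%SET) ?mulr0 //; apply: contra Skl => /eqP <-.
by rewrite -Tk cardsD (finset.setIidPr TS) subnKC // subset_leq_card.
Qed.

Lemma ext_degreeZ k x a : ext_degree k a -> ext_degree k (x *: a).
Proof. by move=> ka S Sk; rewrite ffunE ka // scaler0. Qed.

Lemma ext_degree_dx i : ext_degree 1 (dx R i).
Proof. by move=> S; rewrite ffunE; case: (S =P _) => [->|//]; rewrite cards1. Qed.

Lemma ext_wedge_dxdx i j S : (dx R i \w dx R j) S =
  ((i != j) && (S == [set i; j])%SET)%:R * cross_sign i j.
Proof.
rewrite ffunE; have [iS|iS] := boolP (i \in S); last first.
  rewrite (_ : (S == _) = false) ?andbF ?mul0r; last first.
    by apply/eqP => Sij; move: iS; rewrite Sij !inE eqxx.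
  rewrite big1 // => T TS; rewrite ffunE; case: eqP => [Ti|]; last by rewrite mulr0 mul0r.
  by move: TS; rewrite Ti finset.sub1set (negPf iS).
rewrite (bigD1 [set i]%SET) ?finset.sub1set //= big1 ?addr0; last first.
  by move=> T /andP[_ /negPf Ti]; rewrite ffunE Ti mulr0 mul0r.
rewrite !ffunE eqxx mulr1.
have -> : (S :\: [set i] == [set j])%SET = (i != j) && (S == [set i; j])%SET.
  apply/eqP/andP => [Sij|[ij /eqP ->]].
    split; last by rewrite -Sij finset.setD1K.
    apply/eqP => ij; move/setP: Sij => /(_ j).
    by rewrite !inE ij eqxx.
  apply/setP => k; rewrite !inE; case: (eqVneq k i) => //= ->.
  by rewrite (negPf ij).
have [/andP[ij /eqP ->]|_] := boolP (_ && _); last by rewrite mulr0 mul0r.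
have -> : ([set i; j] :\: [set i] = [set j])%SET.
  apply/setP => k; rewrite !inE; case: (eqVneq k i) => //= ->.
  by rewrite (negPf ij).
by rewrite shuffle_signE !big_set1 mulr1 mul1r.
Qed.

Lemma ext_wedge_dxC i j : dx R i \w dx R j = - (dx R j \w dx R i : ext R n).
Proof.
apply/ffunP => S; rewrite [RHS]ffunE !ext_wedge_dxdx finset.setUC eq_sym.
have [->|ij] := eqVneq j i; first by rewrite /= !mul0r oppr0.
rewrite -mulrN /cross_sign; case: ltngtP => [_|_|/val_inj ij']; rewrite ?opprK //.
by rewrite ij' eqxx in ij.
Qed.

Definition one_form (c : 'I_n -> R) : ext R n := \sum_i c i *: dx R i.

(** The coefficients need not be antisymmetric: by [eq_two_form] only [c i j - c j i] matters.
    Products of coefficients and matrices of partial derivatives can therefore be inserted as they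
    are. *)
Definition two_form (c : 'I_n -> 'I_n -> R) : ext R n :=
  \sum_i \sum_j c i j *: (dx R i \w dx R j).

Lemma one_form_set1 (c : 'I_n -> R) i : one_form c [set i]%SET = c i.
Proof.
rewrite /one_form sum_ffunE (bigD1 i) //= ext_scaleE ffunE eqxx mulr1.
rewrite big1 ?addr0 // => j ji.
by rewrite ext_scaleE ffunE (inj_eq set1_inj) eq_sym (negPf ji) mulr0.
Qed.

Lemma one_form_neq1 (c : 'I_n -> R) S : (#|S| != 1)%N -> one_form c S = 0.
Proof.
move=> S1; rewrite /one_form sum_ffunE big1 // => j _.
by rewrite ext_scaleE (@ext_degree_dx j S S1) mulr0.
Qed.

Lemma ext_degree_one_form (c : 'I_n -> R) : ext_degree 1 (one_form c).
Proof. by move=> S; exact: one_form_neq1. Qed.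

Lemma degree1_one_form a : ext_degree 1 a -> a = one_form (fun i => a [set i]%SET).
Proof.
move=> a1; apply/ffunP => S; have [/cards1P[i ->]|S1] := boolP (#|S| == 1)%N.
  by rewrite one_form_set1.
by rewrite one_form_neq1 // a1.
Qed.

Lemma one_formD (c d : 'I_n -> R) : one_form c + one_form d = one_form (fun i => c i + d i).
Proof. by rewrite /one_form -big_split; apply: eq_bigr => i _; rewrite scalerDl. Qed.

Lemma one_formZ x (c : 'I_n -> R) : x *: one_form c = one_form (fun i => x * c i).
Proof. by rewrite /one_form scaler_sumr; apply: eq_bigr => i _; rewrite scalerA. Qed.

Lemma one_formN (c : 'I_n -> R) : - one_form c = one_form (fun i => - c i).
Proof.
by rewrite -scaleN1r one_formZ; apply: eq_bigr => i _; rewrite mulN1r.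
Qed.

Lemma eq_one_form (c d : 'I_n -> R) : c =1 d -> one_form c = one_form d.
Proof. by move=> cd; apply: eq_bigr => i _; rewrite cd. Qed.

Lemma two_formD (c d : 'I_n -> 'I_n -> R) : two_form c + two_form d = two_form (fun i j => c i j + d i j).
Proof.
rewrite /two_form -big_split; apply: eq_bigr => i _.
by rewrite -big_split; apply: eq_bigr => j _; rewrite scalerDl.
Qed.

Lemma two_formZ x (c : 'I_n -> 'I_n -> R) : x *: two_form c = two_form (fun i j => x * c i j).
Proof.
rewrite /two_form scaler_sumr; apply: eq_bigr => i _.
by rewrite scaler_sumr; apply: eq_bigr => j _; rewrite scalerA.
Qed.

Lemma two_formN (c : 'I_n -> 'I_n -> R) : - two_form c = two_form (fun i j => - c i j).
Proof.
rewrite -scaleN1r two_formZ; apply: eq_bigr => i _.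
by apply: eq_bigr => j _; rewrite mulN1r.
Qed.

Lemma one_form_wedge (c d : 'I_n -> R) : one_form c \w one_form d = two_form (fun i j => c i * d j).
Proof.
rewrite /one_form ext_wedge_suml; apply: eq_bigr => i _.
rewrite ext_wedge_sumr; apply: eq_bigr => j _.
by rewrite ext_wedgeZl ext_wedgeZr scalerA.
Qed.

Lemma two_form_set2 (c : 'I_n -> 'I_n -> R) (i j : 'I_n) : (i < j)%N -> two_form c [set i; j]%SET = c i j - c j i.
Proof.
move=> ij; have ij' : i != j by apply: contraTneq ij => ->; rewrite ltnn.
have eqij k l : (([set i; j] == [set k; l])%SET && (k != l)) =
   ((k == i) && (l == j)) || ((k == j) && (l == i)).
  apply/andP/orP => [[/eqP/setP E kl]|].
    have := E i; have := E j; rewrite !inE !eqxx orbT /=.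
    move=> /esym/orP[/eqP jE|/eqP jE] /esym/orP[/eqP iE|/eqP iE];
      move: ij'; rewrite iE jE ?eqxx // => _; [by right|by left].
  by case=> /andP[/eqP -> /eqP ->]; rewrite ?[[set j; i]%SET]finset.setUC eqxx // eq_sym.
rewrite /two_form sum_ffunE.
under eq_bigr => k _ do rewrite sum_ffunE.
rewrite pair_big /= (bigD1 (i, j)) //= (bigD1 (j, i)) /=; last first.
  by rewrite xpair_eqE eq_sym (negPf ij').
rewrite big1 ?addr0; last first.
  move=> [k l] /= /andP[]; rewrite !xpair_eqE => n1 n2.
  by rewrite ext_scaleE ext_wedge_dxdx andbC eqij (negPf n1) (negPf n2) mul0r mulr0.
rewrite !ext_scaleE !ext_wedge_dxdx ![(_ != _) && _]andbC !eqij !eqxx orbT /=.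
by rewrite /cross_sign ltnNge (ltnW ij) /= ij !mul1r mulr1 mulrN1.
Qed.

Lemma two_form_antisym (c : 'I_n -> 'I_n -> R) : two_form c = two_form (fun i j => (c i j - c j i) / 2).
Proof.
have h : two_form c = - two_form (fun i j => c j i).
  rewrite two_formN /two_form exchange_big; apply: eq_bigr => i _; apply: eq_bigr => j _.
  by rewrite ext_wedge_dxC scalerN scaleNr.
transitivity ((1 / 2) *: (two_form c + two_form c)).
  by apply/ffunP => S; rewrite ext_scaleE ext_addE; field.
rewrite {2}h two_formN two_formD two_formZ.
by apply: eq_bigr => i _; apply: eq_bigr => j _; rewrite mul1r mulrC.
Qed.

Lemma eq_two_form (c d : 'I_n -> 'I_n -> R) : (forall i j, c i j - c j i = d i j - d j i) ->
  two_form c = two_form d.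
Proof.
move=> cd; rewrite two_form_antisym [RHS]two_form_antisym.
by apply: eq_bigr => i _; apply: eq_bigr => j _; rewrite cd.
Qed.

Lemma degree1_wedgeC a b : ext_degree 1 a -> ext_degree 1 b -> a \w b = - (b \w a).
Proof.
move=> /degree1_one_form -> /degree1_one_form ->; rewrite !one_form_wedge two_formN.
by apply: eq_two_form => i j; ring.
Qed.

Lemma degree1_wedge_sq a : ext_degree 1 a -> a \w a = 0.
Proof.
move=> /degree1_one_form ->; rewrite one_form_wedge.
rewrite (@eq_two_form _ (fun _ _ => 0)); last by move=> i j; ring.
by rewrite /two_form big1 // => i _; rewrite big1 // => j _; rewrite scale0r.
Qed.

Lemma dx_wedge_delta i S (d : ext R n) : i \notin S ->
  (forall T, d T = (T == S)%:R) ->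
  exists2 c : R, c != 0 &
    forall T, (dx R i \w d) T = c * (T == i |: S)%SET%:R.
Proof.
move=> iS dE; exists (shuffle_sign [set i]%SET S).
  rewrite shuffle_signE big_set1; apply/prodf_neq0 => j _.
  by rewrite /cross_sign; case: ifP; rewrite ?oppr_eq0 oner_eq0.
move=> T; rewrite ext_wedgeE; have [iT|iT] := boolP (i \in T); last first.
  rewrite (_ : (T == _) = false) ?mulr0; last first.
    by apply/eqP => Ti; move: iT; rewrite Ti !inE eqxx.
  rewrite big1 // => U UT; rewrite ffunE; case: eqP => [Ui|]; last by rewrite mulr0 mul0r.
  by move: UT; rewrite Ui finset.sub1set (negPf iT).
rewrite (bigD1 [set i]%SET) ?finset.sub1set //= big1 ?addr0; last first.
  by move=> U /andP[_ /negPf Ui]; rewrite ffunE Ui mulr0 mul0r.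
rewrite !ffunE eqxx mulr1 dE.
have -> : (T :\: [set i] == S)%SET = (T == i |: S)%SET.
  apply/eqP/eqP => [<-|->]; first by rewrite finset.setD1K.
  by rewrite setU1K.
by case: eqP => [->|_]; rewrite ?mulr0 // setU1K.
Qed.

Section Coframe.
Variable f : 'I_n -> ext R n.
Hypothesis f1 : forall i, ext_degree 1 (f i).
Implicit Types s : seq 'I_n.

(** Products along arbitrary lists, with [coframe_wedge] as the sorted case. Permuting a list costs
    a sign that is only claimed to exist, which is enough for nonvanishing and for recovering
    coefficients. *)
Definition word s : ext R n := \big[@ext_wedge R n/ext_const n 1]_(i <- s) f i.

Lemma word_cons i s : word (i :: s) = f i \w word s.
Proof. by rewrite /word big_cons. Qed.

Lemma word_nil : word [::] = ext_const n 1.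
Proof. by rewrite /word big_nil. Qed.

Lemma word_cat s s' : word (s ++ s') = word s \w word s'.
Proof. by rewrite /word big_cat. Qed.

Lemma ext_degree_word s : ext_degree (size s) (word s).
Proof.
elim: s => [|i s IHs]; first by rewrite word_nil; exact: ext_degree_const.
by rewrite word_cons; exact: (ext_degree_wedge (f1 i) IHs).
Qed.

Lemma word_swap i j s : word [:: i, j & s] = - word [:: j, i & s].
Proof.
by rewrite !word_cons !ext_wedgeA (degree1_wedgeC (f1 i) (f1 j)) ext_wedgeNl.
Qed.

Lemma word_rem i s : i \in s -> exists b : bool, word s = (-1) ^+ b *: word (i :: rem i s).
Proof.
elim: s => [//|j s IHs]; rewrite inE eq_sym /=; have [->|ji] := eqVneq j i.
  by exists false; rewrite scale1r.
move=> /= /IHs[b E]; exists (~~ b).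
rewrite word_cons E ext_wedgeZr -word_cons word_swap.
by rewrite signrN scaleNr scalerN opprK.
Qed.

Lemma word_perm s s' : perm_eq s s' -> exists b : bool, word s = (-1) ^+ b *: word s'.
Proof.
elim: s' s => [|i s' IHs'] s ss'.
  by exists false; rewrite scale1r; move/perm_nilP: ss' => ->.
have is_ : i \in s by rewrite (perm_mem ss') mem_head.
have [b E] := word_rem is_.
have /IHs'[b' E'] : perm_eq (rem i s) s'.
  by rewrite -(perm_cons i) -(permPr ss') perm_sym perm_to_rem.
exists (b (+) b'); rewrite E (word_cons i (rem i s)) E' ext_wedgeZr -word_cons scalerA.
by rewrite signr_addb.
Qed.

Lemma word_nuniq s : ~~ uniq s -> word s = 0.
Proof.
elim: s => [//|i s IHs] /=; rewrite negb_and negbK => /orP[is_|/IHs]; last first.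
  by rewrite word_cons => ->; rewrite ext_wedge0r.
have [b E] := word_rem is_.
rewrite word_cons E ext_wedgeZr word_cons ext_wedgeA degree1_wedge_sq //.
by rewrite ext_wedge0l scaler0.
Qed.

Lemma coframe_wedgeE S : coframe_wedge f S = word (enum S).
Proof. by []. Qed.

Lemma ext_degree_coframe S : ext_degree #|S| (coframe_wedge f S).
Proof. by rewrite coframe_wedgeE cardE; exact: ext_degree_word. Qed.

Lemma word_full s : size s = n ->
  exists c : R, word s = c *: coframe_wedge f [set: 'I_n]%SET.
Proof.
move=> sn; have [us|us] := boolP (uniq s); last first.
  by exists 0; rewrite scale0r word_nuniq.
have [|b ->] := @word_perm s (enum [set: 'I_n]%SET); last by exists ((-1) ^+ b).
apply: uniq_perm; rewrite ?enum_uniq // => i; rewrite mem_enum inE.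
have := uniq_leq_size us (s2 := enum 'I_n) (fun j _ => mem_enum _ j).
have [|_ +] := uniq_min_size us (s2 := enum 'I_n) (fun j _ => mem_enum _ j).
  by rewrite size_enum_ord sn.
by move=> /(_ i); rewrite mem_enum.
Qed.

(** Wedge the relation with the product of all covectors except [f k]: every term but the one of
    index [k] has a repeated factor. *)
Lemma coframe_wedge_dependent (c : 'I_n -> R) k : c k != 0 ->
  \sum_i c i *: f i = 0 -> coframe_wedge f [set: 'I_n]%SET = 0.
Proof.
move=> ck0 E; have kT : k \in enum [set: 'I_n]%SET by rewrite mem_enum inE.
rewrite coframe_wedgeE; have [b ->] := word_rem kT; set s := rem k _.
suff -> : word (k :: s) = 0 by rewrite scaler0.
have : (\sum_i c i *: f i) \w word s = 0 by rewrite E ext_wedge0l.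
rewrite ext_wedge_suml (bigD1 k) //= big1 ?addr0 => [|i ik].
  rewrite ext_wedgeZl -word_cons => E'.
  by rewrite -[LHS]scale1r -(mulVf ck0) -scalerA E' scaler0.
rewrite ext_wedgeZl -word_cons word_nuniq ?scaler0 //=.
by rewrite mem_rem_uniq ?enum_uniq // !inE ik mem_enum inE.
Qed.

Lemma coframe_wedge_compl S :
  exists b : bool, coframe_wedge f S \w coframe_wedge f (~: S)%SET =
    (-1) ^+ b *: coframe_wedge f [set: 'I_n]%SET.
Proof.
rewrite !coframe_wedgeE -word_cat; apply: word_perm.
apply: uniq_perm; rewrite ?enum_uniq //.
  rewrite cat_uniq !enum_uniq /= andbT; apply/hasPn => i.
  by rewrite !mem_enum !inE.
by move=> i; rewrite mem_cat !mem_enum !inE orbN.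
Qed.

End Coframe.

Lemma word_dx_neq0 s : uniq s -> exists2 c : R, c != 0 &
  forall T, word (dx R) s T = c * (T == [set i in s])%SET%:R.
Proof.
elim: s => [_|i s IHs] /=.
  exists 1; first exact: oner_neq0.
  move=> T; rewrite word_nil ffunE mul1r (_ : [set i in [::]]%SET = finset.set0).
    by case: eqP.
  by apply/setP => j; rewrite !inE.
move=> /andP[is_ /IHs[c c0 E]].
pose d : ext R n := [ffun T => (T == [set i in s])%SET%:R].
have -> : word (dx R) (i :: s) = c *: (dx R i \w d).
  rewrite word_cons -ext_wedgeZr; congr (_ \w _).
  by apply/ffunP => T; rewrite E ext_scaleE ffunE.
have [||c' c'0 E'] := @dx_wedge_delta i [set i in s]%SET d.
- by rewrite inE.
- by move=> T; rewrite ffunE.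
exists (c * c'); first by rewrite mulf_neq0.
move=> T; rewrite ext_scaleE E' mulrA; congr (_ * (_ == _)%:R).
by apply/setP => j; rewrite !inE.
Qed.

(** If the top product of the [f i] vanished, so would every word of length n in them. Replacing the
    factors of the coordinate volume one at a time by combinations of the [f j] would then make that
    volume zero. *)
Lemma coframe_wedge_spanning (f : 'I_n -> ext R n) (M : 'I_n -> 'I_n -> R) :
  (forall i, ext_degree 1 (f i)) ->
  (forall i, dx R i = \sum_j M i j *: f j) ->
  coframe_wedge f [set: 'I_n]%SET [set: 'I_n]%SET != 0.
Proof.
move=> f1 E; apply/negP => /eqP f0.
have {}f0 : coframe_wedge f [set: 'I_n]%SET = 0.
  apply/ffunP => S; rewrite [RHS]ffunE; have [->//|ST] := eqVneq S [set: 'I_n]%SET.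
  apply: (@ext_degree_coframe f f1 [set: 'I_n]%SET).
  by apply: contra ST => /eqP cS; rewrite eqEcard subsetT cS leqnn.
have wf s : size s = n -> word f s = 0.
  by move=> /(word_full f1)[c ->]; rewrite f0 scaler0.
(* The induction trades the last coordinate covector of the left word for combinations of covectors
   [f j] at the head of the right word. *)
have spn s s' : (size s + size s')%N = n -> word (dx R) s \w word f s' = 0.
  elim/last_ind: s s' => [|s i IHs] s' ss'; first by rewrite (wf s') ?ext_wedge0r.
  rewrite -cats1 word_cat word_cons word_nil ext_wedge1r -ext_wedgeA E.
  rewrite ext_wedge_suml ext_wedge_sumr big1 // => j _.
  rewrite ext_wedgeZl ext_wedgeZr -word_cons IHs ?scaler0 //=.
  by rewrite size_rcons in ss'; rewrite addnS.
have [c' c'0 /(_ [set: 'I_n]%SET)] := @word_dx_neq0 (enum 'I_n) (enum_uniq _).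
have := spn (enum 'I_n) [::]; rewrite word_nil ext_wedge1r size_enum_ord addn0.
move=> ->//.
rewrite ffunE (_ : [set i in enum 'I_n]%SET = [set: 'I_n]%SET).
  by rewrite eqxx mulr1 => /esym/eqP; rewrite (negPf c'0).
by apply/setP => i; rewrite !inE mem_enum.
Qed.

Section Hodge.
Variables (f : 'I_n -> ext R n) (o : ext R n).
Hypothesis f1 : forall i, ext_degree 1 (f i).

Lemma is_hodge_dualD a b a' b' :
  is_hodge_dual f o a b -> is_hodge_dual f o a' b' ->
  is_hodge_dual f o (a + a') (b + b').
Proof.
move=> [c [-> ->]] [c' [-> ->]]; exists (fun S => c S + c' S); split.
  by rewrite -big_split; apply: eq_bigr => S _; rewrite scalerDl.
by rewrite -big_split; apply: eq_bigr => S _; rewrite mulrDr scalerDl.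
Qed.

Lemma is_hodge_dualZ x a b :
  is_hodge_dual f o a b -> is_hodge_dual f o (x *: a) (x *: b).
Proof.
move=> [c [-> ->]]; exists (fun S => x * c S); split.
  by rewrite scaler_sumr; apply: eq_bigr => S _; rewrite scalerA.
rewrite scaler_sumr; apply: eq_bigr => S _; rewrite scalerA; congr (_ *: _).
by ring.
Qed.

Lemma is_hodge_dual_basis S :
  is_hodge_dual f o (coframe_wedge f S)
    ((Num.sg (o [set: 'I_n]%SET * coframe_wedge f [set: 'I_n]%SET [set: 'I_n]%SET) *
      shuffle_sign S (~: S)%SET) *: coframe_wedge f (~: S)%SET).
Proof.
exists (fun T => (T == S)%:R); split.
  rewrite (bigD1 S) //= eqxx scale1r big1 ?addr0 // => T /negPf ->.
  by rewrite scale0r.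
rewrite (bigD1 S) //= eqxx mulr1 big1 ?addr0 // => T /negPf ->.
by rewrite mulr0 scale0r.
Qed.

(** [is_hodge_dual] only asserts that coefficients exist, so they must be shown unique. The
    coefficient of [S] is recovered by wedging with the complementary product and reading the top
    component; any other [T] contributes zero, by its degree or by a repeated covector. *)
Lemma is_hodge_dual_unique a b b' :
  coframe_wedge f [set: 'I_n]%SET [set: 'I_n]%SET != 0 ->
  is_hodge_dual f o a b -> is_hodge_dual f o a b' -> b = b'.
Proof.
move=> f0 [c [Ea ->]] [c' [Ea' ->]] {b b'}.
have comp S : exists b : bool, forall x : {set 'I_n} -> R,
    ((\sum_T x T *: coframe_wedge f T) \w coframe_wedge f (~: S)%SET) [set: 'I_n]%SET =
    (-1) ^+ b * x S * coframe_wedge f [set: 'I_n]%SET [set: 'I_n]%SET.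
  have [b Eb] := coframe_wedge_compl f1 S; exists b => x.
  rewrite ext_wedge_suml (bigD1 S) //= ext_wedgeZl Eb ext_addE !ext_scaleE.
  rewrite sum_ffunE big1 ?addr0 => [|T TS]; first by rewrite mulrCA mulrA.
  rewrite ext_wedgeZl ext_scaleE; apply/eqP; rewrite mulf_eq0; apply/orP; right.
  have [TSc|TSc] := boolP (#|T| + #|(~: S)%SET| == #|[set: 'I_n]%SET|)%N; last first.
    have D := ext_degree_wedge (@ext_degree_coframe f f1 T) (@ext_degree_coframe f f1 (~: S)%SET).
    apply/eqP; apply: D.
    by rewrite eq_sym.
  have /subsetPn[i iT iS] : ~~ (T \subset S).
    apply: contra TS => TS; rewrite eqEcard TS /=.
    by move: TSc; rewrite cardsT -(cardsC S) eqn_add2r => /eqP ->.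
  rewrite !coframe_wedgeE -word_cat word_nuniq ?ffunE //.
  rewrite cat_uniq !negb_and negbK; apply/orP; right; apply/orP; left.
  by apply/hasP; exists i; rewrite /= mem_enum ?inE.
apply: eq_bigr => S _; congr (_ * _ *: _).
have [b Eb] := comp S; apply: (mulfI (negbT (signr_eq0 R b))); apply: (mulIf f0).
by rewrite -!Eb -Ea -Ea'.
Qed.
End Hodge.

End ExtAlgebra.

Section HodgeWords.
Context {R : realType} (m : nat).
Import mathcomp.boot.fintype mathcomp.boot.finset.
Local Close Scope classical_set_scope.
Variables (f : 'I_m.+1 -> ext R m.+1) (o : ext R m.+1).
Hypothesis f1 : forall i, ext_degree 1 (f i).

(** Covectors are addressed by natural numbers so that complements, signs and products over explicit
    index lists reduce by computation. *)
Definition nword (L : seq nat) : ext R m.+1 :=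
  \big[@ext_wedge R m.+1/ext_const m.+1 1]_(k <- L) f (inord k).

Definition nsign (L L' : seq nat) : R :=
  \prod_(k <- L) \prod_(l <- L') (if (l < k)%N then -1 else 1).

Lemma enum_ord_pred (P : pred nat) :
  enum [set i : 'I_m.+1 | P i] = [seq inord k | k <- [seq k <- iota 0 m.+1 | P k]].
Proof.
apply: (inj_map val_inj); rewrite -map_comp -[LHS]map_id.
rewrite [RHS](_ : _ = [seq k | k <- [seq k <- iota 0 m.+1 | P k]]); last first.
  apply/eq_in_map => k; rewrite mem_filter mem_iota add0n => /andP[_ /andP[_ km]].
  by rewrite /= inordK.
rewrite !map_id -val_enum_ord filter_map; congr map.
by rewrite /enum_mem -filter_predI; apply: eq_filter => i; rewrite /= !inE andbT.
Qed.

Lemma coframe_wedge_nword (P : pred nat) :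
  coframe_wedge f [set i : 'I_m.+1 | P i] = nword [seq k <- iota 0 m.+1 | P k].
Proof. by rewrite /coframe_wedge enum_ord_pred big_map. Qed.

Lemma shuffle_sign_nsign (P : pred nat) :
  shuffle_sign [set i : 'I_m.+1 | P i] (~: [set i : 'I_m.+1 | P i]) =
  nsign [seq k <- iota 0 m.+1 | P k] [seq k <- iota 0 m.+1 | ~~ P k].
Proof.
have -> : ~: [set i : 'I_m.+1 | P i] = [set i : 'I_m.+1 | ~~ P i].
  by apply/setP => i; rewrite !inE.
rewrite shuffle_signE -big_enum enum_ord_pred big_map /nsign.
apply: eq_big_seq => k; rewrite mem_filter mem_iota add0n => /and3P[_ _ km].
rewrite -big_enum (enum_ord_pred (fun k => ~~ P k)) big_map.
apply: eq_big_seq => l; rewrite mem_filter mem_iota add0n => /and3P[_ _ lm].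
by rewrite /cross_sign !inordK.
Qed.

Lemma is_hodge_dual_nword (P : pred nat) :
  is_hodge_dual f o (nword [seq k <- iota 0 m.+1 | P k])
    ((Num.sg (o [set: 'I_m.+1] * nword (iota 0 m.+1) [set: 'I_m.+1]) *
      nsign [seq k <- iota 0 m.+1 | P k] [seq k <- iota 0 m.+1 | ~~ P k]) *:
      nword [seq k <- iota 0 m.+1 | ~~ P k]).
Proof.
have := @is_hodge_dual_basis R _ f o [set i : 'I_m.+1 | P i].
rewrite coframe_wedge_nword shuffle_sign_nsign.
have -> : ~: [set i : 'I_m.+1 | P i] = [set i : 'I_m.+1 | ~~ P i].
  by apply/setP => i; rewrite !inE.
have -> : coframe_wedge f [set: 'I_m.+1] = nword (iota 0 m.+1).
  rewrite (_ : [set: 'I_m.+1] = [set i : 'I_m.+1 | predT (val i)]).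
    by rewrite coframe_wedge_nword filter_predT.
  by apply/setP => i; rewrite !inE.
by rewrite (coframe_wedge_nword (fun k => ~~ P k)).
Qed.

End HodgeWords.

(** * Linear algebra of the Spin(7) form in an adapted coframe *)

Section Spin7Algebra.
Context {R : realType}.
Import mathcomp.boot.fintype mathcomp.boot.finset.
Local Close Scope classical_set_scope.
Variables (f : 'I_8 -> ext R 8).
Hypothesis f1 : forall i, ext_degree 1 (f i).
Local Notation e k := (f (inord k)).

Lemma anti2 i j : f i \w f j = - (f j \w f i).
Proof. exact: degree1_wedgeC. Qed.

Lemma anti3 i j x : f i \w (f j \w x) = - (f j \w (f i \w x)).
Proof. by rewrite !ext_wedgeA anti2 ext_wedgeNl. Qed.

Lemma sq2 i : f i \w f i = 0.
Proof. exact: degree1_wedge_sq. Qed.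

Lemma sq3 i x : f i \w (f i \w x) = 0.
Proof. by rewrite ext_wedgeA sq2 ext_wedge0l. Qed.

Definition wedge_lin := (@ext_wedgeDl R 8, @ext_wedgeDr R 8, @ext_wedgeNl R 8,
  @ext_wedgeNr R 8, @ext_wedgeZl R 8, @ext_wedgeZr R 8, @ext_wedge0l R 8, @ext_wedge0r R 8).

Definition sd (j : nat) : ext R 8 :=
  match j with
  | 0 => e 4 \w e 5 + e 6 \w e 7
  | 1 => e 4 \w e 6 + e 7 \w e 5
  | _ => e 4 \w e 7 + e 5 \w e 6
  end.

Definition vol4 := e 4 \w (e 5 \w (e 6 \w e 7)).

(** A terminating rewrite system for words in e4, ..., e7: neighbours in decreasing order are
    exchanged and squares are killed. *)
Let sort4 := (anti2 (inord 5) (inord 4), anti2 (inord 6) (inord 4), anti2 (inord 7) (inord 4),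
  anti2 (inord 6) (inord 5), anti2 (inord 7) (inord 5), anti2 (inord 7) (inord 6),
  anti3 (inord 5) (inord 4), anti3 (inord 6) (inord 4), anti3 (inord 7) (inord 4),
  anti3 (inord 6) (inord 5), anti3 (inord 7) (inord 5), anti3 (inord 7) (inord 6), sq2, sq3).

Lemma sd_wedge i j : (i < 3)%N -> (j < 3)%N ->
  sd i \w sd j = (2 * (i == j)%:R) *: vol4.
Proof.
case: i => [|[|[|//]]] _; case: j => [|[|[|//]]] _;
  rewrite /sd ?wedge_lin -!ext_wedgeA;
  rewrite ?(sort4, wedge_lin, opprK, oppr0, addr0, add0r, mulr0, scale0r, addNr, subrr) //=
    mulr1 /vol4 scalerDl scale1r.
all: by [].
Qed.

Variable r : nat -> nat -> R.
Hypothesis r_orth : forall i k, (i < 3)%N -> (k < 3)%N ->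
  r i 0%N * r k 0%N + r i 1%N * r k 1%N + r i 2%N * r k 2%N = (i == k)%:R.

(** At a point of E the forms omega_i are, up to scale, the standard self-dual basis turned by the
    rotation that conjugation by the unit fibre coordinate induces. The algebra uses only that the
    rows of [r] are orthonormal. *)
Definition rsd i := r i 0%N *: sd 0 + r i 1%N *: sd 1 + r i 2%N *: sd 2.

Lemma two_commute i j x k : f i \w f j \w f k = f k \w (f i \w f j) /\
  f i \w f j \w (f k \w x) = f k \w (f i \w f j \w x).
Proof.
have E : f i \w f j \w f k = f k \w (f i \w f j).
  by rewrite -ext_wedgeA (anti2 j) ext_wedgeNr (anti3 i) opprK.
by split=> //; rewrite ext_wedgeA E -ext_wedgeA.
Qed.

Lemma sdC i k : sd i \w f k = f k \w sd i.
Proof.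
by case: i => [|[|i]]; rewrite /sd !wedge_lin; congr (_ + _); apply (two_commute _ _ 0).
Qed.

Lemma rsdC i k : rsd i \w f k = f k \w rsd i.
Proof.
rewrite /rsd; move: (sdC 0 k) (sdC 1 k) (sdC 2 k).
by move: (sd 0) (sd 1) (sd 2) => s0 s1 s2 E0 E1 E2; rewrite !wedge_lin E0 E1 E2.
Qed.

Lemma rsd_wedge i k : (i < 3)%N -> (k < 3)%N ->
  rsd i \w rsd k = (2 * (i == k)%:R) *: vol4.
Proof.
move=> i3 k3; rewrite -(r_orth i3 k3) /rsd.
have := (@sd_wedge 0 0 isT isT, @sd_wedge 0 1 isT isT, @sd_wedge 0 2 isT isT,
  @sd_wedge 1 0 isT isT, @sd_wedge 1 1 isT isT, @sd_wedge 1 2 isT isT,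
  @sd_wedge 2 0 isT isT, @sd_wedge 2 1 isT isT, @sd_wedge 2 2 isT isT).
move: (sd 0) (sd 1) (sd 2) => s0 s1 s2 /= E; rewrite !wedge_lin !E.
by apply/ffunP => S; rewrite !(ext_addE, ext_scaleE); ring.
Qed.

Lemma vol4C k : vol4 \w f k = f k \w vol4.
Proof.
rewrite /vol4 -!ext_wedgeA (anti2 (inord 7)) !ext_wedgeNr (anti3 (inord 6)).
by rewrite !ext_wedgeNr opprK (anti3 (inord 5)) ext_wedgeNr (anti3 (inord 4)) opprK.
Qed.

Lemma sd_vol4 i : sd i \w vol4 = 0.
Proof.
case: i => [|[|i]]; rewrite /sd /vol4 !wedge_lin -!ext_wedgeA;
  by rewrite ?(sort4, wedge_lin, opprK, oppr0, addr0, add0r).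
Qed.

Lemma rsd_vol4 i : rsd i \w vol4 = 0.
Proof.
rewrite /rsd; move: (sd_vol4 0) (sd_vol4 1) (sd_vol4 2).
move: (sd 0) (sd 1) (sd 2) => s0 s1 s2 E0 E1 E2.
by rewrite !wedge_lin E0 E1 E2 !scaler0 !addr0.
Qed.

Lemma vol4_rsd i : vol4 \w rsd i = 0.
Proof.
have volC a b : f a \w f b \w vol4 = vol4 \w (f a \w f b).
  by rewrite -ext_wedgeA -vol4C ext_wedgeA -vol4C -ext_wedgeA.
suff -> : vol4 \w rsd i = rsd i \w vol4 by rewrite rsd_vol4.
by rewrite /rsd /sd !wedge_lin !volC.
Qed.

Lemma vol4_sq : vol4 \w vol4 = 0.
Proof. by rewrite {1}/vol4 -!ext_wedgeA /vol4 ?(sort4, wedge_lin, oppr0). Qed.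

End Spin7Algebra.

Section Spin7Form.
Context {R : realType}.
Variables (f : 'I_8 -> ext R 8) (W : nat -> ext R 8) (vol : ext R 8).
Hypothesis f1 : forall i, ext_degree 1 (f i).
Hypothesis WC : forall i k, W i \w f k = f k \w W i.
Hypothesis W_wedge : forall i k, (i < 3)%N -> (k < 3)%N ->
  W i \w W k = (2 * (i == k)%:R) *: vol.
Hypothesis volC : forall k, vol \w f k = f k \w vol.
Hypothesis W_vol : forall i, W i \w vol = 0.
Hypothesis vol_W : forall i, vol \w W i = 0.
Hypothesis vol_sq : vol \w vol = 0.
Local Notation e k := (f (inord k)).

(** The self-dual forms enter through their multiplication table alone. Products stay short because
    the [W i] are never expanded, and the computation can be reused after a cyclic relabelling. *)
Definition phi_alg : ext R 8 := e 1 \w (e 2 \w e 3) -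
  (e 1 \w W 0 + e 2 \w W 1 + e 3 \w W 2).

Definition psi_alg : ext R 8 :=
  6^-1 *: (W 0 \w W 0 + W 1 \w W 1 + W 2 \w W 2) -
  (e 1 \w e 2 \w W 2 + e 2 \w e 3 \w W 0 + e 3 \w e 1 \w W 1).

Definition Theta_alg : ext R 8 := e 0 \w phi_alg + psi_alg.

Lemma psi_algE : psi_alg = vol -
  (e 1 \w (e 2 \w W 2) + e 2 \w (e 3 \w W 0) + e 3 \w (e 1 \w W 1)).
Proof.
rewrite /psi_alg !W_wedge // -!ext_wedgeA mulr1; congr (_ - _).
by apply/ffunP => S; rewrite !(ext_addE, ext_scaleE); field.
Qed.

Lemma WC3 i k x : W i \w (f k \w x) = f k \w (W i \w x).
Proof. by rewrite ext_wedgeA WC -ext_wedgeA. Qed.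

Lemma volC3 k x : vol \w (f k \w x) = f k \w (vol \w x).
Proof. by rewrite ext_wedgeA volC -ext_wedgeA. Qed.

Let sort0 := (anti2 f1 (inord 1) (inord 0), anti2 f1 (inord 2) (inord 0), anti2 f1 (inord 3) (inord 0),
  anti2 f1 (inord 2) (inord 1), anti2 f1 (inord 3) (inord 1), anti2 f1 (inord 3) (inord 2),
  anti3 f1 (inord 1) (inord 0), anti3 f1 (inord 2) (inord 0), anti3 f1 (inord 3) (inord 0),
  anti3 f1 (inord 2) (inord 1), anti3 f1 (inord 3) (inord 1), anti3 f1 (inord 3) (inord 2), sq2 f1, sq3 f1,
  WC, WC3, volC, volC3, W_vol, vol_W, vol_sq, @W_wedge 0 0 isT isT,
  @W_wedge 0 1 isT isT, @W_wedge 0 2 isT isT, @W_wedge 1 0 isT isT, @W_wedge 1 1 isT isT,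
  @W_wedge 1 2 isT isT, @W_wedge 2 0 isT isT, @W_wedge 2 1 isT isT, @W_wedge 2 2 isT isT).

(** What matters is that 14 is positive: the orientation given by the square of the form agrees with
    that of the coframe, so the sign in [is_hodge_dual] is 1. *)
Lemma Theta_alg_sq : Theta_alg \w Theta_alg =
  14 *: (e 0 \w (e 1 \w (e 2 \w (e 3 \w vol)))).
Proof.
rewrite /Theta_alg /phi_alg psi_algE !wedge_lin -!ext_wedgeA.
rewrite ?(sort0, wedge_lin) /= ?(scaler0, oppr0, addr0, add0r, ext_wedge0r, ext_wedge0l) ?(sort0, wedge_lin) /= ?(scaler0, oppr0, addr0, add0r, ext_wedge0r, ext_wedge0l).
by apply/ffunP => S; rewrite !(ext_addE, ext_scaleE, ext_oppE); ring.
Qed.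

Lemma wedge_Theta_alg p b c :
  (p *: (e 0 \w e 1) + b *: W 0 + c *: (e 2 \w e 3)) \w Theta_alg =
  (p - 2 * b) *: (e 0 \w (e 1 \w vol)) + (c - 2 * b) *: (e 2 \w (e 3 \w vol)) +
  (- p + b - c) *: (e 0 \w (e 1 \w (e 2 \w (e 3 \w W 0)))).
Proof.
rewrite /Theta_alg /phi_alg psi_algE !wedge_lin -!ext_wedgeA.
rewrite ?(sort0, wedge_lin) /= ?(scaler0, oppr0, addr0, add0r, ext_wedge0r, ext_wedge0l) ?(sort0, wedge_lin) /= ?(scaler0, oppr0, addr0, add0r, ext_wedge0r, ext_wedge0l).
by apply/ffunP => S; rewrite !(ext_addE, ext_scaleE, ext_oppE); ring.
Qed.

(** The dual of [F] minus the candidate dual is (p + c - 2b)(A + B - C) for the three five- or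
    six-fold products named in the proof. The coframe [g] that defines the dual is kept apart from
    [f], since [f] will be a cyclic relabelling of it. *)
Lemma hodge_Theta_alg (g : 'I_8 -> ext R 8) o p b c :
  let F := p *: (e 0 \w e 1) + b *: W 0%N + c *: (e 2 \w e 3) in
  (forall i, ext_degree 1 (g i)) ->
  coframe_wedge g [set: 'I_8]%SET [set: 'I_8]%SET != 0 ->
  e 0 \w (e 1 \w (e 2 \w (e 3 \w vol))) != 0 ->
  is_hodge_dual g o F (c *: (e 0 \w (e 1 \w vol)) + p *: (e 2 \w (e 3 \w vol)) +
    b *: (e 0 \w (e 1 \w (e 2 \w (e 3 \w W 0%N))))) ->
  is_hodge_dual g o F (- (F \w Theta_alg)) <-> p + c = 2 * b.
Proof.
move=> F g1 g0 top0 FD; rewrite /F wedge_Theta_alg; split=> [FD'|pc].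
  have := is_hodge_dual_unique g1 g0 FD FD'.
  set A := e 0 \w _; set B := e 2 \w (e 3 \w vol); set C := e 0 \w _ => E.
  have : (p + c - 2 * b) *: (A + B - C) = 0.
    apply/ffunP => S; move/(congr1 (fun a : ext R 8 => a S)): E.
    rewrite !(ext_addE, ext_scaleE, ext_oppE) => E.
    by rewrite [RHS]ffunE; apply/eqP; rewrite -subr_eq0; apply/eqP; move: E; lra.
  (* This factor kills B and C by repetition and completes A to the volume form, which is
     nonzero. *)
  move/(congr1 (fun a => a \w (e 2 \w e 3))).
  rewrite ext_wedge0l ext_wedgeZl !ext_wedgeDl ext_wedgeNl.
  have -> : A \w (e 2 \w e 3) = e 0 \w (e 1 \w (e 2 \w (e 3 \w vol))).
    by rewrite /A -!ext_wedgeA volC3 volC.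
  have -> : B \w (e 2 \w e 3) = 0.
    by rewrite /B -!ext_wedgeA volC3 volC (anti3 f1 (inord 3)) !(ext_wedgeNr, sq3 f1, oppr0).
  have -> : C \w (e 2 \w e 3) = 0.
    rewrite /C -!ext_wedgeA WC3 WC (anti3 f1 (inord 3)) !ext_wedgeNr.
    by rewrite (sq3 f1 (inord 2)) !(ext_wedge0r, oppr0).
  rewrite subr0 addr0 => /eqP; rewrite scaler_eq0 (negPf top0) orbF subr_eq0.
  by move/eqP.
have -> : p = 2 * b - c by rewrite -pc addrK.
move: FD; congr is_hodge_dual; first by rewrite /F -pc addrK.
rewrite -pc; apply/ffunP => S; rewrite !(ext_addE, ext_scaleE, ext_oppE).
by rewrite (_ : b = (p + c) / 2); [field|rewrite pc; field].
Qed.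

End Spin7Form.

Section Spin7Hodge.
Context {R : realType}.
Import mathcomp.boot.fintype mathcomp.boot.finset.
Local Close Scope classical_set_scope.
Variables (f : 'I_8 -> ext R 8) (r : nat -> nat -> R).
Hypothesis f1 : forall i, ext_degree 1 (f i).
Hypothesis r_orth : forall i k, (i < 3)%N -> (k < 3)%N ->
  r i 0%N * r k 0%N + r i 1%N * r k 1%N + r i 2%N * r k 2%N = (i == k)%:R.
Hypothesis f_top : coframe_wedge f [set: 'I_8]%SET [set: 'I_8]%SET != 0.
Local Notation e k := (f (inord k)).
Local Notation W := (rsd f r).
Local Notation Theta := (Theta_alg f W).

Lemma coframe_top : coframe_wedge f [set: 'I_8]%SET = e 0 \w (e 1 \w (e 2 \w (e 3 \w vol4 f))).
Proof.
rewrite (_ : [set: 'I_8] = [set i : 'I_8 | predT (val i)]).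
  by rewrite coframe_wedge_nword filter_predT /nword /= !big_cons big_nil ext_wedge1r.
by apply/setP => i; rewrite !inE.
Qed.

Lemma top_neq0 : e 0 \w (e 1 \w (e 2 \w (e 3 \w vol4 f))) != 0.
Proof. by rewrite -coframe_top; apply: contraNneq f_top => ->; rewrite ffunE. Qed.

Let o := Theta \w Theta.

Lemma sg_Theta : Num.sg (o [set: 'I_8] * nword f (iota 0 8) [set: 'I_8]) = 1.
Proof.
have E : nword f (iota 0 8) = coframe_wedge f [set: 'I_8].
  by rewrite coframe_top /nword /= !big_cons big_nil ext_wedge1r.
rewrite /o (Theta_alg_sq f1 (rsdC f1 r) (rsd_wedge f1 r_orth) (vol4C f1) (rsd_vol4 f1 r) (vol4_rsd f1 r) (vol4_sq f1)).
rewrite E -coframe_top ext_scaleE -mulrA gtr0_sg // mulr_gt0 //.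
by rewrite -expr2 exprn_even_gt0.
Qed.

Lemma hodge_pair (P : pred nat) :
  is_hodge_dual f o (nword f [seq k <- iota 0 8 | P k])
    (nsign [seq k <- iota 0 8 | P k] [seq k <- iota 0 8 | ~~ P k] *:
      nword f [seq k <- iota 0 8 | ~~ P k]).
Proof. by have := is_hodge_dual_nword f o P; rewrite sg_Theta mul1r. Qed.

Ltac hodge_by L :=
  have := hodge_pair (mem L);
  rewrite /nword /nsign /= !big_cons !big_nil !ext_wedge1r /=
    !(mulr1, mul1r, mulrNN, mulrN1, opprK).

Lemma hodge_e0 : [/\ is_hodge_dual f o (e 0 \w e 1) (e 2 \w (e 3 \w vol4 f)),
  is_hodge_dual f o (e 0 \w e 2) (e 3 \w (e 1 \w vol4 f)) &
  is_hodge_dual f o (e 0 \w e 3) (e 1 \w (e 2 \w vol4 f))].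
Proof.
split.
- by hodge_by [:: 0; 1]%N; rewrite scale1r.
- by hodge_by [:: 0; 2]%N; rewrite scaleN1r (anti3 f1 (inord 3) (inord 1)).
- by hodge_by [:: 0; 3]%N; rewrite scale1r.
Qed.

Lemma hodge_e123 : [/\ is_hodge_dual f o (e 2 \w e 3) (e 0 \w (e 1 \w vol4 f)),
  is_hodge_dual f o (e 3 \w e 1) (e 0 \w (e 2 \w vol4 f)) &
  is_hodge_dual f o (e 1 \w e 2) (e 0 \w (e 3 \w vol4 f))].
Proof.
split.
- by hodge_by [:: 2; 3]%N; rewrite scale1r.
- hodge_by [:: 1; 3]%N => h; rewrite (anti2 f1 (inord 3)).
  by have := is_hodge_dualZ (-1) h; rewrite !scaleN1r opprK.
- by hodge_by [:: 1; 2]%N; rewrite scale1r.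
Qed.

Lemma hodge_sd i : (i < 3)%N -> is_hodge_dual f o (sd f i)
  (e 0 \w (e 1 \w (e 2 \w (e 3 \w sd f i)))).
Proof.
case: i => [|[|[|//]]] _; rewrite /sd !ext_wedgeDr addrC; apply: is_hodge_dualD.
- by hodge_by [:: 6; 7]%N; rewrite scale1r.
- by hodge_by [:: 4; 5]%N; rewrite scale1r.
- hodge_by [:: 5; 7]%N => h; rewrite (anti2 f1 (inord 7)).
  by have := is_hodge_dualZ (-1) h; rewrite !scaleN1r opprK.
- by hodge_by [:: 4; 6]%N; rewrite scaleN1r (anti2 f1 (inord 7) (inord 5)) !ext_wedgeNr.
- by hodge_by [:: 5; 6]%N; rewrite scale1r.
- by hodge_by [:: 4; 7]%N; rewrite scale1r.
Qed.

Lemma hodge_rsd i : is_hodge_dual f o (W i) (e 0 \w (e 1 \w (e 2 \w (e 3 \w W i)))).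
Proof.
rewrite /rsd; move: (hodge_sd (isT : 0 < 3)%N) (hodge_sd (isT : 1 < 3)%N) (hodge_sd (isT : 2 < 3)%N).
move: (sd f 0) (sd f 1) (sd f 2) => s0 s1 s2 h0 h1 h2.
rewrite !(ext_wedgeDr, ext_wedgeZr).
by apply: is_hodge_dualD; first apply: is_hodge_dualD; exact: is_hodge_dualZ.
Qed.

Definition cyc3 (i : nat) : nat := nth 0%N [:: 1; 2; 0]%N i.
Definition cyc8 (g : 'I_8 -> ext R 8) (i : 'I_8) : ext R 8 :=
  g (inord (nth 0%N [:: 0; 2; 3; 1; 4; 5; 6; 7]%N i)).

(** Rotating (e1, e2, e3) together with (W0, W1, W2) leaves the form unchanged, so that the second
    and third curvature components reduce to the first. *)
Lemma Theta_alg_cyc (g : 'I_8 -> ext R 8) (w : nat -> ext R 8) :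
  (forall i, ext_degree 1 (g i)) ->
  Theta_alg (cyc8 g) (w \o cyc3) = Theta_alg g w.
Proof.
move=> g1; rewrite /Theta_alg /phi_alg /psi_alg /cyc8 !inordK //= /cyc3 /=.
rewrite -!ext_wedgeA.
congr (_ \w (_ - _) + (_ *: _ - _)).
- by rewrite (anti2 g1 (inord 3)) ext_wedgeNr (anti3 g1 (inord 2)) opprK.
- by rewrite addrC addrA.
- by rewrite addrC addrA.
- by rewrite addrC addrA.
Qed.

Lemma hodge_instanton i p b c : (i < 3)%N ->
  let F := p *: (e 0 \w e i.+1) + b *: W i + c *: (e (cyc3 i).+1 \w e (cyc3 (cyc3 i)).+1) in
  is_hodge_dual f o F (- (F \w Theta)) <-> p + c = 2 * b.
Proof.
have [h01 h02 h03] := hodge_e0; have [h23 h31 h12] := hodge_e123.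
have hF x y z a b' d a' b'' d' : is_hodge_dual f o a a' -> is_hodge_dual f o b' b'' ->
    is_hodge_dual f o d d' ->
    is_hodge_dual f o (x *: a + y *: b' + z *: d) (z *: d' + x *: a' + y *: b'').
  move=> ha hb hd; rewrite addrC addrA; apply: is_hodge_dualD; last exact: is_hodge_dualZ.
  by apply: is_hodge_dualD; exact: is_hodge_dualZ.
case: i => [|[|[|//]]] _.
- have H := hodge_Theta_alg f1 (rsdC f1 r) (rsd_wedge f1 r_orth) (vol4C f1) (rsd_vol4 f1 r)
    f1 f_top top_neq0.
  by apply: H; apply: hF => //; exact: hodge_rsd.
- have g1 k : ext_degree 1 (cyc8 f k) by exact: f1.
  have WC k l : (W \o cyc3) k \w cyc8 f l = cyc8 f l \w (W \o cyc3) k by exact: rsdC.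
  have WW k l : (k < 3)%N -> (l < 3)%N ->
      (W \o cyc3) k \w (W \o cyc3) l = (2 * (k == l)%:R) *: vol4 f.
    case: k => [|[|[|//]]] _; case: l => [|[|[|//]]] _; exact: (rsd_wedge f1 r_orth).
  have VC k : vol4 f \w cyc8 f k = cyc8 f k \w vol4 f by exact: vol4C.
  have WV k : (W \o cyc3) k \w vol4 f = 0 by exact: rsd_vol4.
  have H := hodge_Theta_alg (o := o) (p := p) (b := b) (c := c) g1 WC WW VC WV f1 f_top.
  rewrite Theta_alg_cyc // /cyc8 !inordK //= in H.
  apply: H.
    by rewrite (anti3 f1 (inord 3) (inord 1)) ext_wedgeNr (anti3 f1 (inord 2) (inord 1)) !ext_wedgeNr opprK top_neq0.
  apply: hF => //.
  have := hodge_rsd 1; rewrite (anti3 f1 (inord 3) (inord 1)) !ext_wedgeNr.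
  by rewrite (anti3 f1 (inord 2) (inord 1)) ext_wedgeNr opprK.
- have g1' k : ext_degree 1 (cyc8 f k) by exact: f1.
  have g1 k : ext_degree 1 (cyc8 (cyc8 f) k) by exact: f1.
  have WC k l : (W \o cyc3 \o cyc3) k \w cyc8 (cyc8 f) l = cyc8 (cyc8 f) l \w (W \o cyc3 \o cyc3) k by exact: rsdC.
  have WW k l : (k < 3)%N -> (l < 3)%N ->
      (W \o cyc3 \o cyc3) k \w (W \o cyc3 \o cyc3) l = (2 * (k == l)%:R) *: vol4 f.
    case: k => [|[|[|//]]] _; case: l => [|[|[|//]]] _; exact: (rsd_wedge f1 r_orth).
  have VC k : vol4 f \w cyc8 (cyc8 f) k = cyc8 (cyc8 f) k \w vol4 f by exact: vol4C.
  have WV k : (W \o cyc3 \o cyc3) k \w vol4 f = 0 by exact: rsd_vol4.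
  have H := hodge_Theta_alg (o := o) (p := p) (b := b) (c := c) g1 WC WW VC WV f1 f_top.
  rewrite !Theta_alg_cyc // /cyc8 !inordK //= in H.
  apply: H.
    by rewrite (anti3 f1 (inord 3) (inord 1)) (anti3 f1 (inord 3) (inord 2)) !ext_wedgeNr opprK top_neq0.
  apply: hF => //.
  have := hodge_rsd 2.
  by rewrite (anti3 f1 (inord 3) (inord 1)) (anti3 f1 (inord 3) (inord 2)) !ext_wedgeNr opprK.
Qed.

End Spin7Hodge.

(** * Smooth functions and forms *)

Section DeriveRules.
Context {R : realType} {V : normedModType R}.
Implicit Types (f g : V -> R) (x v : V).

Lemma isdD f g x v (df dg : R) : is_derive x v f df -> is_derive x v g dg ->
  is_derive x v (fun y => f y + g y) (df + dg).
Proof. by move=> fx gx; apply: is_deriveD. Qed.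

Lemma isdM f g x v (df dg : R) : is_derive x v f df -> is_derive x v g dg ->
  is_derive x v (fun y => f y * g y) (df * g x + f x * dg).
Proof.
move=> fx gx; rewrite addrC [df * _]mulrC.
exact: (is_deriveM fx gx).
Qed.

Lemma isdN f x v (df : R) : is_derive x v f df ->
  is_derive x v (fun y => - f y) (- df).
Proof. by move=> fx; apply: is_deriveN. Qed.

Lemma isdB f g x v (df dg : R) : is_derive x v f df -> is_derive x v g dg ->
  is_derive x v (fun y => f y - g y) (df - dg).
Proof. by move=> fx gx; apply: isdD => //; exact: isdN. Qed.

Lemma isdV f x v (df : R) : f x != 0 -> is_derive x v f df ->
  is_derive x v (fun y => (f y)^-1) (- df / f x ^+ 2).
Proof.
move=> f0 fx; split; first exact: (derivableV f0 ex_derive).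
by rewrite (deriveV f0 ex_derive) derive_val /GRing.scale /= mulNr mulrC mulNr.
Qed.

Lemma isd_cst (c : R) x v : is_derive x v (fun=> c) 0.
Proof. exact: is_derive_cst. Qed.

(** Turns a directional derivative into a derivative in one variable. Chain rules for an outer real
    function or an inner linear map then need derivatives along the given directions only. *)
Lemma isd_line f x v (df : R) : is_derive x v f df <->
  is_derive (0 : R) (1 : R) (fun h => f (h *: v + x)) df.
Proof.
have E : (fun h : R => h^-1 *: ((fun h => f (h *: v + x)) \o shift 0) (h *: 1)
    - h^-1 *: (f (0 *: v + x))) = fun h => h^-1 *: ((f \o shift x) (h *: v)) - h^-1 *: f x.
  by apply/funext => h /=; rewrite addr0 scale0r add0r [h *: 1]mulr1.
have {}E : (fun h : R => h^-1 *: (((fun h => f (h *: v + x)) \o shift 0) (h *: 1)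
    - f (0 *: v + x))) = fun h => h^-1 *: ((f \o shift x) (h *: v) - f x).
  by apply/funext => h; rewrite !scalerBr; move/(congr1 (@^~ h)): E.
by split=> -[d e]; split; rewrite /derivable /derive ?E // -?E.
Qed.

Lemma isd_comp (F : R -> R) f x v (a b : R) :
  is_derive (f x) (1 : R) F a -> is_derive x v f b ->
  is_derive x v (fun y => F (f y)) (a * b).
Proof.
move=> Fx /isd_line fx; apply/isd_line.
by apply: (@is_derive1_comp _ F (fun h => f (h *: v + x))) => //; rewrite scale0r add0r.
Qed.

Lemma isd_near f g x v (df : R) : (\forall y \near x, f y = g y) ->
  is_derive x v f df -> is_derive x v g df.
Proof. exact: near_eq_is_derive. Qed.

Lemma isd_unique f x v (a b : R) : is_derive x v f a -> is_derive x v f b -> a = b.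
Proof. by move=> /@derive_val <- /@derive_val <-. Qed.

Lemma isd_eq f x v (a b : R) : is_derive x v f a -> a = b -> is_derive x v f b.
Proof. by move=> fa <-. Qed.

End DeriveRules.

Lemma open_near {T : topologicalType} (D : set T) (P : T -> Prop) x :
  open D -> D x -> (forall y, D y -> P y) -> \forall y \near x, P y.
Proof. by move=> oD Dx DP; near=> y; apply: DP; near: y; exact: open_nbhs_nbhs. Unshelve. all: by end_near. Qed.

Section Ck.
Context {R : realType} {V : normedModType R} {I : Type} (dir : I -> V).
Implicit Types (D : set V) (f g : V -> R).

(** Derivatives are carried as witness functions on [D], for an arbitrary family of directions.
    Closure under sums, products, inverses and composition is then an induction on [n], on the line
    and on R^n alike. *)
Fixpoint Ck (n : nat) D f : Prop :=
  (forall x, D x -> {for x, continuous f}) /\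
  match n with
  | 0 => True
  | m.+1 => forall i, exists2 g, (forall x, D x -> is_derive x (dir i) f (g x)) & Ck m D g
  end.

Lemma Ck_cont n D f x : Ck n D f -> D x -> {for x, continuous f}.
Proof. by case: n => [|n] [c _]; exact: c. Qed.

Lemma CkW n D f : Ck n.+1 D f -> Ck n D f.
Proof.
elim: n f => [|n IHn] f [c d]; split => // i.
by have [g gd /IHn gC] := d i; exists g.
Qed.

Lemma Ck_sub n D D' f : D' `<=` D -> Ck n D f -> Ck n D' f.
Proof.
move=> sD; elim: n f => [|n IHn] f [c d]; split=> //; try by move=> x /sD; exact: c.
move=> i; have [g gd /IHn gC] := d i; exists g => // x /sD; exact: gd.
Qed.

Lemma Ck_eq n D f g : open D -> (forall x, D x -> f x = g x) -> Ck n D f -> Ck n D g.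
Proof.
move=> oD fg; case: n => [|n] [c d]; split=> //.
- move=> x Dx; suff : g y @[y --> x] --> g x by [].
  rewrite -(fg x Dx); apply: cvg_trans (c x Dx).
  by apply: near_eq_cvg; exact: (open_near oD Dx).
- move=> x Dx; suff : g y @[y --> x] --> g x by [].
  rewrite -(fg x Dx); apply: cvg_trans (c x Dx).
  by apply: near_eq_cvg; exact: (open_near oD Dx).
- move=> i; have [h hd hC] := d i; exists h => // x Dx.
  by apply: isd_near (hd x Dx); exact: (open_near oD Dx).
Qed.

Lemma Ck_cst n D (c : R) : Ck n D (fun=> c).
Proof.
elim: n c => [|n IHn] c; split=> //; try by move=> x _; exact: cvg_cst.
by move=> i; exists (fun=> 0) => // x _; exact: isd_cst.
Qed.

Lemma CkD n D f g : Ck n D f -> Ck n D g -> Ck n D (fun x => f x + g x).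
Proof.
elim: n f g => [|n IHn] f g [fc fd] [gc gd]; split=> //;
  try by move=> x Dx; apply: cvgD; [exact: fc|exact: gc].
move=> i; have [f' fd' fC] := fd i; have [g' gd' gC] := gd i.
exists (fun x => f' x + g' x); last exact: IHn.
by move=> x Dx; apply: isdD; [exact: fd'|exact: gd'].
Qed.

Lemma CkM n D f g : Ck n D f -> Ck n D g -> Ck n D (fun x => f x * g x).
Proof.
elim: n f g => [|n IHn] f g fS gS; have [fc fd] := fS; have [gc gd] := gS; split=> //;
  try by move=> x Dx; apply: cvgM; [exact: fc|exact: gc].
move=> i; have [f' fd' fC] := fd i; have [g' gd' gC] := gd i.
exists (fun x => f' x * g x + f x * g' x).
  by move=> x Dx; apply: isdM; [exact: fd'|exact: gd'].
by apply: CkD; apply: IHn => //; exact: CkW.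
Qed.

Lemma CkN n D f : Ck n D f -> Ck n D (fun x => - f x).
Proof.
move=> fC; have := CkM (Ck_cst n D (-1)) fC.
by under [fun x => -1 * _]eq_fun do rewrite mulN1r.
Qed.

Lemma CkB n D f g : Ck n D f -> Ck n D g -> Ck n D (fun x => f x - g x).
Proof. by move=> fC /CkN; exact: CkD. Qed.

Lemma CkX n D f k : Ck n D f -> Ck n D (fun x => f x ^+ k).
Proof.
move=> fC; elim: k => [|k IHk].
  by under [fun x => _ ^+ 0]eq_fun do rewrite expr0; exact: Ck_cst.
by under [fun x => _ ^+ k.+1]eq_fun do rewrite exprS; exact: CkM.
Qed.

Lemma CkV n D f : (forall x, D x -> f x != 0) -> Ck n D f -> Ck n D (fun x => (f x)^-1).
Proof.
move=> f0; elim: n => [|n IHn] fS; have [fc fd] := fS; split=> //;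
  try by move=> x Dx; apply: continuousV; [exact: f0|exact: fc].
move=> i; have [f' fd' fC] := fd i; exists (fun x => - f' x * ((f x)^-1 * (f x)^-1)).
  by move=> x Dx; apply: isd_eq (isdV (f0 x Dx) (fd' x Dx)) _; rewrite -exprVn expr2.
have IH := IHn (CkW fS).
by apply: CkM; [exact: CkN|exact: CkM].
Qed.

End Ck.

Definition Ck1 {R : realType} := @Ck R R unit (fun=> 1).

Lemma Ck1_id {R : realType} n (D : set R) : Ck1 n D (fun r : R => r).
Proof.
case: n => [|n]; split=> //; try by move=> r _; exact: cvg_id.
by case; exists (fun=> 1) => [r _|]; [exact: is_derive_id|exact: Ck_cst].
Qed.

Lemma Ck_comp {R : realType} {V : normedModType R} {I : Type} (dir : I -> V) n
    (D : set V) (U : set R) (F : R -> R) (f : V -> R) :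
  (forall x, D x -> U (f x)) -> Ck1 n U F -> Ck dir n D f ->
  Ck dir n D (fun x => F (f x)).
Proof.
move=> DU; elim: n F => [|n IHn] F FS fS; have [Fc Fd] := FS; have [fc fd] := fS; split=> //.
- by move=> x Dx; apply: continuous_comp; [exact: fc|exact: (Fc _ (DU _ Dx))].
- by move=> x Dx; apply: continuous_comp; [exact: fc|exact: (Fc _ (DU _ Dx))].
move=> i; have [f' fd' fC] := fd i; have [F' Fd' FC] := Fd tt.
exists (fun x => F' (f x) * f' x).
  by move=> x Dx; apply: isd_comp; [exact: (Fd' _ (DU _ Dx))|exact: fd'].
by apply: CkM => //; apply: IHn => //; exact: CkW fS.
Qed.

(** Intended for the projection [base], which sends each coordinate direction to zero or to a
    coordinate direction. *)
Lemma Ck_linear {R : realType} {V V' : normedModType R} {I I' : Type}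
    (dir : I -> V) (dir' : I' -> V') (L : V -> V') n (D' : set V') (f : V' -> R) :
  (forall h v x, L (h *: v + x) = h *: L v + L x) -> continuous L ->
  (forall i, L (dir i) = 0 \/ exists j, L (dir i) = dir' j) ->
  Ck dir' n D' f -> Ck dir n [set x | D' (L x)] (fun x => f (L x)).
Proof.
move=> Llin Lc Ldir; elim: n f => [|n IHn] f [fc fd]; split=> //.
- by move=> x Dx; apply: continuous_comp; [exact: Lc|exact: fc].
- by move=> x Dx; apply: continuous_comp; [exact: Lc|exact: fc].
move=> i; have [Li|[j Li]] := Ldir i.
  exists (fun=> 0); last exact: Ck_cst.
  move=> x Dx; apply/isd_line; under eq_fun do rewrite Llin Li scaler0 add0r.
  exact: isd_cst.
have [g gd gC] := fd j; exists (fun x => g (L x)); last exact: IHn.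
move=> x Dx; apply/isd_line; under eq_fun do rewrite Llin Li.
by apply/(isd_line f (L x) (dir' j) (g (L x))); exact: gd.
Qed.

Section SmoothOn.
Context {R : realType} (n : nat).
Implicit Types (D : set 'rV[R]_n) (f g : 'rV[R]_n -> R).

Lemma iter_partial_rcons s i f :
  iter_partial (rcons s i) f = iter_partial s (fun x => 'D_(basis_vec i) f x).
Proof. by rewrite /iter_partial foldr_rcons. Qed.

Lemma Ck_iter_partial D f m s : open D -> Ck (@basis_vec R n) (size s + m) D f ->
  Ck (@basis_vec R n) m D (iter_partial s f).
Proof.
move=> oD; elim/last_ind: s f => [//|s i IHs] f; rewrite size_rcons addSn => -[_ d].
have [g gd gC] := d i; rewrite iter_partial_rcons; apply: IHs.
by apply: Ck_eq gC => // x /gd/@derive_val ->.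
Qed.

(** Openness is what allows a witness known only on [D] to replace [derive] under further
    derivatives. *)
Lemma smooth_onP D f : open D -> smooth_on D f <-> forall m, Ck (@basis_vec R n) m D f.
Proof.
move=> oD; split=> [fS m|fC s x Dx]; last first.
  have := Ck_iter_partial oD (fC (size s + 1)%N) => -[c d]; split; first exact: c.
  by move=> i; have [g gd _] := d i; apply: ex_derive; exact: gd.
elim: m f fS => [|m IHm] f fS.
  by split=> // x Dx; have [] := fS [::] x Dx.
split=> [x Dx|i]; first by have [] := fS [::] x Dx.
exists (fun x => 'D_(basis_vec i) f x).
  by move=> x Dx; apply: derivableP; have [_] := fS [::] x Dx; apply.
by apply: IHm => s x Dx; have := fS (rcons s i) x Dx; rewrite iter_partial_rcons.
Qed.

Lemma smooth_onU D D' f : smooth_on D f -> smooth_on D' f -> smooth_on (D `|` D') f.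
Proof. by move=> fD fD' s x [|] Dx; [exact: fD|exact: fD']. Qed.

Lemma smooth_on_sub D D' f : D' `<=` D -> smooth_on D f -> smooth_on D' f.
Proof. by move=> sD fD s x /sD; exact: fD. Qed.

End SmoothOn.

(** * Symmetry of second derivatives *)

Section Schwarz.
Context {R : realType} {V : normedModType R}.

Lemma isd_along (f : V -> R) (x v : V) (s df : R) : is_derive (s *: v + x) v f df ->
  is_derive s (1 : R) (fun h => f (h *: v + x)) df.
Proof.
move=> /isd_line fx; apply/isd_line; move: fx; congr is_derive.
by apply/funext => h; rewrite [h *: 1]mulr1 scalerDl addrA.
Qed.

Lemma MVT_isd (f df : R -> R) (h : R) : 0 < h ->
  (forall s, 0 <= s <= h -> is_derive s (1 : R) f (df s)) ->
  exists2 s, 0 < s < h & f h - f 0 = h * df s.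
Proof.
move=> h0 fd; have [||s sh E] := @MVT R f df 0 h h0.
- by move=> s; rewrite in_itv /= => /andP[s0 sh]; apply: fd; rewrite !ltW.
- apply: derivable_within_continuous => s; rewrite in_itv /= => sh.
  by apply: ex_derive; exact: fd.
by exists s; [move: sh; rewrite in_itv|rewrite E subr0 mulrC].
Qed.

(** The mean value theorem is applied along v and then along w. The left-hand side is symmetric in v
    and w, so exchanging them gives the other mixed derivative for the same second difference. *)
Lemma second_difference (f fv fvw : V -> R) (x v w : V) (h : R) : 0 < h ->
  (forall s s', 0 <= s <= h -> 0 <= s' <= h ->
     is_derive (s *: v + (s' *: w + x)) v f (fv (s *: v + (s' *: w + x))) /\
     is_derive (s' *: w + (s *: v + x)) w fv (fvw (s' *: w + (s *: v + x)))) ->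
  exists s s', [/\ 0 < s < h, 0 < s' < h &
    f (h *: v + (h *: w + x)) - f (h *: v + x) - f (h *: w + x) + f x =
    h * (h * fvw (s' *: w + (s *: v + x)))].
Proof.
move=> h0 fd; have h0' := ltW h0.
have [|s s_ E] := @MVT_isd (fun s => f (s *: v + (h *: w + x)) - f (s *: v + x))
  (fun s => fv (s *: v + (h *: w + x)) - fv (s *: v + x)) h h0.
  move=> u uh; apply: isdB; apply: isd_along.
    by have [//||+ _] := fd u h; rewrite ?h0' ?lexx.
  by have [//||+ _] := fd u 0; rewrite ?h0' ?lexx // scale0r add0r.
have [|s' s'_ E'] := @MVT_isd (fun s' => fv (s' *: w + (s *: v + x)))
    (fun s' => fvw (s' *: w + (s *: v + x))) h h0.
  move=> u uh; apply: isd_along.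
  by have /andP[s0 sh] := s_; have [||//] := fd s u; rewrite ?uh // !ltW.
exists s, s'; split=> //; rewrite -E'; move: E; rewrite !scale0r !add0r => E.
by rewrite [h *: w + (s *: v + x)]addrCA -E; ring.
Qed.

Lemma schwarz (f fv fw fvw fwv : V -> R) (x v w : V) (D : set V) : open D -> D x ->
  (forall y, D y -> is_derive y v f (fv y)) -> (forall y, D y -> is_derive y w f (fw y)) ->
  (forall y, D y -> is_derive y w fv (fvw y)) -> (forall y, D y -> is_derive y v fw (fwv y)) ->
  {for x, continuous fvw} -> {for x, continuous fwv} -> fvw x = fwv x.
Proof.
move=> oD Dx dv dw dvw dwv cvw cwv; apply: contrapT => /eqP ne.
pose e := `|fvw x - fwv x| / 2.
have e0 : 0 < e by rewrite divr_gt0 // normr_gt0 subr_eq0.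
have : \forall y \near x, [/\ D y, `|fvw x - fvw y| < e & `|fwv x - fwv y| < e].
  near=> y; split; near: y; first exact: open_nbhs_nbhs.
    by move/cvgrPdist_lt : cvw; apply.
  by move/cvgrPdist_lt : cwv; apply.
move=> /nbhs_ballP[d /= d0 B].
(* Small enough for the parallelogram on h v and h w to fit into the ball; the summand 1 covers the
   case v = w = 0. *)
pose h := d / (`|v| + `|w| + 1).
have vw0 : 0 < `|v| + `|w| + 1 by rewrite ltr_wpDl // addr_ge0.
have h0 : 0 < h by rewrite divr_gt0.
have Bh s s' : 0 <= s <= h -> 0 <= s' <= h -> ball x d (s *: v + (s' *: w + x)).
  move=> /andP[s0 sh] /andP[s0' sh']; rewrite -ball_normE /= addrA opprD addrCA subrr addr0.
  rewrite normrN (le_lt_trans (ler_normD _ _)) // !normrZ !ger0_norm //.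
  apply: (@le_lt_trans _ _ (h * `|v| + h * `|w|)); first by rewrite lerD // ler_wpM2r.
  rewrite -mulrDr /h mulrAC -mulrA gtr_pMr // ltr_pdivrMr // mul1r.
  by rewrite ltrDl.
have Bh' s s' : 0 <= s <= h -> 0 <= s' <= h -> ball x d (s' *: w + (s *: v + x)).
  by move=> sh sh'; rewrite addrCA; exact: Bh.
have [|s1 [s1' [/andP[s10 s1h] /andP[s1'0 s1'h] E1]]] := @second_difference f fv fvw x v w h h0.
  move=> s s' sh sh'; split.
    by apply: dv; have [] := B _ (Bh s s' sh sh').
  by apply: dvw; have [] := B _ (Bh' s s' sh sh').
have [|s2 [s2' [/andP[s20 s2h] /andP[s2'0 s2'h] E2]]] := @second_difference f fw fwv x w v h h0.
  move=> s s' sh sh'; split.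
    by apply: dw; have [] := B _ (Bh' s' s sh' sh).
  by apply: dwv; have [] := B _ (Bh s' s sh' sh).
have E : fvw (s1' *: w + (s1 *: v + x)) = fwv (s2' *: v + (s2 *: w + x)).
  apply: (mulfI (lt0r_neq0 h0)); apply: (mulfI (lt0r_neq0 h0)); rewrite -E1 -E2.
  by rewrite [h *: w + (h *: v + x)]addrCA; ring.
have [|_ N1 _] := B (s1' *: w + (s1 *: v + x)).
  by apply: Bh'; rewrite !ltW.
have [|_ _ N2] := B (s2' *: v + (s2 *: w + x)).
  by apply: Bh; rewrite !ltW.
have : `|fvw x - fwv x| < e + e.
  rewrite -(subrK (fvw (s1' *: w + (s1 *: v + x))) (fvw x)) -addrA.
  by rewrite (le_lt_trans (ler_normD _ _)) // ltrD // E distrC.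
by rewrite /e -splitr ltxx.
Unshelve. all: by end_near. Qed.

End Schwarz.

(** * Exterior derivatives and pullbacks in coordinates *)

Section FormDerivatives.
Context {R : realType} (n : nat).
Implicit Types (D : set 'rV[R]_n) (f g : 'rV[R]_n -> R).
Local Notation e_ := (@basis_vec R n).

Lemma smooth_schwarz D f i j x : open D -> smooth_on D f -> D x ->
  'D_(e_ i) (fun y => 'D_(e_ j) f y) x = 'D_(e_ j) (fun y => 'D_(e_ i) f y) x.
Proof.
move=> oD fS Dx; have d k y : D y -> is_derive y (e_ k) f ('D_(e_ k) f y).
  by move=> Dy; apply: derivableP; have [_] := fS [::] y Dy; apply.
have dd k l y : D y -> is_derive y (e_ l) (fun y => 'D_(e_ k) f y) ('D_(e_ l) (fun y => 'D_(e_ k) f y) y).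
  by move=> Dy; apply: derivableP; have [_] := fS [:: k] y Dy; apply.
apply: (schwarz oD Dx (d j) (d i) (dd j i) (dd i j)).
  by have [] := fS [:: i; j] x Dx.
by have [] := fS [:: j; i] x Dx.
Qed.

Lemma ext_d_fun f x : ext_d (fun_form f) x = one_form (fun a => 'D_(e_ a) f x).
Proof.
rewrite /ext_d /one_form; apply: eq_bigr => a _.
rewrite (_ : [ffun S => _] = ext_const n ('D_(e_ a) f x)) ?ext_wedge_constr //.
apply/ffunP => S; rewrite !ffunE /fun_form.
case: eqP => [->|/eqP S0].
  by congr ('D_ _ _ _); apply/funext => y; rewrite ffunE eqxx.
rewrite -[RHS](@derive_cst _ _ _ (0 : R) x (e_ a)); congr ('D_ _ _ _).
by apply/funext => y; rewrite ffunE (negPf S0).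
Qed.

Lemma ext_d_one_form (c : 'rV[R]_n -> 'I_n -> R) (dc : 'I_n -> 'I_n -> R) (A : Defs.form R n) x :
  (\forall y \near x, A y = one_form (c y)) ->
  (forall a b, is_derive x (e_ a) (fun y => c y b) (dc a b)) ->
  ext_d A x = two_form dc.
Proof.
move=> AE d; rewrite /ext_d /two_form; apply: eq_bigr => a _.
have -> : [ffun S : {set 'I_n} => 'D_(e_ a) (fun y => A y S) x] = one_form (dc a).
  apply/ffunP => S; rewrite ffunE.
  transitivity ('D_(e_ a) (fun y => one_form (c y) S) x).
    by apply: near_eq_derive; near=> y; rewrite (_ : A y = one_form (c y)) //; near: y.
  have [/finset.cards1P[b ->]|S1] := boolP (#|S| == 1)%N.
    rewrite one_form_set1; under eq_fun do rewrite one_form_set1.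
    by rewrite derive_val.
  rewrite one_form_neq1 //; under eq_fun do rewrite one_form_neq1 //.
  exact: derive_cst.
by rewrite /one_form ext_wedge_sumr; apply: eq_bigr => b _; rewrite ext_wedgeZr.
Unshelve. all: by end_near. Qed.

Lemma pullback1E m (h : 'rV[R]_n -> 'rV[R]_m) (a : Defs.form R m) x :
  pullback1 h a x = one_form (fun b =>
    \sum_(j < m) a (h x) (finset.set1 j) * 'D_(e_ b) (fun y => h y 0 j) x).
Proof.
rewrite /pullback1 /one_form; under [RHS]eq_bigr do rewrite scaler_suml.
rewrite exchange_big; apply: eq_bigr => j _; rewrite ext_d_fun /one_form scaler_sumr.
by apply: eq_bigr => b _; rewrite scalerA.
Qed.

Lemma is_derive_coord (x : 'rV[R]_n) (a j : 'I_n) :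
  is_derive x (e_ a) (fun y : 'rV[R]_n => y 0 j) (a == j)%:R.
Proof.
apply/isd_line; under eq_fun do rewrite !mxE eqxx /=.
apply: isd_eq (isdD (isdM (is_derive_id _ _) (isd_cst _ _ _)) (isd_cst _ _ _)) _.
by rewrite mulr0 !addr0 mul1r eq_sym.
Qed.

Lemma continuous_coord (j : 'I_n) : continuous (fun y : 'rV[R]_n => y 0 j).
Proof. exact: coord_continuous. Qed.

Lemma Ck_coord m D (j : 'I_n) : Ck e_ m D (fun y => y 0 j).
Proof.
case: m => [|m]; split=> //; try by move=> x _; exact: continuous_coord.
move=> a; exists (fun=> (a == j)%:R); last exact: Ck_cst.
by move=> x _; exact: is_derive_coord.
Qed.

End FormDerivatives.

(** * The profile equation and the Riccati equation *)

Section MeanValue.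
Context {R : realType}.

Lemma within_right_continuous (f : R -> R) (b : R) : 0 < b ->
  f r @[r --> 0^'+] --> f 0 -> (forall r : R, 0 < r <= b -> derivable f r 1) ->
  {within `[0, b], continuous f}.
Proof.
move=> b0 fc fd; apply/continuous_within_itvP => //; split=> //.
  move=> r; rewrite in_itv /= => /andP[r0 rb].
  by apply: differentiable_continuous; apply/derivable1_diffP; apply: fd; rewrite r0 ltW.
apply: cvg_at_left_filter; apply: differentiable_continuous.
by apply/derivable1_diffP; apply: fd; rewrite b0 lexx.
Qed.

(** At 0 the profile is only known to be right continuous, and this is enough for the mean value
    theorem on [0, b]. *)
Lemma MVT_origin (f df : R -> R) (b : R) : 0 < b ->
  f r @[r --> 0^'+] --> f 0 -> (forall r : R, 0 < r -> is_derive r (1 : R) f (df r)) ->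
  exists2 c, 0 < c < b & f b - f 0 = df c * b.
Proof.
move=> b0 fc fd; have [||c] := @MVT R f df 0 b b0.
- by move=> r; rewrite in_itv /= => /andP[r0 _]; exact: fd.
- by apply: within_right_continuous => // r /andP[r0 _]; apply: ex_derive; exact: fd.
by rewrite in_itv /= subr0 => cb E; exists c.
Qed.

Lemma isd_continuous (f : R -> R) (x df : R) : is_derive x (1 : R) f df -> {for x, continuous f}.
Proof.
move=> [fd _]; apply: differentiable_continuous; exact/derivable1_diffP.
Qed.

(* Gronwall: w^2 exp(-2Mr) is nonincreasing and w^2 exp(2Mr) is nondecreasing. *)
Lemma linear_ode_zero (w a : R -> R) (lo hi : R) : lo <= hi ->
  (forall r : R, lo <= r <= hi -> is_derive r (1 : R) w (a r * w r)) ->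
  {within `[lo, hi], continuous a} -> w lo = 0 \/ w hi = 0 ->
  forall r : R, lo <= r <= hi -> w r = 0.
Proof.
move=> lohi wd ac w0 r /andP[lor rhi].
have [M aM] : exists M : R, forall s, lo <= s <= hi -> `|a s| <= M.
  have [|c _ cM] := @EVT_max R (fun s => `|a s|) lo hi lohi.
    by move=> s; apply: continuous_comp; [exact: ac|exact: norm_continuous].
  by exists `|a c| => s sh; apply: cM; rewrite in_itv.
have dk (e : R) s : lo <= s <= hi ->
    is_derive s (1 : R) (fun s => w s * w s * expR (e * s)) ((2 * a s + e) * (w s * w s * expR (e * s))).
  move=> sh; have d1 := wd s sh.
  have d2 : is_derive s (1 : R) (fun s => expR (e * s)) (expR (e * s) * (0 * s + e * 1)).
    exact: (@isd_comp _ _ expR (fun s => e * s) s 1 _ _ (is_derive_expR (e * s))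
      (isdM (isd_cst e s 1) (is_derive_id s 1))).
  by apply: isd_eq (isdM (isdM d1 d1) d2) _; ring.
have sq0 (e : R) : w r * w r * expR (e * r) <= 0 -> w r = 0.
  rewrite pmulr_lle0 ?expR_gt0 // -expr2 => le0; apply/eqP.
  by rewrite -sqrf_eq0 eq_le le0 sqr_ge0.
have k0 (e : R) s : 0 <= w s * w s * expR (e * s) by rewrite mulr_ge0 ?expR_ge0 // -expr2 sqr_ge0.
have mvt (e : R) lo' hi' : lo <= lo' -> hi' <= hi -> lo' < hi' -> exists2 c, lo <= c <= hi &
    w hi' * w hi' * expR (e * hi') - w lo' * w lo' * expR (e * lo') =
    (2 * a c + e) * (w c * w c * expR (e * c)) * (hi' - lo').
  move=> l h lh; have [||c cb ->] := @MVT R (fun s => w s * w s * expR (e * s))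
      (fun s => (2 * a s + e) * (w s * w s * expR (e * s))) lo' hi' lh.
  - move=> s; rewrite in_itv /= => /andP[s1 s2]; apply: dk.
    by rewrite (le_trans l) ?(ltW s1) // (le_trans (ltW s2)).
  - apply: derivable_within_continuous => s; rewrite in_itv /= => /andP[s1 s2].
    by apply: ex_derive; apply: dk; rewrite (le_trans l) // (le_trans s2).
  move: cb; rewrite in_itv /= => /andP[s1 s2]; exists c => //.
  by rewrite (le_trans l) ?(ltW s1) // (le_trans (ltW s2)).
case: w0 => w0.
- move: lor; rewrite le_eqVlt => /predU1P[<-//|lor].
  apply: (sq0 (- (2 * M))).
  have [c cb] := mvt (- (2 * M)) _ _ (lexx lo) rhi lor; rewrite w0 !mul0r subr0 => ->.
  rewrite mulr_le0_ge0 ?subr_ge0 ?(ltW lor) // mulr_le0_ge0 // -mulrBr pmulr_rle0 //.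
  by rewrite subr_le0 (le_trans _ (aM c cb)) // ler_norm.
- move: rhi; rewrite le_eqVlt => /predU1P[->//|rhi].
  apply: (sq0 (2 * M)).
  have [c cb] := mvt (2 * M) _ _ lor (lexx hi) rhi; rewrite w0 !mul0r sub0r => E.
  rewrite -oppr_ge0 E mulr_ge0 ?subr_ge0 ?(ltW rhi) // mulr_ge0 // -mulrDr pmulr_rge0 //.
  by have := aM c cb; rewrite ler_norml -lerBlDr sub0r => /andP[].
Qed.

End MeanValue.

Definition nu2 {R : realType} (nu : R -> R) (r : R) : R := nu r ^+ 2.
Definition tp {R : realType} (t N : R -> R) (r : R) : R := 1 - 2 * t r ^+ 2 / N r.

Definition ode {R : realType} (t N : R -> R) (J : set R) (x : R -> R) :=
  forall r : R, J r -> is_derive r (1 : R) x (2 * x r * (tp t N r - x r) / t r).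

Section Profile.
Context {R : realType} (nu0 : R) (t nu : R -> R).
Hypothesis nu0_gt0 : 0 < nu0.
Hypothesis P : profile_solution nu0 t nu.
Local Notation N := (nu2 nu).
Local Notation n0 := (nu0 ^+ 2).
Local Notation tp := (tp t N).
Local Notation ode := (ode t N).

Let n0_gt0 : 0 < n0. Proof. exact: exprn_gt0. Qed.
Let t0 : t 0 = 0. Proof. exact: profile_t0 P. Qed.

Lemma profile_N0 : N 0 = n0. Proof. by rewrite /nu2 (profile_nu0 P). Qed.
Let N0 := profile_N0.

Lemma N_gt0 (r : R) : 0 <= r -> 0 < N r.
Proof. by move=> r0; rewrite exprn_gt0 // (profile_pos P). Qed.

Let t_rc : t r @[r --> 0^'+] --> t 0. Proof. exact: profile_t_right_cont P. Qed.

Lemma N_right_cont : N r @[r --> 0^'+] --> N 0.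
Proof.
have nc := profile_nu_right_cont P.
by rewrite /nu2 expr2; under eq_fun do rewrite expr2; exact: cvgM.
Qed.
Let N_rc := N_right_cont.

Lemma profile_dN (r : R) : 0 < r -> is_derive r (1 : R) N (6 * t r).
Proof. exact: (profile_dnu2 P). Qed.
Let dN := profile_dN.

Let dt (r : R) : 0 < r -> is_derive r (1 : R) t (tp r). Proof. exact: (profile_dt P). Qed.

(** With u = N - 5t^2 one finds N'/N = 6t/N and u'/u = -4t/N, so the logarithmic derivative of N^2
    u^3 is 12t/N - 12t/N = 0. The proof differentiates the product itself, since u is not yet known
    to be nonzero. *)
Lemma profile_conserved (r : R) : 0 <= r -> N r ^+ 2 * (N r - 5 * t r ^+ 2) ^+ 3 = n0 ^+ 5.
Proof.
rewrite le_eqVlt => /predU1P[<-|r0]; first by rewrite N0 t0; ring.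
pose H r := N r * N r * ((N r - 5 * (t r * t r)) * ((N r - 5 * (t r * t r)) * (N r - 5 * (t r * t r)))).
have Hc : H r @[r --> 0^'+] --> H 0.
  have uc : (fun r => N r - 5 * (t r * t r)) r @[r --> 0^'+] --> N 0 - 5 * (t 0 * t 0).
    by apply: (cvgB N_rc); apply: cvgM; [exact: cvg_cst|exact: (cvgM t_rc t_rc)].
  exact: (cvgM (cvgM N_rc N_rc) (cvgM uc (cvgM uc uc))).
have Hd (s : R) : 0 < s -> is_derive s (1 : R) H 0.
  move=> s0; have Ns : N s != 0 by rewrite gt_eqF // N_gt0 // ltW.
  have d1 := isdB (dN s0) (isdM (isd_cst (5 : R) s 1) (isdM (dt s0) (dt s0))).
  apply: isd_eq (isdM (isdM (dN s0) (dN s0)) (isdM d1 (isdM d1 d1))) _.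
  by rewrite /tp; field.
have [c _] := MVT_origin r0 Hc Hd; rewrite mul0r => /eqP; rewrite subr_eq0 => /eqP E.
transitivity (H r); first by rewrite /H; ring.
by rewrite E /H t0 N0; ring.
Qed.

Lemma profile_bound (r : R) : 0 <= r -> 5 * t r ^+ 2 < N r.
Proof.
move=> r0; rewrite -subr_gt0 ltNge; apply/negP => le0.
have := profile_conserved r0; have := N_gt0 r0.
have : 0 < n0 ^+ 5 by rewrite exprn_gt0.
move: (N r - _) le0 => u u0; move: (n0 ^+ 5) (N r) => a b a0 b0 E.
have : b ^+ 2 * u ^+ 3 <= 0.
  by rewrite mulr_ge0_le0 ?sqr_ge0 // exprS mulr_le0_ge0 // sqr_ge0.
by rewrite E leNgt a0.
Qed.

(** The conserved quantity keeps t^2/N below 1/5, hence t' above 3/5; the growth of t and N follows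
    from this. *)
Lemma tp_gt (r : R) : 0 <= r -> 3 / 5 < tp r.
Proof.
move=> r0; rewrite /tp; have Nr := N_gt0 r0; have := profile_bound r0 => B.
have : 2 * t r ^+ 2 / N r < 2 / 5 by rewrite ltr_pdivrMr //; lra.
lra.
Qed.

Lemma t_ge (r : R) : 0 <= r -> 3 / 5 * r <= t r.
Proof.
rewrite le_eqVlt => /predU1P[<-|r0]; first by rewrite t0 mulr0.
have [c /andP[c0 _]] := MVT_origin r0 t_rc dt; rewrite t0 subr0 => ->.
by rewrite ler_wpM2r ?(ltW r0) // ltW // tp_gt // ltW.
Qed.

Lemma t_gt0 (r : R) : 0 < r -> 0 < t r.
Proof. by move=> r0; apply: lt_le_trans (t_ge (ltW r0)); rewrite mulr_gt0. Qed.

(** N' = 6t is at least 18r/5 by [t_ge]. *)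
Lemma N_ge (r : R) : 0 <= r -> n0 + 9 / 5 * r ^+ 2 <= N r.
Proof.
rewrite le_eqVlt => /predU1P[<-|r0]; first by rewrite N0; lra.
have [||c /andP[c0 _]] := @MVT_origin R (fun r => N r - 9 / 5 * (r * r)) (fun r => 6 * t r - 18 / 5 * r) r r0.
- have id_rc : (r : R) @[r --> (0 : R)^'+] --> (0 : R) by apply: cvg_at_right_filter; exact: cvg_id.
  by apply: (cvgB N_rc); apply: cvgM; [exact: cvg_cst|exact: (cvgM id_rc id_rc)].
- move=> s s0; have i := is_derive_id s (1 : R).
  apply: isd_eq (isdB (dN s0) (isdM (isd_cst _ _ _) (isdM i i))) _.
  by rewrite mul0r add0r mul1r mulr1; field.
rewrite N0 !mulr0 subr0 => E.
have : 0 <= (6 * t c - 18 / 5 * c) * r.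
  by rewrite mulr_ge0 ?(ltW r0) //; have := t_ge (ltW c0); lra.
by rewrite -E expr2; lra.
Qed.

Lemma N_gt (r : R) : 0 < r -> n0 < N r.
Proof. by move=> r0; apply: lt_le_trans (N_ge (ltW r0)); rewrite ltrDl mulr_gt0 // exprn_gt0. Qed.

(** Dividing by x is avoided. If x is nonzero at r1, choose C so that w = x(N/3 + C) - t^2 vanishes
    there; since w satisfies the linear equation w' = 2(t' - x)/t w, it vanishes on the whole
    interval. *)
Lemma ode_first_integral (J : set R) (x : R -> R) : ode J x ->
  (forall r, J r -> 0 < r) -> is_interval J ->
  (forall r, J r -> x r = 0) \/
  exists C : R, forall r, J r -> x r * (N r / 3 + C) = t r ^+ 2.
Proof.
move=> xd J0 Ji; have [[r1 [Jr1 /eqP x1]]|nx] := pselect (exists r, J r /\ x r <> 0); last first.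
  by left=> r Jr; apply: contrapT => xr; apply: nx; exists r.
right; exists (t r1 ^+ 2 / x r1 - N r1 / 3) => r Jr.
set C := _ - _; pose w r := x r * (N r / 3 + C) - t r * t r.
have w1 : w r1 = 0 by rewrite /w /C; field.
have wd (s : R) : J s -> is_derive s (1 : R) w (2 * (tp s - x s) / t s * w s).
  move=> Js; have s0 := J0 _ Js; have ts : t s != 0 by rewrite gt_eqF // t_gt0.
  have d1 := isdM (dN s0) (isd_cst (3^-1 : R) s 1).
  apply: isd_eq (isdB (isdM (xd s Js) (isdD d1 (isd_cst C s 1))) (isdM (dt s0) (dt s0))) _.
  by rewrite /w; field.
have ac (s : R) : J s -> {for s, continuous (fun s => 2 * (tp s - x s) / t s)}.
  move=> Js; have s0 := J0 _ Js; have ts : t s != 0 by rewrite gt_eqF // t_gt0.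
  have Ns : N s != 0 by rewrite gt_eqF // N_gt0 // ltW.
  have ct := isd_continuous (dt s0); have cN := isd_continuous (dN s0).
  have cx := isd_continuous (xd s Js).
  apply: cvgM; last exact: cvgV.
  apply: cvgM; first exact: cvg_cst.
  apply: cvgB => //; apply: cvgB; first exact: cvg_cst.
  apply: cvgM; last exact: cvgV.
  by apply: cvgM; [exact: cvg_cst|exact: cvgM].
have main lo hi : J lo -> J hi -> lo <= hi -> w lo = 0 \/ w hi = 0 ->
    forall s : R, lo <= s <= hi -> w s = 0.
  move=> Jlo Jhi lohi w0; apply: (@linear_ode_zero R w (fun s => 2 * (tp s - x s) / t s) lo hi lohi) => //.
    by move=> s sh; apply: wd; exact: (Ji lo hi Jlo Jhi _ sh).
  apply: (@continuous_in_subspaceT _ _ `[lo, hi] (fun s => 2 * (tp s - x s) / t s)) => {}s.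
  by rewrite inE /= in_itv /= => sh; apply: ac; exact: (Ji lo hi Jlo Jhi _ sh).
suff : w r = 0 by rewrite /w expr2 => /eqP; rewrite subr_eq0 => /eqP.
have [rr1|/ltW r1r] := leP r r1.
  by apply: (main r r1) => //; [right|rewrite lexx].
by apply: (main r1 r) => //; [left|rewrite lexx andbT].
Qed.

Lemma ode_global (x : R -> R) : ode [set r : R | 0 < r] x ->
  (forall r : R, 0 < r -> x r = 0) \/
  exists2 C : R, - n0 / 3 <= C & forall r : R, 0 < r -> x r = t r ^+ 2 / (N r / 3 + C).
Proof.
move=> /ode_first_integral[//||x0|[C xC]]; first by move=> a b /= a0 _ c /andP[/(lt_le_trans a0)].
  by left.
right; have D0 r : 0 < r -> N r / 3 + C != 0.
  move=> r0; apply/eqP => D0; have := xC r r0; rewrite D0 mulr0 => /esym/eqP.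
  by rewrite expf_eq0 /= gt_eqF // t_gt0.
exists C; last first.
  by move=> r r0; rewrite -(xC r r0) mulfK // D0.
rewrite leNgt; apply/negP => CN.
(* If C < -n0/3 then N/3 + C is negative at 0. It is positive at b, because b > 1 makes N(b) at
   least n0 + b. At the zero in between, the first integral would give t = 0. *)
pose b := 1 - 3 * C; have b0 : 0 < b by move: n0_gt0 CN; rewrite /b; lra.
have fc : {within `[0, b], continuous (fun r => N r / 3 + C)}.
  apply: within_right_continuous => //.
    by apply: cvgD; [apply: cvgM; [exact: N_rc|exact: cvg_cst]|exact: cvg_cst].
  move=> r /andP[r0 _]; apply: ex_derive.
  exact: isdD (isdM (dN r0) (isd_cst (3^-1 : R) r 1)) (isd_cst C r 1).
have [|c] := IVT (v := 0) (ltW b0) fc.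
- have f0 : N 0 / 3 + C < 0 by move: n0_gt0 CN; rewrite N0; lra.
  have fb : 0 < N b / 3 + C.
    have := N_ge (ltW b0); have : b <= 9 / 5 * b ^+ 2 by move: n0_gt0 CN; rewrite /b; nra.
    by move: n0_gt0 CN; rewrite /b; lra.
  rewrite ge_min le_max (ltW f0) (ltW fb) orbT //.
rewrite in_itv /= => /andP[c0 _] E.
move: c0; rewrite le_eqVlt => /predU1P[c0|c0]; last by move: (D0 c c0); rewrite E eqxx.
by move: n0_gt0 CN E; rewrite -c0 N0; lra.
Qed.

Lemma ode_solution (J : set R) (C : R) : (forall r, J r -> 0 < r) ->
  (forall r, J r -> N r / 3 + C != 0) -> ode J (fun r => t r ^+ 2 / (N r / 3 + C)).
Proof.
move=> J0 D0 r Jr; have r0 := J0 _ Jr; have Dr := D0 _ Jr.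
have tr : t r != 0 by rewrite gt_eqF // t_gt0.
have Nr : N r != 0 by rewrite gt_eqF // N_gt0 // ltW.
have d1 := isdD (isdM (dN r0) (isd_cst (3^-1 : R) r 1)) (isd_cst C r 1).
have := isdM (isdM (dt r0) (dt r0)) (isdV (Dr : (fun y => N y / 3 + C) r != 0) d1).
move/isd_eq; apply; move: (tp r) (N r / 3 + C) Dr => a D Dr.
by rewrite mulr0 !addr0; field; rewrite tr Dr.
Qed.

Lemma ode_eq (J : set R) (x y : R -> R) : open J -> (forall r, J r -> x r = y r) ->
  ode J x -> ode J y.
Proof.
move=> oJ xy xd r Jr; rewrite -(xy r Jr); apply: isd_near (xd r Jr).
exact: (open_near oJ Jr).
Qed.

(** A bootstrap: t' and N' are rational in t and N with denominator N. *)
Lemma profile_smooth n : Ck1 n [set r : R | 0 < r] t /\ Ck1 n [set r : R | 0 < r] N.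
Proof.
elim: n => [|n [tS NS]].
  by split; split=> // r r0; [exact: isd_continuous (dt r0)|exact: isd_continuous (dN r0)].
split; split; try (move=> r r0; exact: isd_continuous (dt r0)) || (move=> r r0; exact: isd_continuous (dN r0)); case.
- exists tp; first by move=> r r0; exact: dt.
  apply: CkB; first exact: Ck_cst.
  apply: CkM; first by apply: CkM; [exact: Ck_cst|exact: CkX].
  by apply: CkV => // r r0; rewrite gt_eqF // N_gt0 // ltW.
- exists (fun r => 6 * t r); first by move=> r r0; exact: dN.
  by apply: CkM => //; exact: Ck_cst.
Qed.

Lemma tp_smooth n : Ck1 n [set r : R | 0 < r] tp.
Proof.
have [tS NS] := profile_smooth n; apply: CkB; first exact: Ck_cst.
apply: CkM; first by apply: CkM; [exact: Ck_cst|exact: CkX].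
by apply: CkV => // r r0; rewrite gt_eqF // N_gt0 // ltW.
Qed.

Lemma ode_smooth n (J : set R) (x : R -> R) : (forall r, J r -> 0 < r) -> ode J x -> Ck1 n J x.
Proof.
move=> J0 xd; elim: n => [|n IHn]; split=> //; try by move=> r Jr; exact: isd_continuous (xd r Jr).
case.
exists (fun r => 2 * x r * (tp r - x r) / t r); first by move=> r Jr; exact: xd.
apply: CkM.
  apply: CkM; first by apply: CkM => //; exact: Ck_cst.
  by apply: CkB => //; apply: Ck_sub (tp_smooth n).
apply: CkV; first by move=> r /J0 r0; rewrite gt_eqF // t_gt0.
by apply: Ck_sub (profile_smooth n).1.
Qed.

Lemma Ninv_cvg : (N r)^-1 @[r --> +oo] --> (0 : R).
Proof.
apply/cvgrPdist_lt => e e0; near=> r.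
have r1 : 1 < r by near: r; exact: nbhs_pinfty_gt.
have re : e^-1 < r by near: r; apply: nbhs_pinfty_gt; rewrite num_real.
have r0 : 0 < r by rewrite (lt_trans _ r1).
have Nr := N_gt0 (ltW r0).
rewrite sub0r normrN gtr0_norm ?invr_gt0 // invf_plt ?posrE //.
apply: lt_trans re _; have := N_ge (ltW r0).
have : r < 9 / 5 * r ^+ 2 by rewrite expr2; nra.
by move: n0_gt0; lra.
Unshelve. all: by end_near. Qed.

(** By the conserved quantity the cube of 1/5 - t^2/N equals n0^5/(125 N^5), and N tends to
    infinity. *)
Lemma ratio_cvg : t r ^+ 2 / N r @[r --> +oo] --> (1 / 5 : R).
Proof.
have N_oo := Ninv_cvg.
have bd r : 0 < r -> `|1 / 5 - t r ^+ 2 / N r| ^+ 3 <= (n0 / 5) ^+ 5 * 25 * (N r)^-1 ^+ 5.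
  move=> r0; have Nr := N_gt0 (ltW r0); have B := profile_bound (ltW r0).
  have -> : `|1 / 5 - t r ^+ 2 / N r| = (N r - 5 * t r ^+ 2) / (5 * N r).
    rewrite ger0_norm; first by field; rewrite gt_eqF.
    by rewrite subr_ge0 ler_pdivrMr //; lra.
  have := profile_conserved (ltW r0) => E.
  rewrite expr_div_n [(n0 / 5) ^+ 5]expr_div_n -E le_eqVlt; apply/orP; left; apply/eqP.
  by field; rewrite gt_eqF.
apply/cvgrPdist_lt => e e0.
have : (n0 / 5) ^+ 5 * 25 * (N r)^-1 ^+ 5 @[r --> +oo] --> (n0 / 5) ^+ 5 * 25 * (0 : R) ^+ 5.
  apply: cvgM; first exact: cvg_cst.
  exact: (cvgM N_oo (cvgM N_oo (cvgM N_oo (cvgM N_oo N_oo)))).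
rewrite expr0n /= mulr0 => /cvgrPdist_lt /(_ (e ^+ 3)) h.
have {}h := h (exprn_gt0 3 e0).
near=> r; have r0 : 0 < r by near: r; exact: nbhs_pinfty_gt.
have : `|0 - (n0 / 5) ^+ 5 * 25 * (N r)^-1 ^+ 5| < e ^+ 3 by near: r.
rewrite sub0r normrN => hr.
have := le_lt_trans (le_trans (bd r r0) (ler_norm _)) hr.
by rewrite ltr_pXn2r // nnegrE ltW.
Unshelve. all: by end_near. Qed.

(** After division by N the limit is (1/5)/(1/3), whatever C is; this is why all nonzero solutions
    share their asymptotic connection. *)
Lemma solution_cvg (C : R) : t r ^+ 2 / (N r / 3 + C) @[r --> +oo] --> (3 / 5 : R).
Proof.
have : t r ^+ 2 / N r * (3^-1 + C * (N r)^-1)^-1 @[r --> +oo] --> 1 / 5 * (3^-1 + C * 0)^-1.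
  apply: cvgM; first exact: ratio_cvg.
  apply: cvgV; first by rewrite mulr0 addr0 invr_eq0.
  by apply: cvgD; [exact: cvg_cst|apply: cvgM; [exact: cvg_cst|exact: Ninv_cvg]].
rewrite (_ : 1 / 5 * _ = 3 / 5 :> R); last by rewrite mulr0 addr0 invrK; field.
apply: cvg_trans; apply: near_eq_cvg; near=> r.
have r0 : 0 < r by near: r; exact: nbhs_pinfty_gt.
have Nr := N_gt0 (ltW r0).
rewrite -mulrA -invfM; congr (_ * _^-1); field.
by rewrite gt_eqF.
Unshelve. all: by end_near. Qed.

End Profile.

(** * Analyticity of the profile *)

Section QuadraticSystem.
Context {R : realType}.
Variable rhs : nat -> seq (R * (nat * nat)).

(** Right-hand side of f_i' = sum of c f_j f_k over the entries (c, (j, k)) of [rhs i]. Lower-order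
    terms are expressed with a component that is constantly 1. *)
Definition quad_sum (F : nat -> nat -> R) (i : nat) : R :=
  \sum_(e <- rhs i) e.1 * F e.2.1 e.2.2.

(** Normalized Taylor coefficients of the solution with value [v], by the Cauchy product. The whole
    list is carried along because the next coefficient needs all earlier ones. *)
Fixpoint taylor_list (v : nat -> R) (m : nat) : seq (nat -> R) :=
  if m is m'.+1 then
    let s := taylor_list v m' in
    rcons s (fun i => (m%:R)^-1 * quad_sum (fun j k =>
      \sum_(l < m) nth (fun=> 0) s l j * nth (fun=> 0) s (m' - l) k) i)
  else [:: v].

Definition taylor (v : nat -> R) (m i : nat) : R := nth (fun=> 0) (taylor_list v m) m i.

Lemma size_taylor_list v m : size (taylor_list v m) = m.+1.
Proof. by elim: m => //= m IHm; rewrite size_rcons IHm. Qed.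

Lemma nth_taylor_list v m l : (l <= m)%N -> nth (fun=> 0) (taylor_list v m) l = taylor v l.
Proof.
elim: m => [|m IHm]; first by rewrite leqn0 => /eqP ->.
rewrite leq_eqVlt => /predU1P[->//|]; rewrite ltnS => lm /=.
by rewrite nth_rcons size_taylor_list ltnS lm IHm.
Qed.

Lemma taylor0 v i : taylor v 0 i = v i. Proof. by []. Qed.

Lemma taylorS v m i : taylor v m.+1 i = (m.+1%:R)^-1 * quad_sum (fun j k =>
  \sum_(l < m.+1) taylor v l j * taylor v (m - l) k) i.
Proof.
rewrite /taylor /= nth_rcons size_taylor_list ltnn eqxx; congr (_ * _).
apply: eq_bigr => e _; congr (_ * _); apply: eq_bigr => l _.
by rewrite !nth_taylor_list ?leq_subr // -ltnS.
Qed.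

Lemma isd_sum (T : Type) (s : seq T) (F : T -> R -> R) (dF : T -> R) (r : R) :
  (forall x, is_derive r (1 : R) (F x) (dF x)) ->
  is_derive r (1 : R) (fun y => \sum_(x <- s) F x y) (\sum_(x <- s) dF x).
Proof.
move=> FD; elim: s => [|x s IHs].
  rewrite big_nil; under eq_fun do rewrite big_nil; exact: isd_cst.
by rewrite big_cons; under eq_fun do rewrite big_cons; exact: isdD.
Qed.

(** The coefficient of degree m in the Leibniz rule for formal power series. *)
Lemma convolution_derive (a b : nat -> R) m :
  \sum_(l < m.+1) (l.+1%:R * a l.+1 * b (m - l)%N + a l * ((m - l).+1%:R * b (m - l).+1)) =
  m.+1%:R * \sum_(l < m.+2) a l * b (m.+1 - l)%N.
Proof.
rewrite big_split /=.
have -> : \sum_(l < m.+1) l.+1%:R * a l.+1 * b (m - l)%N = \sum_(l < m.+2) l%:R * a l * b (m.+1 - l)%N.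
  by rewrite [RHS]big_ord_recl /= !mul0r add0r; apply: eq_bigr => l _; rewrite subSS.
have -> : \sum_(l < m.+1) a l * ((m - l).+1%:R * b (m - l).+1) =
    \sum_(l < m.+2) a l * ((m.+1 - l)%:R * b (m.+1 - l)%N).
  rewrite [RHS]big_ord_recr /= subnn mul0r mulr0 addr0; apply: eq_bigr => l _.
  by rewrite subSn // -ltnS.
rewrite -big_split /= mulr_sumr; apply: eq_bigr => l _.
have -> : m.+1%:R = l%:R + (m.+1 - l)%:R :> R by rewrite -natrD subnKC // -ltnS.
ring.
Qed.

Section Solution.
Variable f : nat -> R -> R.

(** Along a solution the m-th coefficient is the m-th derivative divided by m!, which accounts for
    the factor m + 1. *)
Lemma taylor_derive (r : R) :
  (forall i, is_derive r (1 : R) (f i) (quad_sum (fun j k => f j r * f k r) i)) ->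
  forall m i, is_derive r (1 : R) (fun y => taylor (f^~ y) m i)
    (m.+1%:R * taylor (f^~ r) m.+1 i).
Proof.
move=> fd; elim/ltn_ind => -[|m] IHm i.
  apply: isd_eq (fd i) _; rewrite taylorS invr1 !mul1r; apply: eq_bigr => e _.
  by rewrite big_ord1.
under eq_fun do rewrite taylorS.
have d (l : 'I_m.+1) j k : is_derive r (1 : R) (fun y => taylor (f^~ y) l j * taylor (f^~ y) (m - l) k)
  (l.+1%:R * taylor (f^~ r) l.+1 j * taylor (f^~ r) (m - l) k +
   taylor (f^~ r) l j * ((m - l).+1%:R * taylor (f^~ r) (m - l).+1 k)).
  by apply: isdM; apply: IHm; rewrite // ltnS leq_subr.
have D := isdM (isd_cst ((m.+1%:R)^-1 : R) r 1) (isd_sum (rhs i) (fun e =>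
  isdM (isd_cst e.1 r 1) (isd_sum (index_enum 'I_m.+1) (fun l => d l e.2.1 e.2.2)))).
apply: isd_eq D _; rewrite mul0r add0r taylorS mulrA mulfV ?pnatr_eq0 // mul1r.
rewrite mulr_sumr; apply: eq_bigr => e _; rewrite mul0r add0r.
by rewrite (convolution_derive (taylor (f^~ r) ^~ e.2.1) (taylor (f^~ r) ^~ e.2.2)) mulrCA mulKf ?pnatr_eq0.
Qed.

Lemma taylor_cvg (F : set_system R) (FF : Filter F) (v : nat -> R) :
  (forall i, f i r @[r --> F] --> v i) ->
  forall m i, taylor (f^~ r) m i @[r --> F] --> taylor v m i.
Proof.
move=> fc; elim/ltn_ind => -[|m] IHm i; first exact: fc.
rewrite taylorS; under eq_fun do rewrite taylorS.
apply: cvgM; first exact: cvg_cst.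
apply: cvg_big => [|e _]; first exact: add_continuous.
apply: cvgM; first exact: cvg_cst.
apply: cvg_big => [|l _]; first exact: add_continuous.
by apply: cvgM; apply: IHm; rewrite // ltnS leq_subr.
Qed.

End Solution.

(** The m + 1 terms of the Cauchy product are cancelled by the factor 1/(m + 1) of the recursion, so
    the growth is geometric. *)
Lemma taylor_bound (v : nat -> R) (C Q : R) :
  (forall i, `|v i| <= C) -> (forall i, \sum_(e <- rhs i) `|e.1| <= Q) ->
  forall m i, `|taylor v m i| <= C * (Q * C) ^+ m.
Proof.
move=> vC rQ; have C0 : 0 <= C by apply: le_trans (vC 0%N).
have Q0 : 0 <= Q by apply: le_trans (rQ 0%N); apply: sumr_ge0.
elim/ltn_ind => -[|m] IHm i; first by rewrite mulr1.
rewrite taylorS normrM ger0_norm ?invr_ge0 // mulrC ler_pdivrMr ?ltr0n //.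
apply: le_trans (ler_norm_sum _ _ _) _.
have conv j k : `|\sum_(l < m.+1) taylor v l j * taylor v (m - l) k| <= m.+1%:R * (C * C * (Q * C) ^+ m).
  apply: le_trans (ler_norm_sum _ _ _) _.
  rewrite mulr_natl -[X in _ *+ X](card_ord m.+1) -sumr_const; apply: ler_sum => l _.
  rewrite normrM; have lm : (l <= m)%N by rewrite -ltnS.
  apply: le_trans (ler_pM (normr_ge0 _) (normr_ge0 _) (IHm _ _ _) (IHm _ _ _)) _ => //.
    by rewrite ltnS leq_subr.
  by rewrite mulrACA -exprD subnKC.
apply: (@le_trans _ _ (\sum_(e <- rhs i) `|e.1| * (m.+1%:R * (C * C * (Q * C) ^+ m)))).
  by apply: ler_sum => e _; rewrite normrM ler_wpM2l.
rewrite -mulr_suml (le_trans (ler_wpM2r _ (rQ i))) ?mulr_ge0 ?exprn_ge0 ?mulr_ge0 //.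
by rewrite exprS le_eqVlt; apply/orP; left; apply/eqP; ring.
Qed.

(** [p] marks the components that are odd in r. Differentiation flips parity, so each product on the
    right must have the parity opposite to that of its component. *)
Lemma taylor_parity (v : nat -> R) (p : nat -> bool) :
  (forall i, p i -> v i = 0) ->
  (forall i, all (fun e => p i == ~~ (p e.2.1 (+) p e.2.2)) (rhs i)) ->
  forall m i, odd m != p i -> taylor v m i = 0.
Proof.
move=> v0 rp; elim/ltn_ind => -[|m] IHm i; first by case: (p i) (v0 i) => //= ->.
move=> mi; rewrite taylorS /quad_sum big_seq big1 ?mulr0 // => e er.
rewrite big1 ?mulr0 // => l _; have lm : (l <= m)%N by rewrite -ltnS.
have /eqP pe := allP (rp i) e er.
have [ol|ol] := eqVneq (odd l) (p e.2.1); last by rewrite IHm ?mul0r.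
rewrite [X in _ * X]IHm ?mulr0 ?ltnS ?leq_subr //.
by move: mi; rewrite pe oddB //= ol; case: (odd m); case: (p _); case: (p _).
Qed.

End QuadraticSystem.

(** * Convergence of the Taylor series of a solution *)

Section TaylorExpansion.
Context {R : realType}.

Lemma half_pow_cvg (C : R) : C * (n%:R * 2^-1 ^+ n) @[n --> \oo] --> (0 : R).
Proof.
(* Leaves a geometric sequence of ratio 3/4 as majorant. *)
have bd n : (n%:R : R) <= 2 * (3 / 2) ^+ n.
  elim: n => [|n IHn]; first by rewrite expr0; lra.
  have : (1 : R) <= (3 / 2) ^+ n by rewrite exprn_ege1 //; lra.
  rewrite exprS -[n.+1%:R]natr1; move: (_ ^+ n) IHn => X IHn X1; lra.
have g0 : geometric (`|C| * 2) (3 / 4) n @[n --> \oo] --> (0 : R).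
  by apply: cvg_geometric; rewrite ger0_norm; lra.
apply/cvgrPdist_lt => e e0; move/cvgrPdist_lt : g0 => /(_ e e0).
apply: filterS => n; rewrite !sub0r !normrN => h; apply: le_lt_trans h.
rewrite /geometric /= [leLHS]normrM -mulrA [leRHS]normrM normr_id ler_wpM2l //.
have h0 : (0 : R) <= 2^-1 by rewrite invr_ge0.
have h1 : (0 : R) <= 3 / 4 by lra.
rewrite !ger0_norm ?mulr_ge0 ?exprn_ge0 //.
apply: le_trans (ler_wpM2r _ (bd n)) _; first by rewrite exprn_ge0.
by rewrite -mulrA -exprMn (_ : 3 / 2 / 2 = 3 / 4 :> R) //; field.
Qed.

Lemma bounded_family (f : nat -> R -> R) (a b : R) (n : nat) : a <= b ->
  (forall i, {within `[a, b], continuous (f i)}) ->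
  (forall i r, (n <= i)%N -> f i r = 0) ->
  exists2 C : R, 0 < C & forall i r, a <= r <= b -> `|f i r| <= C.
Proof.
move=> ab fc f0; suff [C C0 Cb] : exists2 C : R, 0 < C &
    forall i r, (i < n)%N -> a <= r <= b -> `|f i r| <= C.
  exists C => // i r rab; case: (ltnP i n) => [/Cb|/f0->]; first exact.
  by rewrite normr0 ltW.
elim: n {f0} => [|n [C C0 Cb]]; first by exists 1.
have [|c _ cM] := @EVT_max R (fun s => `|f n s|) a b ab.
  by move=> s; apply: continuous_comp; [exact: fc|exact: norm_continuous].
exists (C + `|f n c|) => [|i r]; first by rewrite ltr_wpDr.
rewrite ltnS leq_eqVlt => /predU1P[->|il] rab.
  by rewrite (le_trans (cM r _)) ?in_itv // lerDr ltW.
by rewrite (le_trans (Cb _ _ il rab)) // lerDl.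
Qed.

Lemma isd_sub_exp (r1 r : R) k :
  is_derive r (1 : R) (fun y => (r1 - y) ^+ k) (- (k%:R * (r1 - r) ^+ k.-1)).
Proof.
elim: k => [|k IHk]; first by rewrite mul0r oppr0; exact: isd_cst.
under eq_fun do rewrite exprS.
apply: isd_eq (isdM (isdB (isd_cst r1 r 1) (is_derive_id r 1)) IHk) _.
by case: k {IHk} => [|k]; rewrite /= ?mulr0n ?exprS -?natr1; ring.
Qed.

Variable rhs : nat -> seq (R * (nat * nat)).
Variables (f : nat -> R -> R) (a b : R).
Hypothesis ab : a <= b.
Hypothesis f_cont : forall i, {within `[a, b], continuous (f i)}.
Hypothesis f_ode : forall r, a < r < b ->
  forall i, is_derive r (1 : R) (f i) (quad_sum rhs (fun j k => f j r * f k r) i).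
Local Notation T r := (taylor rhs (f^~ r)).

(* The Taylor polynomial centred at r, as a function of the centre: its derivative telescopes. *)
Let phi (r1 : R) i n (r : R) : R := \sum_(0 <= k < n) T r k i * (r1 - r) ^+ k.

Lemma taylor_poly_derive r1 i n r : a < r < b ->
  is_derive r (1 : R) (phi r1 i n.+1) (n.+1%:R * T r n.+1 i * (r1 - r) ^+ n).
Proof.
move=> rab; elim: n => [|n IHn].
  rewrite /phi; under eq_fun do rewrite big_nat1 expr0 mulr1.
  by rewrite expr0 mulr1; exact: (taylor_derive (f_ode rab) 0).
rewrite /phi; under eq_fun do rewrite big_nat_recr //=.
apply: isd_eq (isdD IHn (isdM (taylor_derive (f_ode rab) n.+1 i) (isd_sub_exp r1 r n.+1))) _.
by rewrite /=; ring.
Qed.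

Lemma taylor_poly_cont r1 i n : {within `[a, b], continuous (phi r1 i n)}.
Proof.
move=> r; rewrite /phi /=.
apply: cvg_big => [|k _]; first exact: add_continuous.
apply: cvgM; first apply: (@taylor_cvg R rhs f (nbhs (r : subspace `[a, b])) _ (f^~ r)).
  by move=> j; exact: f_cont.
apply: (@continuous_subspaceT _ _ _ (fun y : R => (r1 - y) ^+ k)) => y.
exact: isd_continuous (isd_sub_exp _ _ _).
Qed.

Variables (C Q : R).
Hypothesis fC : forall i r, a <= r <= b -> `|f i r| <= C.
Hypothesis rQ : forall i, \sum_(e <- rhs i) `|e.1| <= Q.

(** Centred at r1 the polynomial takes the value f(r1). By the mean value theorem in the centre, the
    change from r0 to r1 is governed by the one term left after telescoping, which [taylor_bound]
    controls. *)
Lemma taylor_remainder r0 r1 i n : a <= r0 <= b -> a <= r1 <= b ->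
  `|f i r1 - phi r1 i n.+1 r0| <= C * (n.+1%:R * (Q * C * `|r1 - r0|) ^+ n.+1).
Proof.
move=> r0ab r1ab.
have phi1 : phi r1 i n.+1 r1 = f i r1.
  rewrite /phi big_nat_recl //= taylor0 expr0 mulr1 big1 ?addr0 // => k _.
  by rewrite subrr expr0n mulr0.
have C0 : 0 <= C by apply: le_trans (fC 0%N r0ab).
have Q0 : 0 <= Q by apply: le_trans (rQ 0%N); apply: sumr_ge0.
suff [c cab [cr E]] : exists2 c, a <= c <= b & `|r1 - c| <= `|r1 - r0| /\
    `|phi r1 i n.+1 r1 - phi r1 i n.+1 r0| = `|n.+1%:R * T c n.+1 i * (r1 - c) ^+ n * (r1 - r0)|.
  rewrite -phi1 E !normrM normrX ger0_norm //.
  have Tb := @taylor_bound R rhs (f^~ c) C Q (fun j => fC j cab) rQ n.+1 i.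
  apply: (@le_trans _ _ (n.+1%:R * (C * (Q * C) ^+ n.+1) * `|r1 - r0| ^+ n * `|r1 - r0|)).
    apply: ler_wpM2r => //; apply: ler_pM => //.
      by apply: ler_wpM2l.
    by rewrite lerXn2r // nnegrE.
  by rewrite [(Q * C * _) ^+ _]exprMn [`|_| ^+ n.+1]exprSr le_eqVlt; apply/orP; left; apply/eqP; ring.
have mvt lo hi : lo <= hi -> a <= lo -> hi <= b -> exists2 c, lo <= c <= hi &
    phi r1 i n.+1 hi - phi r1 i n.+1 lo = n.+1%:R * T c n.+1 i * (r1 - c) ^+ n * (hi - lo).
  move=> lh al hb; have [||c] := @MVT_segment R (phi r1 i n.+1)
      (fun c => n.+1%:R * T c n.+1 i * (r1 - c) ^+ n) lo hi lh.
  - move=> x; rewrite in_itv /= => /andP[x1 x2]; apply: taylor_poly_derive.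
    by rewrite (le_lt_trans al) // (lt_le_trans x2).
  - apply: (@continuous_subspaceW _ _ `[lo, hi]%classic `[a, b]%classic (phi r1 i n.+1)); last exact: taylor_poly_cont.
    by apply: subset_itv; rewrite bnd_simp.
  by rewrite in_itv /= => cb E; exists c.
have /andP[a0 b0] := r0ab; have /andP[a1 b1] := r1ab.
have [r01|/ltW r10] := leP r0 r1.
  have [c /andP[c0 c1] E] := mvt _ _ r01 a0 b1; exists c.
    by rewrite (le_trans a0) // (le_trans c1).
  by rewrite E; split=> //; rewrite !ger0_norm ?subr_ge0 // lerB.
have [c /andP[c0 c1] E] := mvt _ _ r10 a1 b0; exists c.
  by rewrite (le_trans a1) // (le_trans c1).
split; last by rewrite distrC E !normrM (distrC r0).
by rewrite distrC (distrC r1) !ger0_norm ?subr_ge0 // lerB.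
Qed.

Lemma taylor_converges r0 r1 i : a <= r0 <= b -> a <= r1 <= b ->
  Q * C * `|r1 - r0| <= 2^-1 ->
  (\sum_(0 <= k < n) T r0 k i * (r1 - r0) ^+ k) @[n --> \oo] --> f i r1.
Proof.
move=> r0ab r1ab h.
have C0 : 0 <= C by apply: le_trans (fC 0%N r0ab).
have Q0 : 0 <= Q by apply: le_trans (rQ 0%N); apply: sumr_ge0.
apply/cvgrPdist_lt => e e0; have := @half_pow_cvg C; move/cvgrPdist_lt => /(_ e e0) hC.
near=> n; have n0 : (0 < n)%N by near: n; exact: nbhs_infty_gt.
have : `|0 - C * (n%:R * 2^-1 ^+ n)| < e by near: n.
rewrite sub0r normrN -(prednK n0); apply: le_lt_trans.
apply: (le_trans (taylor_remainder i n.-1 r0ab r1ab)); apply: le_trans (ler_norm _).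
by rewrite ler_wpM2l // ler_wpM2l // lerXn2r // nnegrE ?mulr_ge0 // invr_ge0.
Unshelve. all: by end_near. Qed.

End TaylorExpansion.

(** * Power series: derivatives, shifts and smoothness *)

Section PowerSeries.
Context {R : realType}.
Implicit Types (c : nat -> R) (rho w : R).

Definition converges_on rho c := forall w, `|w| < rho -> cvgn (pseries c w).
Definition psum c w : R := limn (pseries c w).

(** Each of the n + 1 terms of 1 + u + ... + u^n is at least u^n. This absorbs the factor n + 1 that
    differentiating a series creates. *)
Lemma geometric_derivative_bound (u : R) n : 0 <= u <= 1 ->
  n.+1%:R * u ^+ n * (1 - u) <= 1 - u ^+ n.+1.
Proof.
move=> /andP[u0 u1]; elim: n => [|n IHn]; first by rewrite expr0 expr1; lra.
have h : 0 <= u ^+ n.+1 <= 1 by rewrite exprn_ge0 // exprn_ile1.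
rewrite [u ^+ n.+2]exprS -[n.+2%:R]natr1 mulrDl mul1r mulrDl.
have -> : n.+1%:R * u ^+ n.+1 * (1 - u) = u * (n.+1%:R * u ^+ n * (1 - u)).
  by rewrite exprS; ring.
move/andP: h => [h0 h1]; have := ler_wpM2l u0 IHn.
have : u ^+ n.+1 * (1 - u) <= 1 - u by rewrite ler_piMl // subr_ge0.
by move: (n.+1%:R * _ * _) (u ^+ n.+1) h0 h1 => a b; nra.
Qed.

Lemma converges_on_diffs rho c : converges_on rho c -> converges_on rho (pseries_diffs c).
Proof.
(* Two radii are placed between |w| and rho: convergence at y bounds the coefficients, the ratio
   |w|/z absorbs the factor n + 1, and z/y is the ratio of the geometric majorant. *)
move=> cc w wr; pose y := (`|w| + rho) / 2; pose z := (`|w| + y) / 2.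
have w0 : 0 <= `|w| by [].
have wz : `|w| < z by rewrite /z /y; lra.
have zy : z < y by rewrite /z /y; lra.
have yr : y < rho by rewrite /y; lra.
have z0 : 0 < z by lra.
have y0 : 0 < y by lra.
have : cvgn (pseries c y) by apply: cc; rewrite ger0_norm // ltW.
move=> /cvg_series_bounded[K0 [_ K0b]].
pose K := Num.max (K0 + 1) 0.
have cK n : `|c n| * y ^+ n <= K.
  have := K0b (K0 + 1); rewrite ltrDl ltr01 => /(_ isT n I) /=.
  rewrite normrM normrX (ger0_norm (ltW y0)) => h.
  by rewrite le_max h.
have K_ge0 : 0 <= K by rewrite le_max lexx orbT.
pose u := `|w| / z; pose v := z / y.
have u01 : 0 <= u < 1 by rewrite divr_ge0 ?(ltW z0) //= ltr_pdivrMr // mul1r.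
have v01 : 0 <= v < 1 by rewrite divr_ge0 ?(ltW z0) ?(ltW y0) //= ltr_pdivrMr // mul1r.
apply: normed_cvg.
apply: (@series_le_cvg _ _ (geometric (K / y / (1 - u)) v)).
- by move=> n; rewrite normr_ge0.
- move=> n; case/andP: u01 => u0 u1; case/andP: v01 => v0 _.
  by rewrite /geometric /= !mulr_ge0 ?exprn_ge0 ?invr_ge0 ?(ltW y0) // subr_ge0 ltW.
- move=> n; rewrite /pseries_diffs /geometric /= normrM normrM ger0_norm // normrX.
  have wE : `|w| = u * v * y by rewrite /u /v; field; rewrite (gt_eqF y0) (gt_eqF z0).
  rewrite wE 2!exprMn.
  have /andP[u0 u1] := u01; have /andP[v0 v1] := v01.
  have gb := @geometric_derivative_bound u n; rewrite u0 (ltW u1) in gb; have {}gb := gb isT.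
  have gb' : n.+1%:R * u ^+ n <= (1 - u)^-1.
    rewrite -[leRHS]mul1r ler_pdivlMr ?subr_gt0 // (le_trans gb) //.
    by rewrite lerBlDr lerDl exprn_ge0.
  have cKn : `|c n.+1| * y ^+ n <= K / y by rewrite ler_pdivlMr // -mulrA -exprSr.
  have -> : n.+1%:R * `|c n.+1| * (u ^+ n * v ^+ n * y ^+ n) =
    (`|c n.+1| * y ^+ n) * (n.+1%:R * u ^+ n) * v ^+ n by ring.
  apply: ler_wpM2r; first by rewrite exprn_ge0.
  by apply: ler_pM => //; rewrite mulr_ge0 ?exprn_ge0 // ltW.
- by apply: is_cvg_geometric_series; rewrite ger0_norm; case/andP: v01.
Qed.

Lemma psum_derive rho c w : converges_on rho c -> `|w| < rho ->
  is_derive w (1 : R) (psum c) (psum (pseries_diffs c) w).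
Proof.
move=> cc wr; pose K := (`|w| + rho) / 2.
have w0 : 0 <= `|w| by [].
have K0 : 0 <= K by rewrite /K; lra.
have Kr : `|K| < rho by rewrite ger0_norm // /K; lra.
have cd := converges_on_diffs cc; have cdd := converges_on_diffs cd.
apply: (pseries_snd_diffs (cc _ Kr) (cd _ Kr) (cdd _ Kr)).
by rewrite (ger0_norm K0) /K; lra.
Qed.

Lemma psum_smooth rho c n : converges_on rho c -> Ck1 n [set w | `|w| < rho] (psum c).
Proof.
elim: n c => [|n IHn] c cc; (split; first by move=> w wr; exact: isd_continuous (psum_derive cc wr)) => //.
case; exists (psum (pseries_diffs c)); first by move=> w wr; exact: psum_derive wr.
by apply: IHn; exact: converges_on_diffs.
Qed.

Lemma pseries_shift c w n : pseries c w n.+1 = c 0%N + w * pseries (fun k => c k.+1) w n.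
Proof.
rewrite /pseries /series /= big_nat_recl //= expr0 mulr1 mulr_sumr; congr (_ + _).
by apply: eq_bigr => k _; rewrite exprS; ring.
Qed.

Lemma converges_on_shift rho c : converges_on rho c -> converges_on rho (fun k => c k.+1).
Proof.
move=> cc w wr; have [->|w0] := eqVneq w 0.
  apply/cvg_ex; exists (c 1%N); apply/cvgrPdist_lt => e e0; near=> n.
  have n0 : (0 < n)%N by near: n; exact: nbhs_infty_gt.
  rewrite /pseries /series /= -(prednK n0) big_nat_recl //= expr0 mulr1 big1 ?addr0 ?subrr ?normr0 //.
  by move=> k _; rewrite expr0n mulr0.
apply/cvg_ex; exists (w^-1 * (psum c w - c 0%N)).
have : w^-1 * (pseries c w n.+1 - c 0%N) @[n --> \oo] --> w^-1 * (psum c w - c 0%N).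
  apply: cvgM; first exact: cvg_cst.
  apply: cvgB; last exact: cvg_cst.
  by rewrite (cvg_shiftS (pseries c w)); exact: cc.
apply: cvg_trans; apply: near_eq_cvg; near=> n.
by rewrite pseries_shift addrAC subrr add0r mulKf.
Unshelve. all: by end_near. Qed.

Lemma psum_shift rho c w : converges_on rho c -> `|w| < rho ->
  psum c w = c 0%N + w * psum (fun k => c k.+1) w.
Proof.
move=> cc wr; apply: cvg_lim => //; rewrite -(cvg_shiftS (pseries c w)).
under eq_fun do rewrite pseries_shift.
apply: cvgD; first exact: cvg_cst.
by apply: cvgM; [exact: cvg_cst|exact: (converges_on_shift cc wr)].
Qed.

Lemma psum0 c : psum c 0 = c 0%N.
Proof.
apply: cvg_lim => //; apply/cvgrPdist_lt => e e0; near=> n.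
have n0 : (0 < n)%N by near: n; exact: nbhs_infty_gt.
rewrite /pseries /series /= -(prednK n0) big_nat_recl //= expr0 mulr1 big1 ?addr0 ?subrr ?normr0 //.
by move=> k _; rewrite expr0n mulr0.
Unshelve. all: by end_near. Qed.

Lemma converges_on_bound (C K : R) c : 0 < K -> (forall k, `|c k| <= C * K ^+ k) ->
  converges_on K^-1 c.
Proof.
move=> K0 cb w wr.
have C0 : 0 <= C by have := cb 0%N; rewrite expr0 mulr1; apply: le_trans.
apply: normed_cvg; apply: (@series_le_cvg _ _ (geometric C (K * `|w|))).
- by move=> n; rewrite normr_ge0.
- by move=> n; rewrite /geometric /= mulr_ge0 ?exprn_ge0 // mulr_ge0 // ltW.
- move=> n; rewrite /geometric /= normrM normrX exprMn mulrA.
  by rewrite ler_wpM2r ?exprn_ge0.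
- apply: is_cvg_geometric_series; rewrite ger0_norm ?mulr_ge0 ?(ltW K0) //.
  by rewrite mulrC -ltr_pdivlMr // mul1r.
Qed.

(* A convergent series with vanishing odd (resp. even) coefficients is a power series in r^2. *)
Lemma even_series (a : nat -> R) (r l : R) (p : bool) :
  (forall k, odd k != p -> a k = 0) ->
  (\sum_(0 <= k < n) a k * r ^+ k) @[n --> \oo] --> l ->
  cvgn (pseries (fun k => a (p + k.*2)%N) (r ^+ 2)) ->
  l = r ^+ p * psum (fun k => a (p + k.*2)%N) (r ^+ 2).
Proof.
move=> a0 al cc.
have E n : \sum_(0 <= k < n.*2) a k * r ^+ k =
    r ^+ p * pseries (fun k => a (p + k.*2)%N) (r ^+ 2) n.
  elim: n => [|n IHn]; first by rewrite /pseries /series /= !big_nil mulr0.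
  rewrite doubleS !big_nat_recr //= IHn /pseries /series /= [in RHS]big_nat_recr //= mulrDr -addrA.
  congr (_ + _); rewrite -exprM mul2n.
  move: a0; clear; case: p => /= a0.
    by rewrite (a0 n.*2) ?odd_double // mul0r add0r add1n expr1 exprS; ring.
  by rewrite (a0 n.*2.+1) /= ?odd_double // mul0r addr0 add0n expr0 mul1r.
have l1 : r ^+ p * pseries (fun k => a (p + k.*2)%N) (r ^+ 2) n @[n --> \oo] --> l.
  under eq_fun do rewrite -E.
  move/cvgrPdist_lt: al => al; apply/cvgrPdist_lt => e /al[m _ mh].
  exists m => // n /= mn; apply: mh => /=; apply: leq_trans mn _.
  by rewrite -addnn leq_addr.
have l2 : r ^+ p * pseries (fun k => a (p + k.*2)%N) (r ^+ 2) n @[n --> \oo] -->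
    r ^+ p * psum (fun k => a (p + k.*2)%N) (r ^+ 2).
  by apply: cvgM => //; exact: cvg_cst.
by apply: (cvg_unique _ l1 l2).
Qed.

End PowerSeries.

(** * The profile and the Riccati solutions as power series *)

Section ProfileSeries.
Context {R : realType} (nu0 : R) (t nu : R -> R).
Hypothesis nu0_gt0 : 0 < nu0.
Hypothesis P : profile_solution nu0 t nu.
Local Notation N := (nu2 nu).
Local Notation n0 := (nu0 ^+ 2).
Local Notation tp := (tp t N).

Definition quad_term (c : R) (j k : nat) : R * (nat * nat) := (c, (j, k)).

(** The unknowns, listed in [profile_system], are chosen so that each derivative is a quadratic
    polynomial in them. The first eight are regular at r = 0; the last three involve 1/r and serve
    expansions around r > 0. *)
Definition profile_rhs (m i : nat) : seq (R * (nat * nat)) :=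
  if (i < m)%N then nth [::]
    [:: [::];
        [:: quad_term 1 0 0; quad_term (-2) 1 2];
        [:: quad_term 1 0 3; quad_term (-8) 2 2];
        [:: quad_term (-6) 2 3];
        [:: quad_term 6 0 1];
        [:: quad_term (-2) 6 5];
        [:: quad_term 1 0 5; quad_term (-2) 6 2; quad_term (-2) 6 6];
        [:: quad_term 2 0 6; quad_term (-4) 7 2; quad_term (-2) 7 6];
        [:: quad_term (-1) 8 8];
        [:: quad_term 1 5 8; quad_term (-2) 9 2; quad_term (-2) 9 6; quad_term (-1) 9 8];
        [:: quad_term 2 9 8; quad_term (-4) 10 2; quad_term (-2) 10 6; quad_term (-2) 10 8]] i
  else [::].

(** With C = 1/y0 - n0/3 the factor 1/(N/3 + C) equals y0/[xden]. This form remains meaningful for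
    y0 = 0, where it yields the zero solution. *)
Definition xden (y0 r : R) : R := 1 + y0 * (N r - n0) / 3.
Definition xsol (y0 r : R) : R := t r ^+ 2 * (y0 / xden y0 r).

Definition profile_system (m : nat) (y0 : R) (i : nat) (r : R) : R :=
  if (i < m)%N then
    let d := y0 / xden y0 r in
    nth 0 [:: 1; t r; t r / N r; (N r)^-1; N r; d; t r * d; t r ^+ 2 * d;
              r^-1; t r * d / r; t r ^+ 2 * d / r ^+ 2] i
  else 0.

Lemma xden_derive (y0 r : R) : 0 < r -> is_derive r (1 : R) (xden y0) (2 * y0 * t r).
Proof.
move=> r0; have dN := profile_dN P r0.
apply: isd_eq (isdD (isd_cst (1 : R) r 1) (isdM (isdM (isd_cst y0 r 1)
  (isdB dN (isd_cst n0 r 1))) (isd_cst (3^-1 : R) r 1))) _.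
by field.
Qed.

Lemma profile_system_derive m (y0 r : R) : m = 8%N \/ m = 11%N -> 0 < r -> xden y0 r != 0 ->
  forall i, is_derive r (1 : R) (profile_system m y0 i)
    (quad_sum (profile_rhs m) (fun j k => profile_system m y0 j r * profile_system m y0 k r) i).
Proof.
move=> m811 r0 D0; have dN := profile_dN P r0; have dt : is_derive r (1 : R) t (tp r) by exact: (profile_dt P r0).
have Nr : N r != 0 by rewrite gt_eqF // (N_gt0 P) // ltW.
have rn : r != 0 by rewrite gt_eqF.
have rrn : (fun y : R => y * y) r != 0 by rewrite mulf_neq0.
have dr := is_derive_id r (1 : R).
have dD := xden_derive y0 r0.
have d5 := isdM (isd_cst y0 r 1) (isdV D0 dD).
have dp := isdM dt (isdV Nr dN).
have dx := isdM (isdM dt dt) d5.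
have dxi := isdM (isdM dt d5) (isdV rn dr).
have dy := isdM dx (@isdV R R (fun y => y * y) r 1 _ rrn (isdM dr dr)).
move=> i; have [|i8] := ltnP i 8.
  rewrite /quad_sum /profile_rhs /profile_system.
  case: i => [_|i]; first by case: m811 => ->; rewrite /= big_nil; exact: isd_cst.
  case: i => [_|i]; first by case: m811 => ->; rewrite /= !big_cons !big_nil /=; apply: isd_eq dt _; rewrite /tp; field.
  case: i => [_|i]; first by case: m811 => ->; rewrite /= !big_cons !big_nil /=; apply: isd_eq dp _; rewrite /tp; field.
  case: i => [_|i]; first by case: m811 => ->; rewrite /= !big_cons !big_nil /=; apply: isd_eq (isdV Nr dN) _; field.
  case: i => [_|i]; first by case: m811 => ->; rewrite /= !big_cons !big_nil /=; apply: isd_eq dN _; field.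
  case: i => [_|i]; first by case: m811 => ->; rewrite /= !big_cons !big_nil /=; apply: isd_eq d5 _; field.
  case: i => [_|i]; first by case: m811 => ->; rewrite /= !big_cons !big_nil /=; apply: isd_eq (isdM dt d5) _; rewrite /tp; field; rewrite Nr D0.
  by case: i => // _; case: m811 => ->; rewrite /= !big_cons !big_nil /=; apply: isd_eq dx _; rewrite /tp; field; rewrite Nr D0.
case: m811 => ->.
  by rewrite /quad_sum /profile_rhs /profile_system ltnNge i8 big_nil; exact: isd_cst.
rewrite /quad_sum /profile_rhs /profile_system.
do 8 (case: i i8 => // i i8).
case: i i8 => [|i] i8; first by rewrite /= !big_cons !big_nil /=; apply: isd_eq (isdV rn dr) _; field.
case: i i8 => [|i] i8; first by rewrite /= !big_cons !big_nil /=; apply: isd_eq dxi _; rewrite /tp; field; rewrite Nr D0 rn.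
case: i i8 => [|i] i8; first by rewrite /= !big_cons !big_nil /=; apply: isd_eq dy _; rewrite /tp; field; rewrite Nr D0 rn.
by rewrite big_nil; exact: isd_cst.
Qed.

Lemma profile_rhs_bound m i : m = 8%N \/ m = 11%N -> \sum_(e <- profile_rhs m i) `|e.1| <= 16.
Proof.
move=> m811; rewrite /profile_rhs.
do 11 (case: i => [|i]; first by case: m811 => ->; rewrite /= ?big_cons ?big_nil /= ?normrN ?ger0_norm //; lra).
by case: ifP; rewrite ?nth_default // big_nil.
Qed.

(** The odd unknowns are t, t/N and t y0/[xden]. *)
Lemma profile_rhs_parity i : let p i := i \in [:: 1; 2; 6]%N in
  all (fun e => p i == ~~ (p e.2.1 (+) p e.2.2)) (profile_rhs 8 i).
Proof. by do 8 (case: i => [|i] //). Qed.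

Lemma xden0 y0 : xden y0 0 = 1.
Proof. by rewrite /xden (profile_N0 P) subrr mulr0 mul0r addr0. Qed.

Lemma profile_system_cont y0 b : 0 < b -> (forall r, 0 <= r <= b -> xden y0 r != 0) ->
  forall i, {within `[0, b], continuous (profile_system 8 y0 i)}.
Proof.
move=> b0 D0 i; apply: within_right_continuous => //; last first.
  move=> r /andP[r0 rb]; apply: ex_derive; apply: profile_system_derive => //; first by left.
  by apply: D0; rewrite ltW.
have tc : t r @[r --> 0^'+] --> t 0 by exact: (profile_t_right_cont P).
have Nc := N_right_cont P.
have Dc : xden y0 r @[r --> 0^'+] --> xden y0 0.
  apply: cvgD; first exact: cvg_cst.
  apply: cvgM; last exact: cvg_cst.
  by apply: cvgM; [exact: cvg_cst|apply: cvgB => //; exact: cvg_cst].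
have N0 : N 0 != 0 by rewrite gt_eqF // (N_gt0 P).
have dc : y0 / xden y0 r @[r --> 0^'+] --> y0 / xden y0 0.
  by apply: cvgM; [exact: cvg_cst|apply: cvgV => //; rewrite xden0 oner_neq0].
rewrite /profile_system.
do 8 (case: i => [|i]; first by rewrite /=;
  first [exact: tc | exact: Nc | exact: dc | exact: (cvgV N0 Nc) | exact: (cvgM tc (cvgV N0 Nc))
    | exact: (cvgM tc dc) | exact: (cvgM (cvgM tc tc) dc) | exact: cvg_cst]).
exact: cvg_cst.
Qed.

Local Notation T y0 := (taylor (profile_rhs 8) (profile_system 8 y0 ^~ 0)).

Lemma profile_series (y0 b : R) : 0 < b -> (forall r, 0 <= r <= b -> xden y0 r != 0) ->
  exists d K C : R, [/\ 0 < d <= b, 0 < K, K * d <= 2^-1,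
    forall k i, `|T y0 k i| <= C * K ^+ k &
    forall r i, 0 <= r <= d ->
      (\sum_(0 <= k < n) T y0 k i * r ^+ k) @[n --> \oo] --> profile_system 8 y0 i r].
Proof.
move=> b0 D0; have fc := profile_system_cont b0 D0.
have f0 i r : (8 <= i)%N -> profile_system 8 y0 i r = 0.
  by rewrite /profile_system leqNgt => /negPf ->.
have [C C0 Cb] := bounded_family (ltW b0) fc f0.
have QC0 : 0 < 16 * C by rewrite mulr_gt0.
(* 16 bounds the coefficients of the system and [C] its solution on [0, b], so K = 16 C is the
   geometric rate; d keeps K d at most 1/2, the range of [taylor_converges]. *)
exists (Num.min b (2 * (16 * C))^-1), (16 * C), C; split=> //.
- by rewrite lt_min b0 invr_gt0 mulr_gt0 //= ge_min lexx.
- rewrite mulrC -ler_pdivlMr // ge_min; apply/orP; right.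
  by rewrite invfM.
- move=> k i; apply: taylor_bound.
    by move=> j; apply: Cb; rewrite lexx ltW.
  by move=> j; apply: profile_rhs_bound; left.
move=> r i /andP[r0]; rewrite le_min => /andP[rb rQ].
have := @taylor_converges R (profile_rhs 8) (profile_system 8 y0) 0 b fc _ C 16 Cb _ 0 r i.
rewrite !subr0; apply.
- move=> s /andP[s0 sb] j; apply: profile_system_derive => //; first by left.
  by apply: D0; rewrite !ltW.
- by move=> j; apply: profile_rhs_bound; left.
- by rewrite lexx ltW.
- by rewrite r0 rb.
rewrite ger0_norm // mulrC -ler_pdivlMr // (le_trans rQ) // invfM //.
Qed.

Lemma profile_init y0 i : i \in [:: 1; 2; 6; 7]%N -> profile_system 8 y0 i 0 = 0.
Proof.
rewrite /profile_system !inE => /or4P[]/eqP -> /=; rewrite ?(profile_t0 P) ?expr0n ?mul0r //.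
Qed.

Lemma profile_taylor_parity y0 m i : odd m != (i \in [:: 1; 2; 6]%N) -> T y0 m i = 0.
Proof.
apply: taylor_parity => {m}i; last exact: profile_rhs_parity.
by move=> i6; apply: profile_init; move: (i6 : i \in [:: 1; 2; 6]%N); rewrite !inE => /or3P[]->; rewrite ?orbT.
Qed.

(** This and the next lemmas give the leading terms t = r + ..., N = n0 + 3r^2 + ... and x = y0 r^2
    + ..., needed before powers of r can be divided out. *)
Lemma T_t1 y0 : T y0 1 1 = 1.
Proof.
rewrite taylorS /quad_sum /= !big_cons !big_nil /= !big_ord1 !taylor0 /= invr1.
by rewrite (@profile_init y0 1) // /profile_system /=; ring.
Qed.

Lemma T_one y0 m : T y0 m.+1 0 = 0.
Proof. by rewrite taylorS /quad_sum /= big_nil mulr0. Qed.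

Lemma T_N2 y0 : T y0 2 4 = 3.
Proof.
rewrite taylorS /quad_sum /= !big_cons !big_nil /= !big_ord_recl !big_ord0 /= !taylor0 /=.
by rewrite T_t1 (T_one y0 0) (@profile_init y0 1) // /profile_system /=; field.
Qed.

Lemma T_x2 y0 : T y0 2 7 = y0.
Proof.
rewrite taylorS /quad_sum /= !big_cons !big_nil /= !big_ord_recl !big_ord0 /= !taylor0 /=.
rewrite (T_one y0 0) !(@profile_init y0 2) // !(@profile_init y0 6) // !(@profile_init y0 7) //.
rewrite (@profile_taylor_parity y0 1 7) //.
rewrite taylorS /quad_sum /= !big_cons !big_nil /= !big_ord1 !taylor0 /=.
rewrite !(@profile_init y0 2) // !(@profile_init y0 6) // /profile_system /= xden0.
by field.
Qed.

(** At 0 the quotient has to be filled in by its limit y0. *)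
Definition ysol (y0 r : R) : R := if r == 0 then y0 else xsol y0 r / r ^+ 2.

Lemma ysol_analytic_at (y0 r0 b : R) : 0 <= r0 < b -> (forall r, 0 <= r <= b -> xden y0 r != 0) ->
  exists (a : nat -> R) (d : R), 0 < d /\ forall r, 0 <= r -> `|r - r0| < d ->
    (\sum_(0 <= k < n) a k * (r - r0) ^+ k) @[n --> \oo] --> ysol y0 r.
Proof.
move=> /andP[r00 r0b] D0; have b0 : 0 < b by apply: le_lt_trans r0b.
move: r00; rewrite le_eqVlt => /predU1P[r0E|r00].
  have [d [K [C [/andP[d0 db] K0 Kd TK Tc]]]] := profile_series b0 D0.
  (* The expansion of x at 0 starts with r^2, so the coefficients of y are those of x shifted by
     two. *)
  exists (fun k => T y0 k.+2 7), d; split=> // r r_ge0; rewrite -r0E subr0 ger0_norm // => rd.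
  rewrite /ysol; case: eqVneq => [->|rn0].
    apply/cvgrPdist_lt => e e0; near=> n.
    have n0 : (0 < n)%N by near: n; exact: nbhs_infty_gt.
    rewrite -(prednK n0) big_nat_recl //= expr0 mulr1 T_x2 big1 ?addr0 ?subrr ?normr0 //.
    by move=> k _; rewrite expr0n mulr0.
  have := Tc r 7%N; rewrite r_ge0 (ltW rd) => /(_ isT) h.
  have {}h : (\sum_(0 <= k < n.+2) T y0 k 7 * r ^+ k) @[n --> \oo] --> profile_system 8 y0 7 r.
    move: h => /cvgrPdist_lt h; apply/cvgrPdist_lt => e /h[m _ mh].
    by exists m => // n /= mn; apply: mh => /=; rewrite (leq_trans mn) // -addn2 leq_addr.
  have : (\sum_(0 <= k < n.+2) T y0 k 7 * r ^+ k) * (r ^+ 2)^-1 @[n --> \oo] --> xsol y0 r / r ^+ 2.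
    by apply: cvgM; [exact: h|exact: cvg_cst].
  apply: cvg_trans; apply: near_eq_cvg; near=> n.
  rewrite big_nat_recl // big_nat_recl //= taylor0 (@profile_init y0 7) // (@profile_taylor_parity y0 1 7) //.
  rewrite !mul0r !add0r mulr_suml; apply: eq_bigr => k _.
  rewrite (_ : r ^+ k.+2 = r ^+ k * r ^+ 2); last by rewrite -exprD addn2.
  by rewrite mulrA mulfK // expf_eq0.
(* Staying above r0/2 keeps the unknowns containing 1/r bounded, so the full system of eleven
   applies. *)
pose lo := r0 / 2; have lo0 : 0 < lo by rewrite divr_gt0.
have lor : lo < r0 by rewrite /lo; lra.
have lob : lo <= b by rewrite ltW // (lt_trans lor).
have Dlo r : lo <= r <= b -> 0 < r /\ xden y0 r != 0.
  move=> /andP[lr rb]; have r_gt0 := lt_le_trans lo0 lr; split=> //.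
  by apply: D0; rewrite rb ltW.
have fd r i : lo <= r <= b -> is_derive r (1 : R) (profile_system 11 y0 i)
    (quad_sum (profile_rhs 11) (fun j k => profile_system 11 y0 j r * profile_system 11 y0 k r) i).
  by move=> /Dlo[r_gt0 Dr]; apply: profile_system_derive => //; right.
have fc i : {within `[lo, b], continuous (profile_system 11 y0 i)}.
  apply: derivable_within_continuous => r; rewrite in_itv /= => rb.
  by apply: ex_derive; exact: fd.
have f0 i r : (11 <= i)%N -> profile_system 11 y0 i r = 0.
  by rewrite /profile_system leqNgt => /negPf ->.
have [C C0 Cb] := bounded_family lob fc f0.
have QC0 : 0 < 16 * C by rewrite mulr_gt0.
exists (fun k => taylor (profile_rhs 11) (profile_system 11 y0 ^~ r0) k 10),
  (Num.min (Num.min (r0 - lo) (b - r0)) (2 * (16 * C))^-1); split.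
  by rewrite !lt_min !subr_gt0 lor r0b invr_gt0 mulr_gt0.
move=> r r_ge0; rewrite !lt_min => /andP[/andP[h1 h2] h3].
have lr : lo < r by move: h1; rewrite ltr_norml => /andP[h _]; lra.
have rb : r < b by move: h2; rewrite ltr_norml => /andP[_ h]; lra.
have -> : ysol y0 r = profile_system 11 y0 10 r.
  by rewrite /ysol gt_eqF // (lt_trans lo0).
apply: (@taylor_converges R (profile_rhs 11) (profile_system 11 y0) lo b fc _ C 16 Cb).
- by move=> s /andP[s1 s2] j; apply: fd; rewrite !ltW.
- by move=> j; apply: profile_rhs_bound; right.
- by rewrite !ltW.
- by rewrite !ltW.
by rewrite mulrC -ler_pdivlMr // (le_trans (ltW h3)) // invfM.
Unshelve. all: by end_near. Qed.

(* Parity of the Taylor coefficients at 0 turns them into power series in w = r^2. *)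
Lemma profile_even_series (y0 b : R) i : 0 < b -> (forall r, 0 <= r <= b -> xden y0 r != 0) ->
  let p : bool := i \in [:: 1; 2; 6]%N in
  exists2 d : R, 0 < d & exists c : nat -> R, [/\ converges_on (d ^+ 2) c,
    forall k, c k = T y0 (p + k.*2) i &
    forall r, 0 <= r < d -> profile_system 8 y0 i r = r ^+ p * psum c (r ^+ 2)].
Proof.
move=> b0 D0 p; have [d [K [C [/andP[d0 db] K0 Kd TK Tc]]]] := profile_series b0 D0.
exists d => //; exists (fun k => T y0 (p + k.*2) i).
have cc : converges_on (d ^+ 2) (fun k => T y0 (p + k.*2) i).
  have K2 : 0 < K ^+ 2 by rewrite exprn_gt0.
  have : converges_on (K ^+ 2)^-1 (fun k => T y0 (p + k.*2) i).
    apply: (@converges_on_bound R (C * K ^+ p)) => // k.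
    by rewrite -mulrA -exprM mul2n -exprD; exact: TK.
  move=> h w wd; apply: h; apply: lt_le_trans wd _.
  rewrite -exprVn lerXn2r ?nnegrE ?invr_ge0 ?(ltW d0) ?(ltW K0) //.
  rewrite -[leRHS]mul1r ler_pdivlMr // mulrC (le_trans Kd) //.
  have : (0 : R) < 2 by []; lra.
split=> // r /andP[r0 rd]; apply: (@even_series R (fun k => T y0 k i) r _ p).
- by move=> k; exact: profile_taylor_parity.
- by apply: Tc; rewrite r0 ltW.
by apply: cc; rewrite ger0_norm ?exprn_ge0 // ltrXn2r // nnegrE.
Qed.

Lemma profile_even :
  exists (d : R) (T1 P1 : R -> R), [/\ 0 < d,
    forall n, Ck1 n [set w : R | `|w| < d ^+ 2] T1,
    forall n, Ck1 n [set w : R | `|w| < d ^+ 2] P1 &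
    forall r, 0 <= r < d -> t r = r * (1 + r ^+ 2 * T1 (r ^+ 2)) /\
      N r - n0 = 3 * r ^+ 2 * (1 + r ^+ 2 * P1 (r ^+ 2))].
Proof.
(* The components t and N do not involve y0; taking y0 = 0 makes the denominator identically 1. *)
have D0 (r : R) : 0 <= r <= 1 -> xden 0 r != 0 by rewrite /xden !mul0r addr0 oner_neq0.
have [d1 d1_0 [c1 [cc1 cE1 E1]]] := @profile_even_series 0 1 1 ltr01 D0.
have [d2 d2_0 [c2 [cc2 cE2 E2]]] := @profile_even_series 0 1 4 ltr01 D0.
have cc1' := converges_on_shift cc1.
have cc2' := converges_on_shift (converges_on_shift cc2).
have sub (d d' : R) : 0 < Num.min d d' -> (Num.min d d') ^+ 2 <= d ^+ 2 /\ (Num.min d d') ^+ 2 <= d' ^+ 2.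
  move=> d0; split; rewrite lerXn2r ?nnegrE ?(ltW d0) ?ge_min ?lexx ?orbT //.
    by apply: le_trans (ltW d0) _; rewrite ge_min lexx.
  by apply: le_trans (ltW d0) _; rewrite ge_min lexx orbT.
exists (Num.min d1 d2), (psum (fun k => c1 k.+1)), (fun w => psum (fun k => c2 k.+2) w / 3).
have d0 : 0 < Num.min d1 d2 by rewrite lt_min d1_0.
have [s1 s2] := sub _ _ d0; split=> //.
- by move=> n; apply: Ck_sub (psum_smooth n cc1') => w /= wd; exact: lt_le_trans wd s1.
- move=> n; apply: CkM; last exact: Ck_cst.
  by apply: Ck_sub (psum_smooth n cc2') => w /= wd; exact: lt_le_trans wd s2.
move=> r /andP[r0]; rewrite lt_min => /andP[rd1 rd2].
have w1 : `|r ^+ 2| < d1 ^+ 2 by rewrite ger0_norm ?exprn_ge0 // ltrXn2r // nnegrE ltW.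
have w2 : `|r ^+ 2| < d2 ^+ 2 by rewrite ger0_norm ?exprn_ge0 // ltrXn2r // nnegrE ltW.
split.
  have := E1 r; rewrite r0 rd1 => /(_ isT); rewrite /profile_system /= => ->.
  by rewrite (psum_shift cc1 w1) cE1 /= T_t1 expr1.
have := E2 r; rewrite r0 rd2 => /(_ isT); rewrite /profile_system /= => ->.
rewrite (psum_shift cc2 w2) (psum_shift (converges_on_shift cc2) w2) !cE2 /= taylor0 T_N2.
by rewrite /profile_system /= (profile_N0 P) expr0; field.
Qed.

Lemma ysol_even (y0 b : R) : 0 < b -> (forall r, 0 <= r <= b -> xden y0 r != 0) ->
  exists (d : R) (Y : R -> R), [/\ 0 < d, forall n, Ck1 n [set w : R | `|w| < d ^+ 2] Y &
    forall r, 0 <= r < d -> ysol y0 r = Y (r ^+ 2)].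
Proof.
move=> b0 D0; have [d d0 [c [cc cE E]]] := @profile_even_series y0 b 7 b0 D0.
exists d, (psum (fun k => c k.+1)); split=> // [n|r /andP[r0 rd]].
  exact: psum_smooth (converges_on_shift cc).
have w : `|r ^+ 2| < d ^+ 2 by rewrite ger0_norm ?exprn_ge0 // ltrXn2r // nnegrE ltW.
rewrite /ysol; case: eqVneq => [->|rn].
  by rewrite expr0n /= psum0 cE /= T_x2.
have := E r; rewrite r0 rd => /(_ isT); rewrite {1}/profile_system /= => Ex.
rewrite /xsol Ex (psum_shift cc w) cE /= taylor0 (@profile_init y0 7) //.
by rewrite expr0 mul1r add0r mulrC mulKf // expf_eq0.
Qed.

End ProfileSeries.

(** * Quaternion-valued forms and gauge transformations *)

Section QuatRing.
Context {R : realType}.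
Implicit Types x y z : quat R.

Lemma quat_ext x y : q0 x = q0 y -> q1 x = q1 y -> q2 x = q2 y -> q3 x = q3 y -> x = y.
Proof. by case: x => ????; case: y => ???? /= -> -> -> ->. Qed.

HB.instance Definition _ := gen_eqMixin (quat R).
HB.instance Definition _ := gen_choiceMixin (quat R).

Definition qopp x := Quat (- q0 x) (- q1 x) (- q2 x) (- q3 x).
Definition qzero : quat R := Quat 0 0 0 0.
Definition qone : quat R := Quat 1 0 0 0.

Lemma qaddA : associative (@qadd R). Proof. by move=> x y z; apply: quat_ext; exact: addrA. Qed.
Lemma qaddC : commutative (@qadd R). Proof. by move=> x y; apply: quat_ext; exact: addrC. Qed.
Lemma qadd0 : left_id qzero (@qadd R). Proof. by move=> x; apply: quat_ext; exact: add0r. Qed.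
Lemma qaddN : left_inverse qzero qopp (@qadd R).
Proof. by move=> x; apply: quat_ext; exact: addNr. Qed.

HB.instance Definition _ := GRing.isZmodule.Build (quat R) qaddA qaddC qadd0 qaddN.

Lemma qmulA : associative (@qmul R).
Proof. by move=> x y z; apply: quat_ext; rewrite /=; ring. Qed.
Lemma qmul1l : left_id qone (@qmul R).
Proof. by move=> x; apply: quat_ext; rewrite /=; ring. Qed.
Lemma qmul1r : right_id qone (@qmul R).
Proof. by move=> x; apply: quat_ext; rewrite /=; ring. Qed.
Lemma qmulDl : left_distributive (@qmul R) (@qadd R).
Proof. by move=> x y z; apply: quat_ext; rewrite /=; ring. Qed.
Lemma qmulDr : right_distributive (@qmul R) (@qadd R).
Proof. by move=> x y z; apply: quat_ext; rewrite /=; ring. Qed.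

HB.instance Definition _ :=
  GRing.Zmodule_isPzRing.Build (quat R) qmulA qmul1l qmul1r qmulDl qmulDr.

Definition qreal (c : R) : quat R := Quat c 0 0 0.

Lemma qconjK x : qconj (qconj x) = x. Proof. by apply: quat_ext; rewrite /= ?opprK. Qed.
Lemma qconjM x y : qconj (x * y) = qconj y * qconj x.
Proof. by apply: quat_ext; rewrite /=; ring. Qed.
Lemma qconj_mul x : qconj x * x = qreal (qnorm2 x).
Proof. by apply: quat_ext; rewrite /= /qnorm2; ring. Qed.
Lemma qmul_conj x : x * qconj x = qreal (qnorm2 x).
Proof. by apply: quat_ext; rewrite /= /qnorm2; ring. Qed.
Lemma qreal1 : qreal 1 = 1. Proof. by []. Qed.
Lemma qnorm2M x y : qnorm2 (x * y) = qnorm2 x * qnorm2 y.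
Proof. by rewrite /qnorm2 /=; ring. Qed.
Lemma qnorm2_conj x : qnorm2 (qconj x) = qnorm2 x.
Proof. by rewrite /qnorm2 /=; ring. Qed.

Lemma unit_qconj x : qnorm2 x = 1 -> qconj x * x = 1 /\ x * qconj x = 1.
Proof. by move=> x1; rewrite qconj_mul qmul_conj x1. Qed.

End QuatRing.

Section QuatDerive.
Context {R : realType} {V : normedModType R}.
Implicit Types (c d : V -> quat R).

Definition is_qderive (x v : V) c (dc : quat R) : Prop :=
  [/\ is_derive x v (fun y => q0 (c y)) (q0 dc), is_derive x v (fun y => q1 (c y)) (q1 dc),
      is_derive x v (fun y => q2 (c y)) (q2 dc) & is_derive x v (fun y => q3 (c y)) (q3 dc)].

Lemma qdD x v c d dc dd : is_qderive x v c dc -> is_qderive x v d dd ->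
  is_qderive x v (fun y => c y + d y) (dc + dd).
Proof. by move=> [????] [????]; split; exact: isdD. Qed.

Lemma qdM x v c d dc dd : is_qderive x v c dc -> is_qderive x v d dd ->
  is_qderive x v (fun y => c y * d y) (dc * d x + c x * dd).
Proof.
move=> [c0 c1 c2 c3] [d0 d1 d2 d3]; split.
- by apply: isd_eq (isdB (isdB (isdB (isdM c0 d0) (isdM c1 d1)) (isdM c2 d2)) (isdM c3 d3)) _; rewrite /=; ring.
- by apply: isd_eq (isdB (isdD (isdD (isdM c0 d1) (isdM c1 d0)) (isdM c2 d3)) (isdM c3 d2)) _; rewrite /=; ring.
- by apply: isd_eq (isdD (isdD (isdB (isdM c0 d2) (isdM c1 d3)) (isdM c2 d0)) (isdM c3 d1)) _; rewrite /=; ring.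
- by apply: isd_eq (isdD (isdB (isdD (isdM c0 d3) (isdM c1 d2)) (isdM c2 d1)) (isdM c3 d0)) _; rewrite /=; ring.
Qed.

Lemma qd_conj x v c dc : is_qderive x v c dc -> is_qderive x v (fun y => qconj (c y)) (qconj dc).
Proof. by move=> [c0 c1 c2 c3]; split=> //; exact: isdN. Qed.

Lemma qd_near x v c d dc : (\forall y \near x, c y = d y) ->
  is_qderive x v c dc -> is_qderive x v d dc.
Proof.
move=> cd [c0 c1 c2 c3]; split.
- by apply: isd_near c0; apply: filterS cd => y ->.
- by apply: isd_near c1; apply: filterS cd => y ->.
- by apply: isd_near c2; apply: filterS cd => y ->.
- by apply: isd_near c3; apply: filterS cd => y ->.
Qed.

Lemma qd_cst x v (k : quat R) : is_qderive x v (fun=> k) 0.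
Proof. by split; exact: isd_cst. Qed.

Lemma qd_unique x v c dc dd : is_qderive x v c dc -> is_qderive x v c dd -> dc = dd.
Proof.
move=> [c0 c1 c2 c3] [d0 d1 d2 d3]; apply: quat_ext.
- exact: isd_unique c0 d0.
- exact: isd_unique c1 d1.
- exact: isd_unique c2 d2.
- exact: isd_unique c3 d3.
Qed.

Lemma qd_eq x v c dc dd : is_qderive x v c dc -> dc = dd -> is_qderive x v c dd.
Proof. by move=> h <-. Qed.

End QuatDerive.

Section Gauge.
Context {R : realType}.

(* With D_a u^-1 = - u^-1 (D_a u) u^-1, everything but u^-1 F u cancels. *)
Lemma gauge_covariance_alg (u v a b da_b db_a ua ub uab : quat R) :
  v * u = 1 -> u * v = 1 ->
  let d_cu w1 w2 c dc := - (v * w1 * v) * c * u + v * dc * u + v * c * w1 + (- (v * w1 * v) * w2 + v * uab) in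
  let ca := v * a * u + v * ua in let cb := v * b * u + v * ub in
  d_cu ua ub b da_b - d_cu ub ua a db_a + (ca * cb - cb * ca) =
  v * (da_b - db_a + (a * b - b * a)) * u.
Proof.
move=> vu uv d_cu ca cb.
have E1 x w c : - (v * w * v) * c * u + v * x * u + v * c * w =
    - ((v * w) * (v * c * u)) + v * x * u + (v * c * u) * (v * w).
  by rewrite -(mulrA (v * c)) (mulrA u) uv mul1r -!mulNr !mulrA.
have E2 w w' : - (v * w * v) * w' = - ((v * w) * (v * w')) by rewrite mulNr !mulrA.
have E3 x y : v * (x * y) * u = (v * x * u) * (v * y * u).
  by rewrite -!mulrA (mulrA u v) uv mul1r.
rewrite /d_cu /ca /cb !E1 !E2 !(mulrDr v, mulrDl _ _ u, mulrN v, mulNr _ u) !E3.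
move: (v * a * u) (v * b * u) (v * ua) (v * ub) (v * uab) (v * da_b * u) (v * db_a * u).
by move=> p q x y z X Y; apply: quat_ext; rewrite /=; ring.
Qed.

Context {V : normedModType R} {I : Type} (dir : I -> V).

Definition covariant (u du : V -> quat R) (c : V -> quat R) (x : V) : quat R :=
  qconj (u x) * c x * u x + qconj (u x) * du x.

(** Differentiate conj(u) u = 1 and multiply by conj(u) on the right. *)
Lemma unit_derive (x v : V) (u : V -> quat R) (du : quat R) :
  (\forall y \near x, qnorm2 (u y) = 1) -> is_qderive x v u du ->
  qconj du = - (qconj (u x) * du * qconj (u x)).
Proof.
move=> u1 d; have [vu uv] := unit_qconj (nbhs_singleton u1).
have : is_qderive x v (fun y => qconj (u y) * u y) 0.
  apply: qd_near (qd_cst x v 1); apply: filterS u1 => y y1.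
  by rewrite (unit_qconj y1).1.
move=> /qd_unique /(_ (qdM (qd_conj d) d)) /esym/eqP; rewrite addr_eq0 => /eqP E.
by rewrite -mulNr -E -mulrA uv mulr1.
Qed.

Lemma gauge_derive (x : V) (i j : I) (u : V -> quat R) (du : I -> V -> quat R) (ddu : quat R)
    (c : V -> quat R) (dc : quat R) :
  (\forall y \near x, qnorm2 (u y) = 1) ->
  is_qderive x (dir i) u (du i x) -> is_qderive x (dir i) (du j) ddu ->
  is_qderive x (dir i) c dc ->
  is_qderive x (dir i) (covariant u (du j) c)
    (- (qconj (u x) * du i x * qconj (u x)) * c x * u x + qconj (u x) * dc * u x +
      qconj (u x) * c x * du i x +
     (- (qconj (u x) * du i x * qconj (u x)) * du j x + qconj (u x) * ddu)).
Proof.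
move=> u1 d dd cd; have dv := qd_conj d.
apply: qd_eq (qdD (qdM (qdM dv cd) d) (qdM dv dd)) _.
by rewrite -(unit_derive u1 d) mulrDl.
Qed.

End Gauge.

Section HForms.
Context {R : realType} (n : nat).
Local Notation e_ := (@basis_vec R n).
Implicit Types (A B : hform (R := R) n) (u : qfun (R := R) n) (x : 'rV[R]_n).

Definition qone_form (c : 'I_n -> quat R) : quat (ext R n) :=
  Quat (one_form (fun a => q0 (c a))) (one_form (fun a => q1 (c a)))
       (one_form (fun a => q2 (c a))) (one_form (fun a => q3 (c a))).

Definition qtwo_form (c : 'I_n -> 'I_n -> quat R) : quat (ext R n) :=
  Quat (two_form (fun a b => q0 (c a b))) (two_form (fun a b => q1 (c a b)))
       (two_form (fun a b => q2 (c a b))) (two_form (fun a b => q3 (c a b))).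

Lemma eq_qone_form c d : (forall a, c a = d a) -> qone_form c = qone_form d.
Proof. by move=> /funext ->. Qed.

Lemma qone_form_inj c d : qone_form c = qone_form d -> forall a, c a = d a.
Proof.
move=> E a; apply: quat_ext.
- by have := congr1 (fun w : ext R n => w (finset.set1 a)) (congr1 (@q0 _) E); rewrite /= !one_form_set1.
- by have := congr1 (fun w : ext R n => w (finset.set1 a)) (congr1 (@q1 _) E); rewrite /= !one_form_set1.
- by have := congr1 (fun w : ext R n => w (finset.set1 a)) (congr1 (@q2 _) E); rewrite /= !one_form_set1.
- by have := congr1 (fun w : ext R n => w (finset.set1 a)) (congr1 (@q3 _) E); rewrite /= !one_form_set1.
Qed.

Lemma eq_qtwo_form c d : (forall a b, c a b - c b a = d a b - d b a) ->
  qtwo_form c = qtwo_form d.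
Proof.
move=> cd; rewrite /qtwo_form; congr Quat; apply: eq_two_form => a b.
- exact: (congr1 (@q0 R) (cd a b)).
- exact: (congr1 (@q1 R) (cd a b)).
- exact: (congr1 (@q2 R) (cd a b)).
- exact: (congr1 (@q3 R) (cd a b)).
Qed.

Definition qpartial u (a : 'I_n) x : quat R := qeval (qmap (fun f => 'D_(e_ a) f) u) x.

Lemma smooth_one_form (D : set 'rV[R]_n) (A : Defs.form R n) (c : 'rV[R]_n -> 'I_n -> R) :
  open D -> (forall x, D x -> A x = one_form (c x)) ->
  (forall a m, Ck e_ m D (fun x => c x a)) -> smooth_form_on D A.
Proof.
move=> oD AE cS S; apply/(smooth_onP _ oD) => m.
have [/finset.cards1P[a ->]|S1] := boolP (#|S| == 1)%N.
  by apply: Ck_eq (cS a m) => // x Dx; rewrite AE // one_form_set1.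
by apply: Ck_eq (Ck_cst e_ m D 0) => // x Dx; rewrite AE // one_form_neq1.
Qed.

Lemma smooth_form_coef (D : set 'rV[R]_n) (A : Defs.form R n) (c : 'rV[R]_n -> 'I_n -> R) :
  open D -> (forall x, D x -> A x = one_form (c x)) -> smooth_form_on D A ->
  forall a m, Ck e_ m D (fun x => c x a).
Proof.
move=> oD AE AS a m; apply: Ck_eq ((smooth_onP _ oD).1 (AS [set a]%SET) m) => // x Dx.
by rewrite AE // one_form_set1.
Qed.

End HForms.

Section BaseFibre.
Context {R : realType}.
Local Notation e_ := (@basis_vec R (4 + 4)).
Implicit Types (p : 'rV[R]_(4 + 4)) (z : 'rV[R]_4).

(** Coefficients of a form pulled back along [base]: none in the fibre directions. The zero is a
    parameter so that real and quaternionic coefficients are treated alike. *)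
Definition lift4 {T : Type} (zero : T) (c : 'I_4 -> T) (a : 'I_(4 + 4)) : T :=
  match fintype.split a with inl j => c j | inr _ => zero end.

Lemma base_coord p j : base p 0 j = p 0 (lshift 4 j).
Proof. by rewrite mxE. Qed.

Lemma partial_base p (a : 'I_(4 + 4)) j :
  'D_(e_ a) (fun y => base y 0 j) p = (a == lshift 4 j)%:R.
Proof. by under eq_fun do rewrite base_coord; rewrite (derive_val (is_derive := is_derive_coord _ _ _)). Qed.

Lemma pullback1_base (f : Defs.form R 4) p :
  pullback1 base f p = one_form (lift4 0 (fun j => f (base p) [set j]%SET)).
Proof.
rewrite pullback1E; apply: eq_one_form => a.
under eq_bigr do rewrite partial_base.
rewrite /lift4; case: splitP => [j aj|k ak].
  have -> : a = lshift 4 j by apply: val_inj.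
  rewrite (bigD1 j) //= eqxx mulr1 big1 ?addr0 // => k kj.
  by rewrite (inj_eq (@lshift_inj _ _)) eq_sym (negPf kj) mulr0.
rewrite big1 // => j _; case: eqP => [aE|_]; last by rewrite mulr0.
by have := ltn_ord j; have := ak; rewrite aE /= => ->; rewrite ltnNge leq_addr.
Qed.

Definition dq (a : 'I_(4 + 4)) : quat R :=
  Quat (a == rshift 4 (o4 0))%:R (a == rshift 4 (o4 1))%:R
       (a == rshift 4 (o4 2))%:R (a == rshift 4 (o4 3))%:R.

Lemma fibreE p : fibre p = Quat (p 0 (rshift 4 (o4 0))) (p 0 (rshift 4 (o4 1)))
  (p 0 (rshift 4 (o4 2))) (p 0 (rshift 4 (o4 3))).
Proof. by rewrite /fibre /quat_of_row !mxE. Qed.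

Lemma fibre0E : (fun p => q0 (fibre p)) = (fun p => p 0 (rshift 4 (o4 0))).
Proof. by apply/funext => p; rewrite fibreE. Qed.
Lemma fibre1E : (fun p => q1 (fibre p)) = (fun p => p 0 (rshift 4 (o4 1))).
Proof. by apply/funext => p; rewrite fibreE. Qed.
Lemma fibre2E : (fun p => q2 (fibre p)) = (fun p => p 0 (rshift 4 (o4 2))).
Proof. by apply/funext => p; rewrite fibreE. Qed.
Lemma fibre3E : (fun p => q3 (fibre p)) = (fun p => p 0 (rshift 4 (o4 3))).
Proof. by apply/funext => p; rewrite fibreE. Qed.

Lemma fibre_derive p a : is_qderive p (e_ a) (@fibre R) (dq a).
Proof.
by split; rewrite ?fibre0E ?fibre1E ?fibre2E ?fibre3E; exact: is_derive_coord.
Qed.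

Lemma qpartial_fibre a p : qpartial (@fibre_coord R) a p = dq a.
Proof.
have [d0 d1 d2 d3] := fibre_derive p a.
by apply: quat_ext; rewrite /= ; [exact: (derive_val (is_derive := d0))|exact: (derive_val (is_derive := d1))
  |exact: (derive_val (is_derive := d2))|exact: (derive_val (is_derive := d3))].
Qed.

Lemma fibre_smooth m D : [/\ Ck e_ m D (fun p => q0 (fibre p)), Ck e_ m D (fun p => q1 (fibre p)),
  Ck e_ m D (fun p => q2 (fibre p)) & Ck e_ m D (fun p => q3 (fibre p))].
Proof.
by split; rewrite ?fibre0E ?fibre1E ?fibre2E ?fibre3E; exact: Ck_coord.
Qed.

Lemma base_Ck m (D : set 'rV[R]_4) f : Ck (@basis_vec R 4) m D f ->
  Ck e_ m [set p | D (base p)] (fun p => f (base p)).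
Proof.
apply: Ck_linear => [h v x|x|a].
- by apply/rowP => j; rewrite !mxE.
- exact/differentiable_continuous/differentiable_lsubmx.
case: (splitP a) => [j aj|k ak]; [right; exists j|left]; apply/rowP => l; rewrite !mxE eqxx /=.
  by congr (_%:R); rewrite -!val_eqE /= aj.
by rewrite -val_eqE /= ak; case: eqP => // E; have := ltn_ord l; rewrite E ltnNge leq_addr.
Qed.

Lemma base_derive (f : 'rV[R]_4 -> quat R) p (df : 'I_4 -> quat R) a :
  (forall j, is_qderive (base p) (@basis_vec R 4 j) f (df j)) ->
  is_qderive p (e_ a) (fun y => f (base y)) (lift4 0 df a).
Proof.
have lin h : base (h *: e_ a + p) = h *: base (e_ a) + base p.
  by apply/rowP => j; rewrite !mxE.
move=> fd; rewrite /lift4; case: splitP => [j aj|k ak].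
  have E : base (e_ a) = @basis_vec R 4 j.
    by apply/rowP => l; rewrite !mxE eqxx /=; congr (_%:R); rewrite -!val_eqE /= aj.
  have [f0 f1 f2 f3] := fd j.
  by split; apply/isd_line; under eq_fun do rewrite lin E;
    [move/isd_line: f0|move/isd_line: f1|move/isd_line: f2|move/isd_line: f3].
have E : base (e_ a) = 0.
  apply/rowP => l; rewrite !mxE eqxx /= -val_eqE /= ak.
  by case: eqP => // E; have := ltn_ord l; rewrite E ltnNge leq_addr.
by split; apply/isd_line; under eq_fun do rewrite lin E scaler0 add0r; exact: isd_cst.
Qed.

End BaseFibre.

Section GaugeCurvature.
Context {R : realType} (n : nat).
Local Notation e_ := (@basis_vec R n).
Implicit Types (D : set 'rV[R]_n) (u : qfun (R := R) n).

Lemma smooth_derive D (f : 'rV[R]_n -> R) a x : open D -> smooth_on D f -> D x ->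
  is_derive x (e_ a) f ('D_(e_ a) f x).
Proof.
by move=> oD /(_ [::] x) fS /fS[_ /(_ a)]; exact: derivableP.
Qed.

Lemma smooth_derive2 D (f : 'rV[R]_n -> R) a b x : open D -> smooth_on D f -> D x ->
  is_derive x (e_ a) (fun y => 'D_(e_ b) f y) ('D_(e_ a) (fun y => 'D_(e_ b) f y) x).
Proof.
by move=> oD /(_ [:: b] x) fS /fS[_ /(_ a)]; exact: derivableP.
Qed.

Definition qpartial2 u a b x : quat R :=
  qeval (qmap (fun f y => 'D_(e_ a) (fun z => 'D_(e_ b) f z) y) u) x.

Lemma qpartial_derive D u a x : open D -> qall (smooth_on D) u -> D x ->
  is_qderive x (e_ a) (qeval u) (qpartial u a x).
Proof.
move=> oD [s0 s1 s2 s3] Dx; split.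
- exact: smooth_derive s0 Dx.
- exact: smooth_derive s1 Dx.
- exact: smooth_derive s2 Dx.
- exact: smooth_derive s3 Dx.
Qed.

Lemma qpartial2_derive D u a b x : open D -> qall (smooth_on D) u -> D x ->
  is_qderive x (e_ a) (qpartial u b) (qpartial2 u a b x).
Proof.
move=> oD [s0 s1 s2 s3] Dx; split.
- exact: smooth_derive2 s0 Dx.
- exact: smooth_derive2 s1 Dx.
- exact: smooth_derive2 s2 Dx.
- exact: smooth_derive2 s3 Dx.
Qed.

Lemma qpartial2C D u a b x : open D -> qall (smooth_on D) u -> D x ->
  qpartial2 u a b x = qpartial2 u b a x.
Proof.
move=> oD [s0 s1 s2 s3] Dx; apply: quat_ext.
- exact: smooth_schwarz s0 Dx.
- exact: smooth_schwarz s1 Dx.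
- exact: smooth_schwarz s2 Dx.
- exact: smooth_schwarz s3 Dx.
Qed.

Definition gauged u (c : 'rV[R]_n -> 'I_n -> quat R) x a : quat R :=
  qconj (qeval u x) * c x a * qeval u x + qconj (qeval u x) * qpartial u a x.

(** The coefficient of dA + A^A in the directions a and b. The derivatives are an argument, so one
    formula serves the base, the total space and gauge transforms. *)
Definition field_strength (c : 'I_n -> quat R) (dc : 'I_n -> 'I_n -> quat R) a b :=
  dc a b - dc b a + (c a * c b - c b * c a).

Lemma gauge_field_strength D u c (dc : 'I_n -> 'I_n -> quat R) x :
  open D -> qall (smooth_on D) u -> unit_on D u -> D x ->
  (forall a b, is_qderive x (e_ a) (fun y => c y b) (dc a b)) ->
  exists2 dg : 'I_n -> 'I_n -> quat R,
    forall a b, is_qderive x (e_ a) (fun y => gauged u c y b) (dg a b) &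
    forall a b, field_strength (gauged u c x) dg a b =
      qconj (qeval u x) * field_strength (c x) dc a b * qeval u x.
Proof.
move=> oD uS u1 Dx cd; have u1' : \forall y \near x, qnorm2 (qeval u y) = 1.
  exact: open_near oD Dx u1.
exists (fun a b => - (qconj (qeval u x) * qpartial u a x * qconj (qeval u x)) * c x b * qeval u x
   + qconj (qeval u x) * dc a b * qeval u x + qconj (qeval u x) * c x b * qpartial u a x +
     (- (qconj (qeval u x) * qpartial u a x * qconj (qeval u x)) * qpartial u b x
      + qconj (qeval u x) * qpartial2 u a b x)) => [a b|a b].
  apply: (@gauge_derive _ _ _ e_ x a b (qeval u) (qpartial u) _ (fun y => c y b)) => //.
    exact: qpartial_derive uS Dx.
  exact: qpartial2_derive uS Dx.
have [vu uv] := unit_qconj (u1 _ Dx).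
(* The second derivatives of u drop out of the antisymmetrization only because they commute. *)
rewrite /field_strength (qpartial2C b a oD uS Dx).
exact: gauge_covariance_alg.
Qed.

End GaugeCurvature.

Local Notation radius := Defs.radius.

(** * The radius and the unit fibre coordinate away from the zero section *)

Section Radius.
Context {R : realType}.
Local Notation e_ := (@basis_vec R (4 + 4)).
Implicit Types (p : 'rV[R]_(4 + 4)).

Lemma qnorm2_ge0 (x : quat R) : 0 <= qnorm2 x.
Proof. by rewrite /qnorm2 !addr_ge0 // sqr_ge0. Qed.

Lemma radius_ge0 p : 0 <= radius p.
Proof. exact: sqrtr_ge0. Qed.

Lemma radius_sq p : radius p ^+ 2 = qnorm2 (fibre p).
Proof. by rewrite sqr_sqrtr // qnorm2_ge0. Qed.

Lemma qnorm2_fibre_Ck m D : Ck e_ m D (fun p => qnorm2 (fibre p)).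
Proof. have [f0 f1 f2 f3] := @fibre_smooth R m D; rewrite /qnorm2.
exact: CkD (CkD (CkD (CkX 2 f0) (CkX 2 f1)) (CkX 2 f2)) (CkX 2 f3). Qed.

Lemma radius_continuous : continuous (@radius R).
Proof.
move=> p; have /Ck_cont/(_ (I : setT p)) := qnorm2_fibre_Ck 0 setT.
by move=> c; apply: continuous_comp c _; exact: sqrt_continuous.
Qed.

Lemma sqrt_Ck1 n : Ck1 n [set r : R | 0 < r] (@Num.sqrt R).
Proof.
elim: n => [|n IHn]; split => //; try by move=> x _; exact: sqrt_continuous.
case; exists (fun x => (2 * Num.sqrt x)^-1); first by move=> x x0; exact: is_derive1_sqrt.
apply: CkV; first by move=> x x0; rewrite mulf_neq0 // gt_eqF // sqrtr_gt0.
by apply: CkM => //; exact: Ck_cst.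
Qed.

Lemma radius_gt0 p : (0 < radius p) = (0 < qnorm2 (fibre p)).
Proof. exact: sqrtr_gt0. Qed.

Lemma radius_Ck m : Ck e_ m [set p | 0 < radius p] (@radius R).
Proof.
apply: (@Ck_comp _ _ _ e_ m _ [set r : R | 0 < r]) (sqrt_Ck1 m) (qnorm2_fibre_Ck m _).
by move=> p /=; rewrite radius_gt0.
Qed.

Lemma open_radius (U : set R) : open U -> open [set p | U (radius p)].
Proof. by move=> oU; apply: open_comp => // p _; exact: radius_continuous. Qed.

Lemma open_base (U : set 'rV[R]_4) : open U -> open [set p | U (base p)].
Proof.
move=> oU; apply: open_comp => // p _.
exact/differentiable_continuous/differentiable_lsubmx.
Qed.

Lemma radius_derive p a : 0 < radius p ->
  is_derive p (e_ a) (@radius R) (q0 (qconj (fibre p) * dq a) / radius p).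
Proof.
move=> r0; have [f0 f1 f2 f3] := fibre_derive p a.
have rp : 0 < qnorm2 (fibre p) by rewrite -radius_gt0.
have dn : is_derive p (e_ a) (fun y => qnorm2 (fibre y)) (2 * q0 (qconj (fibre p) * dq a)).
  by apply: isd_eq (isdD (isdD (isdD (isdM f0 f0) (isdM f1 f1)) (isdM f2 f2)) (isdM f3 f3)) _ => /=; ring.
apply: isd_eq (@isd_comp _ _ (@Num.sqrt R) (fun y => qnorm2 (fibre y)) p _ _ _ (is_derive1_sqrt rp) dn) _.
by rewrite -/(radius p); field; rewrite gt_eqF.
Qed.

Lemma qeval_unit_fibre p : qeval (@unit_fibre R) p = qreal (radius p)^-1 * fibre p.
Proof. by apply: quat_ext => /=; ring. Qed.

Lemma unit_fibre_unit : unit_on [set p | 0 < radius p] (@unit_fibre R).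
Proof.
move=> p /= r0; rewrite qeval_unit_fibre qnorm2M -radius_sq /qnorm2 /=.
by field; rewrite gt_eqF.
Qed.

Lemma unit_fibre_smooth : qall (smooth_on [set p | 0 < radius p]) (@unit_fibre R).
Proof.
have oD := open_radius (@open_gt R 0).
have iC m : Ck e_ m [set p | 0 < radius p] (fun p => (radius p)^-1).
  by apply: CkV (radius_Ck m) => p /gt_eqF ->.
split; apply/(smooth_onP _ oD) => m; have [f0 f1 f2 f3] := @fibre_smooth R m [set p | 0 < radius p].
all: exact: CkM.
Qed.

Lemma unit_fibre_derive p a : 0 < radius p ->
  is_qderive p (e_ a) (qeval (@unit_fibre R))
    (qreal (radius p)^-1 * dq a - qreal (q0 (qconj (fibre p) * dq a) / radius p ^+ 3) * fibre p).
Proof.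
move=> r0; have [f0 f1 f2 f3] := fibre_derive p a.
have rn0 : radius p != 0 by rewrite gt_eqF.
have dv := isdV rn0 (radius_derive a r0).
split.
- by apply: isd_eq (isdM f0 dv) _ => /=; field.
- by apply: isd_eq (isdM f1 dv) _ => /=; field.
- by apply: isd_eq (isdM f2 dv) _ => /=; field.
- by apply: isd_eq (isdM f3 dv) _ => /=; field.
Qed.

(** The real part of conj(q) dq is r dr, and normalizing q removes exactly this part. *)
Lemma unit_fibre_logd p a : 0 < radius p ->
  qconj (qeval (@unit_fibre R) p) * qpartial (@unit_fibre R) a p =
  qreal (radius p ^+ 2)^-1 * qim (qconj (fibre p) * dq a).
Proof.
move=> r0; have rn0 : radius p != 0 by rewrite gt_eqF.
have -> := qd_unique (qpartial_derive a (open_radius (@open_gt R 0)) unit_fibre_smooth r0)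
  (unit_fibre_derive a r0).
rewrite qeval_unit_fibre.
have : qconj (fibre p) * fibre p = qreal (radius p ^+ 2) by rewrite qconj_mul radius_sq.
move: (radius p) (fibre p) (dq a) rn0 => r q d rn0 E.
rewrite qconjM mulrDr mulrN !mulrA.
have qrC c (x : quat R) : x * qreal c = qreal c * x by apply: quat_ext => /=; ring.
have -> : qconj (qreal r^-1) = qreal r^-1 :> quat R by apply: quat_ext; rewrite //= oppr0.
rewrite !qrC !mulrA -(mulrA _ (qconj q) q) E.
by apply: quat_ext => /=; field.
Qed.

End Radius.

(** * Curvature of the spin connection *)

Section SpinCurvature.
Context {R : realType} {Z : topologicalType} {O : orbifold R Z} {M : spin_metric O}.
Context (L : levi_civita M) (i : chart O).
Local Notation e_ := (@basis_vec R 4).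
Implicit Types (z : 'rV[R]_4) (a b c d j k : 'I_4).

Let oD : open (cdom i). Proof. exact: cdom_open. Qed.

Lemma sum_o4 (V : zmodType) (F : 'I_4 -> V) :
  \sum_(c < 4) F c = F (o4 0) + F (o4 1) + F (o4 2) + F (o4 3).
Proof.
have E (k : 'I_4) : k = o4 k by rewrite /o4 inord_val.
do 4 (rewrite big_ord_recr /=); rewrite big_ord0 add0r.
by rewrite (E (widen_ord _ _)) (E (widen_ord _ (widen_ord _ ord_max)))
  (E (widen_ord _ ord_max)) (E ord_max).
Qed.

Lemma o4_eq (m n : nat) : (m < 4)%N -> (n < 4)%N -> (o4 m == o4 n) = (m == n).
Proof. by move=> m4 n4; rewrite -val_eqE /= !inordK. Qed.

Definition lcc a b z j : R := lc L i a b z [set j]%SET.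
Definition dlcc a b z j k : R := 'D_(e_ j) (fun y => lcc a b y k) z.
Definition cof a z j : R := cofr M i a z [set j]%SET.
Definition cof2 a b z j k : R := cof a z j * cof b z k - cof a z k * cof b z j.

Definition sig z j : quat R :=
  Quat 0 (q1 (spin_connection L i) z [set j]%SET) (q2 (spin_connection L i) z [set j]%SET)
    (q3 (spin_connection L i) z [set j]%SET).

Lemma lcE a b z : cdom i z -> lc L i a b z = one_form (lcc a b z).
Proof. by move=> Dz; apply: degree1_one_form => S; exact: lc_degree. Qed.

Lemma cofrE a z : cdom i z -> cofr M i a z = one_form (cof a z).
Proof.
move=> Dz; apply: degree1_one_form => S S1; rewrite /cofr.
have [d0 d1 d2 d3] := @coframe_degree _ _ _ M i.
case: a => -[|[|[|[|//]]]] ? /=; [exact: d0|exact: d1|exact: d2|exact: d3].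
Qed.

Lemma sigE z j : sig z j = Quat 0 (- (1 / 2) * (lcc (o4 0) (o4 1) z j + lcc (o4 2) (o4 3) z j))
  (- (1 / 2) * (lcc (o4 0) (o4 2) z j + lcc (o4 3) (o4 1) z j))
  (- (1 / 2) * (lcc (o4 0) (o4 3) z j + lcc (o4 1) (o4 2) z j)).
Proof. by rewrite /sig /= !(ext_scaleE, ext_addE). Qed.

Lemma spin_connectionE z : cdom i z -> heval (spin_connection L i) z = qone_form (sig z).
Proof.
move=> Dz; rewrite /heval /qone_form /=; congr Quat.
- by rewrite /one_form big1 // => a _; rewrite scale0r.
- by apply: degree1_one_form => S S1; rewrite /= ext_scaleE ext_addE !lcE // !one_form_neq1 // addr0 mulr0.
- by apply: degree1_one_form => S S1; rewrite /= ext_scaleE ext_addE !lcE // !one_form_neq1 // addr0 mulr0.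
- by apply: degree1_one_form => S S1; rewrite /= ext_scaleE ext_addE !lcE // !one_form_neq1 // addr0 mulr0.
Qed.

Lemma lcc_smooth a b j : smooth_on (cdom i) (fun z => lcc a b z j).
Proof. exact: lc_smooth. Qed.

Lemma lcc_derive a b z j k : cdom i z ->
  is_derive z (e_ j) (fun y => lcc a b y k) (dlcc a b z j k).
Proof. by move=> Dz; exact: (smooth_derive j oD (@lcc_smooth a b k) Dz). Qed.

Lemma sig_smooth j : 
  [/\ forall m, Ck e_ m (cdom i) (fun z => q0 (sig z j)), forall m, Ck e_ m (cdom i) (fun z => q1 (sig z j)),
    forall m, Ck e_ m (cdom i) (fun z => q2 (sig z j)) & forall m, Ck e_ m (cdom i) (fun z => q3 (sig z j))].
Proof.
have C a b m : Ck e_ m (cdom i) (fun z => lcc a b z j) by exact: (smooth_onP _ oD).1 (@lcc_smooth a b j) m.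
split=> m; under eq_fun do rewrite sigE /=; first exact: Ck_cst.
all: by apply: CkM; [exact: Ck_cst|exact: CkD].
Qed.

Definition dsig z j k : quat R :=
  Quat 0 (- (1 / 2) * (dlcc (o4 0) (o4 1) z j k + dlcc (o4 2) (o4 3) z j k))
  (- (1 / 2) * (dlcc (o4 0) (o4 2) z j k + dlcc (o4 3) (o4 1) z j k))
  (- (1 / 2) * (dlcc (o4 0) (o4 3) z j k + dlcc (o4 1) (o4 2) z j k)).

Lemma sig_derive z j k : cdom i z -> is_qderive z (e_ j) (fun y => sig y k) (dsig z j k).
Proof.
move=> Dz.
have D a b c d : is_derive z (e_ j) (fun y => - (1 / 2) * (lcc a b y k + lcc c d y k))
    (- (1 / 2) * (dlcc a b z j k + dlcc c d z j k)).
  apply: isd_eq (isdM (isd_cst (- (1 / 2)) z (e_ j)) (isdD (lcc_derive a b j k Dz) (lcc_derive c d j k Dz))) _.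
  by ring.
by split; under eq_fun do rewrite sigE /=; [exact: isd_cst|exact: D|exact: D|exact: D].
Qed.

Lemma lcc_antisym a b z j : cdom i z -> lcc a b z j = - lcc b a z j.
Proof. by move=> Dz; rewrite /lcc lc_antisym // ext_oppE. Qed.

Definition lc_curv a b z j k : R := dlcc a b z j k - dlcc a b z k j +
  \sum_(c < 4) (lcc a c z j * lcc c b z k - lcc a c z k * lcc c b z j).

Lemma lc_curvE a b z j k : cdom i z ->
  lc_curv a b z j k = \sum_(c < 4) \sum_(d < 4) Rm L i z a b c d / 2 * cof2 c d z j k.
Proof.
(* Forms are evaluated on index sets, so coefficients can be read off for j < k only; antisymmetry
   supplies the rest. *)
move=> Dz; wlog jk : j k / (j < k)%N => [H|].
  have [jk|kj|/val_inj ->] := ltngtP j k; first exact: H.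
    have := H k j kj; rewrite /lc_curv /cof2 => E.
    transitivity (- (\sum_(c < 4) \sum_(d < 4) Rm L i z a b c d / 2 *
        (cof c z k * cof d z j - cof c z j * cof d z k))).
      rewrite -E opprD opprB -sumrN; congr (_ + _); apply: eq_bigr => c _; ring.
    by rewrite -sumrN; apply: eq_bigr => c _; rewrite -sumrN; apply: eq_bigr => d _; ring.
  rewrite /lc_curv /cof2 subrr add0r big1; last by move=> c _; rewrite subrr.
  by rewrite big1 // => c _; rewrite big1 // => d _; rewrite subrr mulr0.
have := congr1 (fun w : ext R 4 => w [set j; k]%SET) (Rm_curvature L a b Dz).
have -> : ext_d (lc L i a b) z = two_form (dlcc a b z).
  apply: (@ext_d_one_form _ _ (fun y => lcc a b y)) => [|j' k']; last exact: lcc_derive.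
  by apply: (open_near oD Dz) => y Dy; exact: lcE.
rewrite ext_addE.
rewrite two_form_set2 // !sum_ffunE => E; rewrite /lc_curv.
transitivity (\sum_(c < 4) (\sum_(d < 4) Rm L i z a b c d / 2 *: wedge (cofr M i c) (cofr M i d) z)
   [set j; k]%SET); last first.
  apply: eq_bigr => c _; rewrite sum_ffunE; apply: eq_bigr => d _.
  by rewrite ext_scaleE /wedge !cofrE // one_form_wedge two_form_set2 // /cof2; ring.
rewrite -E; congr (_ + _); apply: eq_bigr => c _.
by rewrite /wedge !lcE // one_form_wedge two_form_set2 //; ring.
Qed.

Lemma sum_kd a (F : 'I_4 -> R) : \sum_(c < 4) kd a c * F c = F a.
Proof.
rewrite (bigD1 a) //= /kd eqxx mul1r big1 ?addr0 // => c ca.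
by rewrite eq_sym (negPf ca) mul0r.
Qed.

(** For Ricci = (s/4) delta the Weyl decomposition leaves (s/4 - s/6) = s/12 times the
    constant-curvature tensor on a pair whose Weyl part cancels. The pairs used are the three
    self-dual combinations. *)
Lemma asd_pair_curv s a b a' b' z j k : einstein L s -> cdom i z ->
  (forall c d, Weyl L i z a b c d + Weyl L i z a' b' c d = 0) ->
  lc_curv a b z j k + lc_curv a' b' z j k = s / 12 * (cof2 a b z j k + cof2 a' b' z j k).
Proof.
move=> ES Dz W0; have [sc Rc] := ES i z Dz.
have E c d : Rm L i z a b c d + Rm L i z a' b' c d =
    s / 12 * (kd a c * kd b d - kd b c * kd a d + (kd a' c * kd b' d - kd b' c * kd a' d)).
  have := W0 c d; rewrite /Weyl !Rc sc => H.
  suff -> : Rm L i z a b c d + Rm L i z a' b' c d = Rm L i z a b c d + Rm L i z a' b' c d - 0 by rewrite -H; field.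
  by rewrite subr0.
rewrite !lc_curvE // -big_split /=.
transitivity (\sum_(c < 4) \sum_(d < 4) (s / 24 * ((kd a c * (kd b d * cof2 c d z j k)) -
    (kd b c * (kd a d * cof2 c d z j k)) + ((kd a' c * (kd b' d * cof2 c d z j k)) -
    (kd b' c * (kd a' d * cof2 c d z j k)))))).
  apply: eq_bigr => c _; rewrite -big_split /=; apply: eq_bigr => d _.
  by rewrite -mulrDl -mulrDl E; field.
have S x y : \sum_(c < 4) \sum_(d < 4) (kd x c * (kd y d * cof2 c d z j k)) = cof2 x y z j k.
  by under eq_bigr do rewrite -mulr_sumr sum_kd; rewrite sum_kd.
under eq_bigr do rewrite -mulr_sumr !(big_split, sumrN) /=.
rewrite -mulr_sumr !(big_split, sumrN) /= !S /cof2; by field.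
Qed.

Lemma scaled_eq (k a b c d : R) : b = c -> a = k * b -> k * c = d -> a = d.
Proof. by move=> -> ->. Qed.

(** The factor -s/24 is the -1/2 in [spin_connection] times s/12. Commutators of quaternion units
    reproduce the quadratic terms of the paired so(4) curvatures, so the three identities of
    [asd_pair_curv] are all that is needed. *)
Lemma spin_curvature s z j k : einstein L s -> anti_self_dual L -> cdom i z ->
  field_strength (sig z) (dsig z) j k = qreal (- (s / 24)) *
    Quat 0 (cof2 (o4 0) (o4 1) z j k + cof2 (o4 2) (o4 3) z j k)
           (cof2 (o4 0) (o4 2) z j k + cof2 (o4 3) (o4 1) z j k)
           (cof2 (o4 0) (o4 3) z j k + cof2 (o4 1) (o4 2) z j k).
Proof.
move=> ES AS Dz.
have P1 := asd_pair_curv j k ES Dz (fun c d => let: And3 H _ _ := AS i z Dz c d in H).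
have P2 := asd_pair_curv j k ES Dz (fun c d => let: And3 _ H _ := AS i z Dz c d in H).
have P3 := asd_pair_curv j k ES Dz (fun c d => let: And3 _ _ H := AS i z Dz c d in H).
have D (m : 'I_4) : lcc m m z j = 0 /\ lcc m m z k = 0.
  by have := lcc_antisym m m j Dz; have := lcc_antisym m m k Dz; lra.
move: P1 P2 P3; rewrite /lc_curv !sum_o4 /field_strength !sigE /dsig.
rewrite !(D _).1 !(D _).2.
have A m n l : lcc (o4 m) (o4 n) z l = - lcc (o4 n) (o4 m) z l by exact: lcc_antisym.
rewrite !(A 1 0)%N !(A 2 0)%N !(A 3 0)%N !(A 2 1)%N !(A 1 3)%N !(A 3 2)%N => P1 P2 P3.
apply: quat_ext => /=; first by ring.
- by apply: (@scaled_eq (- (1 / 2)) _ _ _ _ P1); field.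
- by apply: (@scaled_eq (- (1 / 2)) _ _ _ _ P2); field.
- by apply: (@scaled_eq (- (1 / 2)) _ _ _ _ P3); field.
Qed.

End SpinCurvature.

Lemma quat_eq {T : Type} (x y : quat T) :
  q0 x = q0 y -> q1 x = q1 y -> q2 x = q2 y -> q3 x = q3 y -> x = y.
Proof. by case: x => ????; case: y => ???? /= -> -> -> ->. Qed.

Section PointwiseForms.
Context {R : realType} (n : nat).
Implicit Types (A B : hform (R := R) n) (q u : qfun (R := R) n) (c d : 'I_n -> quat R) (p : 'rV[R]_n).

Lemma heval_comp A c p : heval A p = qone_form c ->
  [/\ q0 A p = one_form (fun a => q0 (c a)), q1 A p = one_form (fun a => q1 (c a)),
      q2 A p = one_form (fun a => q2 (c a)) & q3 A p = one_form (fun a => q3 (c a))].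
Proof.
by move=> E; split; [exact: (congr1 (@q0 _) E)|exact: (congr1 (@q1 _) E)
  |exact: (congr1 (@q2 _) E)|exact: (congr1 (@q3 _) E)].
Qed.

Let Wl (f : 'rV[R]_n -> R) (g : Defs.form R n) p : wedge (fun_form f) g p = f p *: g p.
Proof. exact: ext_wedge_constl. Qed.
Let Wnl (f : 'rV[R]_n -> R) (g : Defs.form R n) p : wedge (- fun_form f) g p = - (f p *: g p).
Proof. by rewrite /wedge -ext_wedge_constl -ext_wedgeNl. Qed.
Let Wr (f : 'rV[R]_n -> R) (g : Defs.form R n) p : wedge g (fun_form f) p = f p *: g p.
Proof. exact: ext_wedge_constr. Qed.
Let addE (f g : Defs.form R n) p : (f + g) p = f p + g p. Proof. by []. Qed.
Let oppE (f : Defs.form R n) p : (- f) p = - f p. Proof. by []. Qed.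

Lemma heval_add A B c d p : heval A p = qone_form c -> heval B p = qone_form d ->
  heval (qadd A B) p = qone_form (fun a => c a + d a).
Proof.
move=> /heval_comp[A0 A1 A2 A3] /heval_comp[B0 B1 B2 B3].
by apply: quat_eq; rewrite /= addE ?A0 ?A1 ?A2 ?A3 ?B0 ?B1 ?B2 ?B3 one_formD.
Qed.

Lemma heval_wedge_fun A c q p : heval A p = qone_form c ->
  heval (hwedge A (hfun q)) p = qone_form (fun a => c a * qeval q p).
Proof.
move=> /heval_comp[A0 A1 A2 A3].
by apply: quat_eq; rewrite /= !(addE, oppE, Wr) A0 A1 A2 A3 !(one_formZ, one_formN, one_formD);
  apply: eq_one_form => a /=; ring.
Qed.

Lemma heval_conj_wedge A c q p : heval A p = qone_form c ->
  heval (hwedge (qconj (hfun q)) A) p = qone_form (fun a => qconj (qeval q p) * c a).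
Proof.
move=> /heval_comp[A0 A1 A2 A3].
by apply: quat_eq; rewrite /= !(addE, oppE, Wl, Wnl) A0 A1 A2 A3 !(one_formZ, one_formN, one_formD);
  apply: eq_one_form => a /=; ring.
Qed.

Lemma heval_hd_fun q p : heval (hd (hfun q)) p = qone_form (fun a => qpartial q a p).
Proof. by apply: quat_eq; rewrite /= ext_d_fun. Qed.

Lemma heval_im A c p : heval A p = qone_form c -> heval (qim A) p = qone_form (fun a => qim (c a)).
Proof.
move=> /heval_comp[A0 A1 A2 A3]; apply: quat_eq => //=.
by rewrite /one_form big1 // => a _; rewrite scale0r.
Qed.

Lemma heval_scale A c (f : 'rV[R]_n -> R) p : heval A p = qone_form c ->
  heval (qmap (fscale f) A) p = qone_form (fun a => qreal (f p) * c a).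
Proof.
move=> /heval_comp[A0 A1 A2 A3].
by apply: quat_eq; rewrite /= /fscale ?A0 ?A1 ?A2 ?A3 one_formZ; apply: eq_one_form => a /=; ring.
Qed.

Lemma gauge_act_qone_form u A c p : heval A p = qone_form c ->
  heval (gauge_act u A) p =
  qone_form (fun a => qconj (qeval u p) * c a * qeval u p + qconj (qeval u p) * qpartial u a p).
Proof.
move=> AE; exact: heval_add (heval_wedge_fun u (heval_conj_wedge u AE))
  (heval_conj_wedge u (heval_hd_fun u p)).
Qed.

Lemma curv_qone_form A (c : 'rV[R]_n -> 'I_n -> quat R) (dc : 'I_n -> 'I_n -> quat R) x :
  (\forall y \near x, heval A y = qone_form (c y)) ->
  (forall a b, is_qderive x (@basis_vec R n a) (fun y => c y b) (dc a b)) ->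
  heval (curv A) x = qtwo_form (fun a b => dc a b + c x a * c x b).
Proof.
move=> AE d; have [E0 E1 E2 E3] := heval_comp (nbhs_singleton AE).
have D (F : quat R -> R) (f : Defs.form R n) :
    (forall y, heval A y = qone_form (c y) -> f y = one_form (fun a => F (c y a))) ->
    (forall a b, is_derive x (@basis_vec R n a) (fun y => F (c y b)) (F (dc a b))) ->
    ext_d f x = two_form (fun a b => F (dc a b)).
  move=> fE Fd; apply: (ext_d_one_form (c := fun y a => F (c y a))) => //.
  by apply: filterS AE => y; exact: fE.
have D0 := D (@q0 R) (q0 A) (fun y Ay => let: And4 h _ _ _ := heval_comp Ay in h)
  (fun a b => let: And4 h _ _ _ := d a b in h).
have D1 := D (@q1 R) (q1 A) (fun y Ay => let: And4 _ h _ _ := heval_comp Ay in h)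
  (fun a b => let: And4 _ h _ _ := d a b in h).
have D2 := D (@q2 R) (q2 A) (fun y Ay => let: And4 _ _ h _ := heval_comp Ay in h)
  (fun a b => let: And4 _ _ h _ := d a b in h).
have D3 := D (@q3 R) (q3 A) (fun y Ay => let: And4 _ _ _ h := heval_comp Ay in h)
  (fun a b => let: And4 _ _ _ h := d a b in h).
have W (f g : Defs.form R n) cf cg : f x = one_form cf -> g x = one_form cg ->
    wedge f g x = two_form (fun a b => cf a * cg b).
  by rewrite /wedge => -> ->; exact: one_form_wedge.
by apply: quat_eq; rewrite /= !(addE, oppE) ?D0 ?D1 ?D2 ?D3
  !(W _ _ _ _ E0 E0, W _ _ _ _ E1 E1, W _ _ _ _ E2 E2, W _ _ _ _ E3 E3, W _ _ _ _ E0 E1,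
  W _ _ _ _ E1 E0, W _ _ _ _ E2 E3, W _ _ _ _ E3 E2, W _ _ _ _ E0 E2, W _ _ _ _ E1 E3,
  W _ _ _ _ E2 E0, W _ _ _ _ E3 E1, W _ _ _ _ E0 E3, W _ _ _ _ E1 E2, W _ _ _ _ E2 E1,
  W _ _ _ _ E3 E0) !(two_formN, two_formD).
Qed.

End PointwiseForms.

Section Eta.
Context {R : realType} {Z : topologicalType} {O : orbifold R Z} {M : spin_metric O}.
Context (L : levi_civita M) (i : chart O).
Local Notation e_ := (@basis_vec R (4 + 4)).
Implicit Types (p : 'rV[R]_(4 + 4)) (a b : 'I_(4 + 4)).

Definition sig8 p a : quat R := lift4 0 (sig L i (base p)) a.
Definition dsig8 p a b : quat R :=
  lift4 0 (fun k => lift4 0 (fun j => dsig L i (base p) j k) a) b.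
Definition cof8 (m : nat) p a : R := lift4 0 (cof (M := M) i (o4 m) (base p)) a.
Definition cof8_2 (m n : nat) p a b : R := cof8 m p a * cof8 n p b - cof8 m p b * cof8 n p a.

Lemma lift4_comp {T T' : Type} (F : T -> T') zero (c : 'I_4 -> T) a :
  F (lift4 zero c a) = lift4 (F zero) (fun j => F (c j)) a.
Proof. by rewrite /lift4; case: fintype.split. Qed.

Lemma sig8_derive p a b : cdom i (base p) ->
  is_qderive p (e_ a) (fun y => sig8 y b) (dsig8 p a b).
Proof.
move=> Dp; rewrite /sig8 /dsig8 /lift4.
case: (fintype.split b) => [k|k]; last exact: qd_cst.
by apply: (@base_derive _ (fun z => sig L i z k) p (fun j => dsig L i (base p) j k)) => j; exact: sig_derive.
Qed.

Lemma sig8_imaginary p a : q0 (sig8 p a) = 0.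
Proof. by rewrite /sig8 (lift4_comp (@q0 R)) /lift4; case: fintype.split. Qed.

Definition sig_curv s p a b : quat R := qreal (- (s / 24)) *
  Quat 0 (cof8_2 0 1 p a b + cof8_2 2 3 p a b) (cof8_2 0 2 p a b + cof8_2 3 1 p a b)
    (cof8_2 0 3 p a b + cof8_2 1 2 p a b).

Lemma sig8_field_strength s p a b : einstein L s -> anti_self_dual L -> cdom i (base p) ->
  field_strength (sig8 p) (dsig8 p) a b = sig_curv s p a b.
Proof.
move=> ES AS Dp; rewrite /field_strength /sig_curv /cof8_2 /cof8 /sig8 /dsig8 /lift4.
case: (fintype.split a) => j; case: (fintype.split b) => k; first exact: spin_curvature.
all: by apply: quat_ext => /=; ring.
Qed.

Definition etac p a : quat R :=
  qreal (radius p ^+ 2)^-1 * qim (qconj (fibre p) * (dq a + sig8 p a * fibre p)).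

Lemma etaE p : heval (Defs.eta L i) p = qone_form (etac p).
Proof.
have pb (f : Defs.form R 4) (g : 'I_4 -> R) : (forall j, f (base p) [set j]%SET = g j) ->
    pullback1 base f p = one_form (lift4 0 g).
  by move=> fg; rewrite pullback1_base; congr (one_form (lift4 0 _)); apply/funext.
have P0 : pullback1 base (q0 (spin_connection L i)) p = one_form (fun a => q0 (sig8 p a)).
  rewrite (@pb _ (fun j => q0 (sig L i (base p) j))).
  by apply: eq_one_form => a; rewrite /sig8 (lift4_comp (@q0 R)).
 by move=> j; rewrite /= ffunE.
have P1 : pullback1 base (q1 (spin_connection L i)) p = one_form (fun a => q1 (sig8 p a)).
  by rewrite (@pb _ (fun j => q1 (sig L i (base p) j))) => [|j //]; apply: eq_one_form => a; rewrite /sig8 (lift4_comp (@q1 R)).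
have P2 : pullback1 base (q2 (spin_connection L i)) p = one_form (fun a => q2 (sig8 p a)).
  by rewrite (@pb _ (fun j => q2 (sig L i (base p) j))) => [|j //]; apply: eq_one_form => a; rewrite /sig8 (lift4_comp (@q2 R)).
have P3 : pullback1 base (q3 (spin_connection L i)) p = one_form (fun a => q3 (sig8 p a)).
  by rewrite (@pb _ (fun j => q3 (sig L i (base p) j))) => [|j //]; apply: eq_one_form => a; rewrite /sig8 (lift4_comp (@q3 R)).
have B : heval (qmap (pullback1 base) (spin_connection L i)) p = qone_form (sig8 p).
  by apply: quat_eq; [exact: P0|exact: P1|exact: P2|exact: P3].
apply: (heval_scale (fun y => (radius y ^+ 2)^-1)); apply: heval_im; apply: (heval_conj_wedge (@fibre_coord R)).
have H := heval_add (heval_hd_fun (@fibre_coord R) p) (heval_wedge_fun (@fibre_coord R) B).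
apply: etrans H _; apply: eq_qone_form => a.
by rewrite qpartial_fibre.
Qed.

(** The term conj(q) S q is already imaginary, so [qim] acts only on conj(q) dq, where
    [unit_fibre_logd] applies. *)
Lemma eta_gauged p a : 0 < radius p -> etac p a = gauged (@unit_fibre R) sig8 p a.
Proof.
move=> r0; have rn0 : radius p != 0 by rewrite gt_eqF.
rewrite /gauged unit_fibre_logd // qeval_unit_fibre /etac.
have := sig8_imaginary p a.
move: (radius p) (fibre p) (dq a) (sig8 p a) rn0 => r q d S rn0 S0.
by apply: quat_ext => /=; rewrite S0; field.
Qed.

Lemma eta_field_strength s p : einstein L s -> anti_self_dual L -> cdom i (base p) -> 0 < radius p ->
  exists2 deta : 'I_(4 + 4) -> 'I_(4 + 4) -> quat R,
    forall a b, is_qderive p (e_ a) (fun y => etac y b) (deta a b) &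
    forall a b, field_strength (etac p) deta a b =
      qconj (qeval (@unit_fibre R) p) * sig_curv s p a b * qeval (@unit_fibre R) p.
Proof.
move=> ES AS Dp r0; have oD := open_radius (@open_gt R 0).
have [dg dgE dgK] := gauge_field_strength oD (@unit_fibre_smooth R) (@unit_fibre_unit R) r0
  (fun a b => sig8_derive a b Dp).
exists dg => a b.
  by apply: qd_near (dgE a b); apply: (open_near oD r0) => y y0; rewrite -eta_gauged.
rewrite -(sig8_field_strength a b ES AS Dp) -dgK /field_strength.
by rewrite !(eta_gauged _ r0).
Qed.

Definition drc p a : R := q0 (qconj (fibre p) * dq a) / radius p.

Lemma drE p : 0 < radius p -> dr p = one_form (drc p).
Proof.
move=> r0; rewrite /dr ext_d_fun; apply: eq_one_form => a.
exact: (derive_val (is_derive := radius_derive a r0)).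
Qed.

Lemma pullback_coframeE p : cdom i (base p) ->
  [/\ pullback1 base (q0 (coframe M i)) p = one_form (cof8 0 p),
      pullback1 base (q1 (coframe M i)) p = one_form (cof8 1 p),
      pullback1 base (q2 (coframe M i)) p = one_form (cof8 2 p) &
      pullback1 base (q3 (coframe M i)) p = one_form (cof8 3 p)].
Proof.
move=> Dp; split; rewrite pullback1_base /cof8 /cof; congr (one_form (lift4 0 _)); apply/funext => j.
all: by rewrite /cofr /o4 inordK.
Qed.

(* The columns of the matrix are the images of the imaginary units under conjugation by u. *)
Definition rot (u : quat R) (k j : nat) : R :=
  let v := qconj u * Quat 0 (j == 0)%N%:R (j == 1)%N%:R (j == 2)%N%:R * u in
  nth 0 [:: q1 v; q2 v; q3 v] k.

Lemma rot_orth u k l : qnorm2 u = 1 -> (k < 3)%N -> (l < 3)%N ->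
  rot u k 0 * rot u l 0 + rot u k 1 * rot u l 1 + rot u k 2 * rot u l 2 = (k == l)%:R.
Proof.
(* Inserting |u|^4 = 1 makes both sides homogeneous of degree four, hence a polynomial identity. *)
move=> u1; have -> : (k == l)%:R = (k == l)%:R * qnorm2 u ^+ 2 by rewrite u1 expr1n mulr1.
case: k => [|[|[|//]]] _; case: l => [|[|[|//]]] _; rewrite /rot /qnorm2 /=; ring.
Qed.

Lemma conj_imaginary u x y z : qconj u * Quat 0 x y z * u = Quat 0
  (rot u 0 0 * x + rot u 0 1 * y + rot u 0 2 * z)
  (rot u 1 0 * x + rot u 1 1 * y + rot u 1 2 * z)
  (rot u 2 0 * x + rot u 2 1 * y + rot u 2 2 * z).
Proof. by apply: quat_ext; rewrite /rot /=; ring. Qed.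

End Eta.

Arguments etac : simpl never.
Arguments rot : simpl never.

Lemma one_form_sum {R : realType} n (I : finType) (k : I -> R) (g : I -> 'I_n -> R) :
  \sum_a k a *: one_form (g a) = one_form (fun j => \sum_a k a * g a j).
Proof.
rewrite /one_form; under eq_bigr do rewrite scaler_sumr.
rewrite exchange_big; apply: eq_bigr => j _; rewrite scaler_suml.
by apply: eq_bigr => a _; rewrite scalerA.
Qed.

Section CoframeIndependence.
Context {R : realType} {Z : topologicalType} {O : orbifold R Z} {M : spin_metric O}.
Context (i : chart O).

Lemma coframe_wedge4 (f : 'I_4 -> ext R 4) : coframe_wedge f [set: 'I_4]%SET =
  f (o4 0) \w (f (o4 1) \w (f (o4 2) \w f (o4 3))).
Proof.
rewrite (_ : [set: 'I_4]%SET = finset.finset (fun i : 'I_4 => predT (val i))).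
  by rewrite coframe_wedge_nword filter_predT /nword /= !big_cons big_nil ext_wedge1r.
by apply/finset.setP => k; rewrite !finset.inE.
Qed.

(** A zero determinant would give a linear relation among the covectors at z and hence a vanishing
    volume, contrary to [coframe_indep]. *)
Lemma cof_inverse z : cdom i z -> exists Q : 'I_4 -> 'I_4 -> R,
  (forall j k, \sum_a Q j a * cof (M := M) i a z k = (j == k)%:R) /\
  forall a b, \sum_j cof (M := M) i a z j * Q j b = (a == b)%:R.
Proof.
move=> Dz; pose E : 'M[R]_4 := \matrix_(a, j) cof (M := M) i a z j.
have [/det0P[v v0 vE]|Eu] := boolP (\det E == 0); last first.
  have Eu' : E \in unitmx by rewrite unitmxE unitfE.
  exists (invmx E); split=> j k.
    have := congr1 (fun A : 'M[R]_4 => A j k) (mulVmx Eu'); rewrite !mxE => <-.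
    by apply: eq_bigr => a _; rewrite mxE.
  have := congr1 (fun A : 'M[R]_4 => A j k) (mulmxV Eu'); rewrite !mxE => <-.
  by apply: eq_bigr => a _; rewrite mxE.
have /rV0Pn[k vk] := v0; have := @coframe_indep _ _ _ M i z Dz.
suff -> : wedge (wedge (q0 (coframe M i)) (q1 (coframe M i)))
    (wedge (q2 (coframe M i)) (q3 (coframe M i))) z = 0 by rewrite ffunE eqxx.
have : coframe_wedge (fun a => cofr M i a z) [set: 'I_4]%SET = 0.
  apply: coframe_wedge_dependent vk _ => [a|].
    by rewrite cofrE //; exact: ext_degree_one_form.
  under eq_bigr do rewrite cofrE //.
  rewrite one_form_sum /one_form big1 // => j _; apply/eqP; rewrite scaler_eq0; apply/orP; left.
  have := congr1 (fun A : 'rV[R]_4 => A 0 j) vE; rewrite !mxE => E0; rewrite -[X in _ == X]E0.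
  by apply/eqP; apply: eq_bigr => a _; rewrite mxE.
rewrite coframe_wedge4 /cofr /o4 !inordK //= => E0.
by rewrite /wedge -ext_wedgeA.
Qed.

End CoframeIndependence.

Section Spanned.
Context {R : realType} (n : nat) (f : 'I_n -> ext R n).

Definition spanned (x : ext R n) := exists c : 'I_n -> R, x = \sum_j c j *: f j.

Lemma spannedD x y : spanned x -> spanned y -> spanned (x + y).
Proof.
move=> [c ->] [d ->]; exists (fun j => c j + d j).
by rewrite -big_split; apply: eq_bigr => j _; rewrite scalerDl.
Qed.

Lemma spannedZ k x : spanned x -> spanned (k *: x).
Proof.
move=> [c ->]; exists (fun j => k * c j).
by rewrite scaler_sumr; apply: eq_bigr => j _; rewrite scalerA.
Qed.

Lemma spanned_sum (I : Type) (r : seq I) (F : I -> ext R n) :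
  (forall j, spanned (F j)) -> spanned (\sum_(j <- r) F j).
Proof.
move=> FS; elim/big_rec: _ => [|j x _ xS]; last exact: spannedD.
by exists (fun=> 0); rewrite big1 // => j _; rewrite scale0r.
Qed.

Lemma spanned_id j : spanned (f j).
Proof.
exists (fun k => (k == j)%:R); rewrite (bigD1 j) //= eqxx scale1r big1 ?addr0 // => k /negPf ->.
by rewrite scale0r.
Qed.

Lemma spanned_scaled k x : k != 0 -> spanned (k *: x) -> spanned x.
Proof. by move=> k0 /(spannedZ k^-1); rewrite scalerA mulVf // scale1r. Qed.

Lemma spanned_top : (forall j, ext_degree 1 (f j)) -> (forall j, spanned (dx R j)) ->
  coframe_wedge f [set: 'I_n]%SET [set: 'I_n]%SET != 0.
Proof.
move=> f1 /choice[Q QE]; exact: coframe_wedge_spanning f1 QE.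
Qed.

End Spanned.

(** * The instanton equation *)

Section InstantonEquation.
Context {R : realType} {Z : topologicalType} {O : orbifold R Z} {M : spin_metric O}.
Context (L : levi_civita M) (i : chart O) (s : R) (t nu : R -> R).
Hypothesis s_gt0 : 0 < s.
Local Notation e_ := (@basis_vec R (4 + 4)).
Variable p : 'rV[R]_(4 + 4).
Hypothesis Dp : cdom i (base p).
Hypothesis r_gt0 : 0 < radius p.
Hypothesis t_neq0 : t (radius p) != 0.
Hypothesis nu_neq0 : nu (radius p) != 0.
Local Notation r := (radius p).
Local Notation q := (fibre p).
Local Notation u := (qeval (@unit_fibre R) p).
Local Notation ec := (etac L i p).
Local Notation f := (fun a => coframe_Theta L s t nu i a p).
Local Notation k_ := (Num.sqrt (s / 48) * nu r).

Let r_neq0 : r != 0. Proof. by rewrite gt_eqF. Qed.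
Let k_neq0 : k_ != 0. Proof. by rewrite mulf_neq0 // gt_eqF // sqrtr_gt0 divr_gt0. Qed.

Lemma coframe_ThetaE (m : nat) : (m < 8)%N -> f (inord m) = nth 0 [::
  one_form (drc p); t r *: one_form (fun a => q1 (ec a));
  t r *: one_form (fun a => q2 (ec a)); t r *: one_form (fun a => q3 (ec a));
  k_ *: one_form (cof8 (M := M) i 0 p); k_ *: one_form (cof8 (M := M) i 1 p);
  k_ *: one_form (cof8 (M := M) i 2 p); k_ *: one_form (cof8 (M := M) i 3 p)] m.
Proof.
have [e0 e1 e2 e3] := heval_comp (etaE L i p); have [c0 c1 c2 c3] := pullback_coframeE (M := M) Dp.
move=> m8; rewrite /coframe_Theta inordK //.
rewrite -(drE r_gt0) -e1 -e2 -e3 -c0 -c1 -c2 -c3.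
case: m m8 => [|[|[|[|[|[|[|[|//]]]]]]]] _; exact: erefl.
Qed.

Lemma coframe_Theta_degree j : ext_degree 1 (f j).
Proof.
have -> : j = inord j by rewrite inord_val.
rewrite (coframe_ThetaE (ltn_ord j)).
case: j => -[|[|[|[|[|[|[|[|//]]]]]]]] ? /=; try apply: ext_degreeZ; exact: ext_degree_one_form.
Qed.

(** The quaternion conj(q)(dq + S q) has real part r dr and imaginary part r^2 eta; multiplying by
    q/r^2 solves for dq. It shows that the coframe of [Theta] spans the fibre differentials. *)
Lemma dq_coframe a : dq a = q * (qreal (drc p a / r) + ec a) - sig8 L i p a * q.
Proof.
have S0 := sig8_imaginary L i p a.
have N2 : r ^+ 2 = q0 q ^+ 2 + q1 q ^+ 2 + q2 q ^+ 2 + q3 q ^+ 2 by exact: radius_sq.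
have N0 : q0 q ^+ 2 + q1 q ^+ 2 + q2 q ^+ 2 + q3 q ^+ 2 != 0 by rewrite -N2 expf_neq0.
rewrite /drc /etac -mulrA -invfM -expr2 N2.
move: (dq a) (sig8 L i p a) q S0 N0 => d S x S0 N0.
by apply: quat_ext => /=; rewrite S0; field.
Qed.

Lemma coframe_Theta_top :
  coframe_wedge f [set: 'I_(4 + 4)]%SET [set: 'I_(4 + 4)]%SET != 0.
Proof.
apply: spanned_top; first exact: coframe_Theta_degree.
have fS (m : nat) : (m < 8)%N -> spanned f (f (inord m)) by move=> _; exact: spanned_id.
have S0 : spanned f (one_form (drc p)) by have := fS 0%N isT; rewrite coframe_ThetaE.
have S1 : spanned f (one_form (fun a => q1 (ec a))).
  by have := fS 1%N isT; rewrite coframe_ThetaE //; exact: spanned_scaled.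
have S2 : spanned f (one_form (fun a => q2 (ec a))).
  by have := fS 2%N isT; rewrite coframe_ThetaE //; exact: spanned_scaled.
have S3 : spanned f (one_form (fun a => q3 (ec a))).
  by have := fS 3%N isT; rewrite coframe_ThetaE //; exact: spanned_scaled.
have SC (m : nat) : (m < 4)%N -> spanned f (one_form (cof8 (M := M) i m p)).
  move=> m4; have := fS (4 + m)%N; rewrite coframe_ThetaE // => /(_ m4).
  by case: m m4 => [|[|[|[|//]]]] _ /=; exact: spanned_scaled.
have [Q [QE _]] := cof_inverse (M := M) Dp.
have SL j : spanned f (one_form (lift4 0 (fun k => (j == k)%:R))).
  suff -> : one_form (lift4 0 (fun k => (j == k)%:R)) = \sum_a Q j a *: one_form (cof8 (M := M) i a p).
    by apply: spanned_sum => a; apply: spannedZ; exact: SC.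
  rewrite one_form_sum; apply: eq_one_form => b; rewrite /cof8 /lift4.
  case: (fintype.split b) => k; last by rewrite big1 // => a _; rewrite mulr0.
  by rewrite -QE; apply: eq_bigr => a _; rewrite /o4 inord_val.
have SS (c : 'I_4 -> R) : spanned f (one_form (lift4 0 c)).
  suff -> : one_form (lift4 0 c) = \sum_j c j *: one_form (lift4 0 (fun k => (j == k)%:R)).
    by apply: spanned_sum => j; exact: spannedZ.
  rewrite one_form_sum; apply: eq_one_form => b; rewrite /lift4.
  case: (fintype.split b) => k; last by rewrite big1 // => a _; rewrite mulr0.
  by rewrite (bigD1 k) //= eqxx mulr1 big1 ?addr0 // => j /negPf ->; rewrite mulr0.
have Ssig (c : 'I_(4 + 4) -> R) : (forall a, c a = lift4 0 (fun j => c (lshift 4 j)) a) ->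
    spanned f (one_form c).
  by move=> cE; rewrite (eq_one_form cE); exact: SS.
have sigl (F : quat R -> R) : F 0 = 0 -> spanned f (one_form (fun a => F (sig8 L i p a))).
  move=> F0; apply: Ssig => a; rewrite /sig8 /lift4.
  case: (splitP a) => [j aj|//]; congr (F _).
  case: splitP => [k /= kj|k /= kj]; first by congr (sig L i _ _); apply: val_inj.
  by have := ltn_ord j; rewrite kj ltnNge leq_addr.
(* [F] stands for one of the four coordinates of the fibre; the summand S q is a form from the base,
   already spanned. *)
have SQ (F : quat R -> R) : F 0 = 0 -> (forall x y, F (x + y) = F x + F y) ->
    (forall c x, F (qreal c * x) = c * F x) -> spanned f (one_form (fun a => F (dq a))).
  move=> F0 FD FZ.
  suff -> : one_form (fun a => F (dq a)) = (F q / r) *: one_form (drc p) +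
      F (q * Quat 0 1 0 0) *: one_form (fun a => q1 (ec a)) +
      F (q * Quat 0 0 1 0) *: one_form (fun a => q2 (ec a)) +
      F (q * Quat 0 0 0 1) *: one_form (fun a => q3 (ec a)) +
      (-1) *: one_form (fun a => F (sig8 L i p a * q)).
    apply: spannedD; last by apply: spannedZ; apply: (sigl (fun x => F (x * q))); rewrite mul0r.
    by apply: spannedD; last (by exact: spannedZ); apply: spannedD; last (by exact: spannedZ);
      apply: spannedD; exact: spannedZ.
  rewrite !(one_formZ, one_formD); apply: eq_one_form => a.
  rewrite dq_coframe (_ : _ - _ = qreal (drc p a / r) * q + qreal (q1 (ec a)) * (q * Quat 0 1 0 0) +
    qreal (q2 (ec a)) * (q * Quat 0 0 1 0) + qreal (q3 (ec a)) * (q * Quat 0 0 0 1) +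
    qreal (-1) * (sig8 L i p a * q)); last first.
    have : q0 (ec a) = 0 by rewrite /etac /=; ring.
    by move: (ec a) (sig8 L i p a) (drc p a / r) => [h0 h1 h2 h3] S x /= ->; apply: quat_ext => /=; ring.
  by rewrite !FD !FZ; ring.
move=> a; rewrite (_ : dx R a = one_form (fun b => (b == a)%:R)); last first.
  rewrite /one_form (bigD1 a) //= eqxx scale1r big1 ?addr0 // => b /negPf ->.
  by rewrite scale0r.
case: (splitP a) => [j aj|k ak].
  apply: Ssig => b; rewrite /lift4; case: (splitP b) => [m bm|m bm].
    by congr (_%:R); rewrite -!val_eqE /= bm.
  by rewrite -val_eqE /= bm aj; case: eqP => // E; have := ltn_ord j; rewrite -E ltnNge leq_addr.
have E : a = rshift 4 k by apply: val_inj; rewrite /= ak.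
rewrite E; case: k {ak E} => -[|[|[|[|//]]]] lt4.
- have -> : Ordinal lt4 = o4 0 by apply: val_inj; rewrite /= inordK.
  by apply: (SQ (@q0 R)) => // *; rewrite /=; ring.
- have -> : Ordinal lt4 = o4 1 by apply: val_inj; rewrite /= inordK.
  by apply: (SQ (@q1 R)) => // *; rewrite /=; ring.
- have -> : Ordinal lt4 = o4 2 by apply: val_inj; rewrite /= inordK.
  by apply: (SQ (@q2 R)) => // *; rewrite /=; ring.
- have -> : Ordinal lt4 = o4 3 by apply: val_inj; rewrite /= inordK.
  by apply: (SQ (@q3 R)) => // *; rewrite /=; ring.
Qed.

End InstantonEquation.

Lemma heval_quat {R : realType} n (A : hform (R := R) n) p a b c d : heval A p = Quat a b c d ->
  [/\ q0 A p = a, q1 A p = b, q2 A p = c & q3 A p = d].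
Proof.
by move=> E; split; [exact: (congr1 (@q0 _) E)|exact: (congr1 (@q1 _) E)
  |exact: (congr1 (@q2 _) E)|exact: (congr1 (@q3 _) E)].
Qed.

Lemma conj_imaginary_scaled {R : realType} (k : R) u x y z :
  qreal k * (qconj u * Quat 0 x y z * u) = Quat 0
  (k * (rot u 0 0 * x + rot u 0 1 * y + rot u 0 2 * z))
  (k * (rot u 1 0 * x + rot u 1 1 * y + rot u 1 2 * z))
  (k * (rot u 2 0 * x + rot u 2 1 * y + rot u 2 2 * z)).
Proof. by rewrite conj_imaginary; apply: quat_ext => /=; ring. Qed.

Lemma qtwo_form_inj {R : realType} n (c : 'I_n -> 'I_n -> quat R) x : qtwo_form c = x ->
  [/\ two_form (fun a b => q0 (c a b)) = q0 x, two_form (fun a b => q1 (c a b)) = q1 x,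
      two_form (fun a b => q2 (c a b)) = q2 x & two_form (fun a b => q3 (c a b)) = q3 x].
Proof. by move=> <-. Qed.

Section InstantonAtPoint.
Context {R : realType} {Z : topologicalType} {O : orbifold R Z} {M : spin_metric O}.
Context (L : levi_civita M) (i : chart O) (s : R) (t nu : R -> R).
Hypothesis s_gt0 : 0 < s.
Hypothesis ES : einstein L s.
Hypothesis AS : anti_self_dual L.
Local Notation e_ := (@basis_vec R (4 + 4)).
Variable p : 'rV[R]_(4 + 4).
Hypothesis Dp : cdom i (base p).
Hypothesis r_gt0 : 0 < radius p.
Local Notation r := (radius p).
Local Notation u := (qeval (@unit_fibre R) p).
Local Notation ec := (etac L i).
Local Notation f := (fun a => coframe_Theta L s t nu i a p).
Local Notation k_ := (Num.sqrt (s / 48) * nu r).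

Definition tsd_coef (j : nat) (a b : 'I_(4 + 4)) : R :=
  let c (m : nat) a := cof8 (M := M) i m p a in
  nth 0 [:: c 0 a * c 1 b + c 2 a * c 3 b; c 0 a * c 2 b + c 3 a * c 1 b;
            c 0 a * c 3 b + c 1 a * c 2 b] j.

Definition tsd (j : nat) : ext R (4 + 4) := two_form (tsd_coef j).

(** By [omegaE] these are the omega_k at [p], in the unscaled coframe of the base. *)
Definition rtsd (k : nat) : ext R (4 + 4) :=
  rot u k 0 *: tsd 0 + rot u k 1 *: tsd 1 + rot u k 2 *: tsd 2.

Lemma rtsdE k : rtsd k = two_form (fun a b =>
  rot u k 0 * tsd_coef 0 a b + rot u k 1 * tsd_coef 1 a b + rot u k 2 * tsd_coef 2 a b).
Proof. by rewrite /rtsd /tsd !two_formZ !two_formD. Qed.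

Lemma qtwo_formE (c : 'I_(4 + 4) -> 'I_(4 + 4) -> quat R) : qtwo_form c = Quat
  (two_form (fun a b => q0 (c a b))) (two_form (fun a b => q1 (c a b)))
  (two_form (fun a b => q2 (c a b))) (two_form (fun a b => q3 (c a b))).
Proof. by []. Qed.

Lemma two_form0 : two_form (fun _ _ : 'I_(4 + 4) => 0 : R) = 0.
Proof. by rewrite /two_form big1 // => a _; rewrite big1 // => b _; rewrite scale0r. Qed.

Let near_eta : \forall y \near p, heval (Defs.eta L i) y = qone_form (ec y).
Proof. by apply: (@open_near _ setT _ p openT I) => y _; exact: etaE. Qed.

Lemma curv_eta : heval (curv (Defs.eta L i)) p =
  Quat 0 (- (s / 24) *: rtsd 0) (- (s / 24) *: rtsd 1) (- (s / 24) *: rtsd 2).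
Proof.
have [deta dE dK] := eta_field_strength ES AS Dp r_gt0.
apply: etrans (curv_qone_form near_eta dE) _.
rewrite (@eq_qtwo_form _ _ _ (fun a b => qreal (- (s / 24)) * (qconj u *
    Quat 0 (tsd_coef 0 a b) (tsd_coef 1 a b) (tsd_coef 2 a b) * u))); last first.
  move=> a b; have := dK a b; rewrite /field_strength => E.
  transitivity (deta a b - deta b a + (ec p a * ec p b - ec p b * ec p a)).
    by rewrite opprD addrACA.
  rewrite E /sig_curv /tsd_coef /cof8_2.
  by apply: quat_ext => /=; ring.
rewrite qtwo_formE !rtsdE !two_formZ -two_form0.
by congr Quat; apply: eq_two_form => a b; rewrite !conj_imaginary_scaled.
Qed.

Lemma omegaE : heval (omega L s i) p = Quat 0 (rtsd 0) (rtsd 1) (rtsd 2).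
Proof.
have E : - (24 / s) * - (s / 24) = 1 by field; rewrite gt_eqF.
have := curv_eta; rewrite /heval /omega => H.
apply: quat_eq.
- by have /= := congr1 (@q0 _) H; rewrite /fscale => ->; rewrite scaler0.
- by have /= := congr1 (@q1 _) H; rewrite /fscale => ->; rewrite scalerA E scale1r.
- by have /= := congr1 (@q2 _) H; rewrite /fscale => ->; rewrite scalerA E scale1r.
- by have /= := congr1 (@q3 _) H; rewrite /fscale => ->; rewrite scalerA E scale1r.
Qed.

Lemma qd_real (V : normedModType R) (x v : V) (g : V -> R) (dg : R) :
  is_derive x v g dg -> is_qderive x v (fun y => qreal (g y)) (qreal dg).
Proof. by move=> gd; split=> //; exact: isd_cst. Qed.

Lemma etac_imaginary a : q0 (ec p a) = 0.
Proof. by rewrite /etac /=; ring. Qed.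

Lemma radial_connectionE (x : R -> R) y : heval (radial_connection L x i) y =
  qone_form (fun a => qreal (x (radius y)) * ec y a).
Proof. exact: (heval_scale (fun y => x (radius y)) (etaE L i y)). Qed.

Let near_radial x : \forall y \near p, heval (radial_connection L x i) y =
  qone_form (fun a => qreal (x (radius y)) * ec y a).
Proof. by apply: (@open_near _ setT _ p openT I) => y _; exact: radial_connectionE. Qed.

Lemma radial_derive (x : R -> R) (dx : R) (deta : 'I_(4 + 4) -> 'I_(4 + 4) -> quat R) :
  is_derive r (1 : R) x dx -> (forall a b, is_qderive p (e_ a) (fun y => ec y b) (deta a b)) ->
  forall a b, is_qderive p (e_ a) (fun y => qreal (x (radius y)) * ec y b)
    (qreal (dx * drc p a) * ec p b + qreal (x r) * deta a b).
Proof.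
move=> xd dE a b; have rd : is_derive p (e_ a) (@Defs.radius R) (drc p a) by exact: radius_derive.
exact: qdM (qd_real (isd_comp xd rd)) (dE a b).
Qed.

Local Notation dr_ := (one_form (drc p)).
Local Notation eta1 := (one_form (fun a => q1 (ec p a))).
Local Notation eta2 := (one_form (fun a => q2 (ec p a))).
Local Notation eta3 := (one_form (fun a => q3 (ec p a))).

(** The curvature of x eta is x' dr^eta + x F_eta + (x^2 - x) eta^eta, and the i-th component of
    eta^eta is 2 eta_j^eta_k. *)
Lemma curv_radial (x : R -> R) (dx : R) : is_derive r (1 : R) x dx ->
  heval (curv (radial_connection L x i)) p = Quat 0
    (dx *: (dr_ \w eta1) + x r *: (- (s / 24) *: rtsd 0) + (2 * (x r ^+ 2 - x r)) *: (eta2 \w eta3))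
    (dx *: (dr_ \w eta2) + x r *: (- (s / 24) *: rtsd 1) + (2 * (x r ^+ 2 - x r)) *: (eta3 \w eta1))
    (dx *: (dr_ \w eta3) + x r *: (- (s / 24) *: rtsd 2) + (2 * (x r ^+ 2 - x r)) *: (eta1 \w eta2)).
Proof.
move=> xd; have [deta dE _] := eta_field_strength ES AS Dp r_gt0.
have := etrans (esym (curv_qone_form near_eta dE)) curv_eta.
move=> /qtwo_form_inj[K0 K1 K2 K3].
apply: etrans (curv_qone_form (near_radial x) (radial_derive xd dE)) _.
have E a b : qreal (dx * drc p a) * ec p b + qreal (x r) * deta a b +
    qreal (x r) * ec p a * (qreal (x r) * ec p b) =
    qreal (dx * drc p a) * ec p b + qreal (x r) * (deta a b + ec p a * ec p b) +
    qreal (x r ^+ 2 - x r) * (ec p a * ec p b).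
  by move: (ec p a) (ec p b) => y z; apply: quat_ext => /=; ring.
rewrite qtwo_formE; congr Quat.
- have : x r *: two_form (fun a b => q0 (deta a b + ec p a * ec p b)) = 0 by rewrite K0 scaler0.
  rewrite two_formZ => <-; apply: eq_two_form => a b; rewrite !E.
  move: (etac_imaginary a) (etac_imaginary b).
  by move: (deta a b) (deta b a) (ec p a) (ec p b) => d d' y z; rewrite /= => -> ->; ring.
- rewrite -[- (s / 24) *: rtsd 0]K1 !one_form_wedge !two_formZ !two_formD.
  apply: eq_two_form => a b; rewrite !E; move: (etac_imaginary a) (etac_imaginary b).
  by move: (deta a b) (deta b a) (ec p a) (ec p b) => d d' y z; rewrite /= => -> ->; ring.
- rewrite -[- (s / 24) *: rtsd 1]K2 !one_form_wedge !two_formZ !two_formD.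
  apply: eq_two_form => a b; rewrite !E; move: (etac_imaginary a) (etac_imaginary b).
  by move: (deta a b) (deta b a) (ec p a) (ec p b) => d d' y z; rewrite /= => -> ->; ring.
- rewrite -[- (s / 24) *: rtsd 2]K3 !one_form_wedge !two_formZ !two_formD.
  apply: eq_two_form => a b; rewrite !E; move: (etac_imaginary a) (etac_imaginary b).
  by move: (deta a b) (deta b a) (ec p a) (ec p b) => d d' y z; rewrite /= => -> ->; ring.
Qed.

Hypothesis t_neq0 : t r != 0.
Hypothesis nu_neq0 : nu r != 0.

Let k_sq : k_ ^+ 2 = s / 48 * nu r ^+ 2.
Proof. by rewrite exprMn sqr_sqrtr // divr_ge0 // ltW. Qed.

Lemma sd_tsd j : (j < 3)%N -> sd f j = (s / 48 * nu r ^+ 2) *: tsd j.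
Proof.
have W m n : (m < 4)%N -> (n < 4)%N -> f (inord (4 + m)) \w f (inord (4 + n)) =
    (s / 48 * nu r ^+ 2) *: two_form (fun a b => cof8 (M := M) i m p a * cof8 (M := M) i n p b).
  move=> m4 n4; rewrite !(coframe_ThetaE L s t nu Dp r_gt0) //.
  have E l : (l < 4)%N -> nth 0 [:: one_form (drc p); t r *: eta1; t r *: eta2; t r *: eta3;
      k_ *: one_form (cof8 (M := M) i 0 p); k_ *: one_form (cof8 (M := M) i 1 p);
      k_ *: one_form (cof8 (M := M) i 2 p); k_ *: one_form (cof8 (M := M) i 3 p)] (4 + l) =
      k_ *: one_form (cof8 (M := M) i l p).
    by case: l => [|[|[|[|//]]]].
  by rewrite !E // ext_wedgeZl ext_wedgeZr scalerA -expr2 k_sq one_form_wedge.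
case: j => [|[|[|//]]] _; rewrite /sd.
- by rewrite (W 0 1)%N // (W 2 3)%N // -scalerDr two_formD.
- by rewrite (W 0 2)%N // (W 3 1)%N // -scalerDr two_formD.
- by rewrite (W 0 3)%N // (W 1 2)%N // -scalerDr two_formD.
Qed.

Lemma rsd_rtsd k : rsd f (rot u) k = (s / 48 * nu r ^+ 2) *: rtsd k.
Proof.
rewrite /rsd !sd_tsd // /rtsd !scalerDr !scalerA.
by congr (_ *: _ + _ *: _ + _ *: _); rewrite mulrC.
Qed.

(** Moves the powers of t, nu and s/48 from the coefficients into the covectors, so that [Theta_alg]
    applies verbatim. *)
Lemma Theta_rescale (e0 e1 e2 e3 w0 w1 w2 : ext R (4 + 4)) (T N S : R) :
  e0 \w (T ^+ 3 *: (e1 \w (e2 \w e3)) - (T * N ^+ 2 * S) *: (e1 \w w0 + e2 \w w1 + e3 \w w2)) +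
    ((N ^+ 4 / 6 * S ^+ 2) *: (w0 \w w0 + w1 \w w1 + w2 \w w2) -
     (N ^+ 2 * T ^+ 2 * S) *: (e1 \w e2 \w w2 + e2 \w e3 \w w0 + e3 \w e1 \w w1)) =
  e0 \w ((T *: e1) \w ((T *: e2) \w (T *: e3)) - ((T *: e1) \w ((S * N ^+ 2) *: w0) +
     (T *: e2) \w ((S * N ^+ 2) *: w1) + (T *: e3) \w ((S * N ^+ 2) *: w2))) +
    (6^-1 *: (((S * N ^+ 2) *: w0) \w ((S * N ^+ 2) *: w0) + ((S * N ^+ 2) *: w1) \w ((S * N ^+ 2) *: w1) +
       ((S * N ^+ 2) *: w2) \w ((S * N ^+ 2) *: w2)) -
     ((T *: e1) \w (T *: e2) \w ((S * N ^+ 2) *: w2) + (T *: e2) \w (T *: e3) \w ((S * N ^+ 2) *: w0) +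
      (T *: e3) \w (T *: e1) \w ((S * N ^+ 2) *: w1))).
Proof.
rewrite !(ext_wedgeDr, ext_wedgeNr, ext_wedgeZl, ext_wedgeZr).
by apply/ffunP => X; rewrite !(ext_addE, ext_scaleE, ext_oppE); field.
Qed.

Lemma ThetaE : Theta L s t nu i p = Theta_alg f (rsd f (rot u)).
Proof.
have [e0 e1 e2 e3] := heval_comp (etaE L i p).
have W0 : q1 (omega L s i) p = rtsd 0 := congr1 (@q1 _) omegaE.
have W1 : q2 (omega L s i) p = rtsd 1 := congr1 (@q2 _) omegaE.
have W2 : q3 (omega L s i) p = rtsd 2 := congr1 (@q3 _) omegaE.
rewrite /Theta_alg /phi_alg /psi_alg !rsd_rtsd.
rewrite !(coframe_ThetaE L s t nu Dp r_gt0) //=.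
have -> : Theta L s t nu i p = dr_ \w
    (t r ^+ 3 *: (eta1 \w (eta2 \w eta3)) - (t r * nu r ^+ 2 * (s / 48)) *:
      (eta1 \w rtsd 0 + eta2 \w rtsd 1 + eta3 \w rtsd 2)) +
    ((nu r ^+ 4 / 6 * (s / 48) ^+ 2) *: (rtsd 0 \w rtsd 0 + rtsd 1 \w rtsd 1 + rtsd 2 \w rtsd 2) -
     (nu r ^+ 2 * t r ^+ 2 * (s / 48)) *: (eta1 \w eta2 \w rtsd 2 + eta2 \w eta3 \w rtsd 0 + eta3 \w eta1 \w rtsd 1)).
  by rewrite -W0 -W1 -W2 -e1 -e2 -e3 -(drE r_gt0).
exact: Theta_rescale.
Qed.

Lemma instanton_at_point (x : R -> R) (dx : R) : is_derive r (1 : R) x dx ->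
  qall (fun F : Defs.form R (4 + 4) =>
    is_hodge_dual f (wedge (Theta L s t nu i) (Theta L s t nu i) p) (F p)
      (- wedge F (Theta L s t nu i) p)) (curv (radial_connection L x i)) <->
  dx = 2 * x r * (1 - 2 * t r ^+ 2 / nu r ^+ 2 - x r) / t r.
Proof.
move=> xd; have [F0 F1 F2 F3] := heval_quat (curv_radial xd).
have f1 := coframe_Theta_degree L s t nu Dp r_gt0.
have ftop := coframe_Theta_top L s_gt0 Dp r_gt0 t_neq0 nu_neq0.
have u1 : qnorm2 u = 1 by exact: unit_fibre_unit.
have HI k P b c := @hodge_instanton _ f (rot u) f1 (fun k l => rot_orth u1) ftop k P b c.
have s0 : s != 0 by rewrite gt_eqF.
(* This is p + c = 2b for p = x'/t, c = 2(x^2 - x)/t^2 and b = -2x/nu^2, the last being -(s/24) x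
   divided by the scale (s/48) nu^2 of the self-dual forms. *)
have key : dx / t r + 2 * (x r ^+ 2 - x r) / t r ^+ 2 = 2 * (- 2 * x r / nu r ^+ 2) <->
    dx = 2 * x r * (1 - 2 * t r ^+ 2 / nu r ^+ 2 - x r) / t r.
  split=> [H|->]; last by field; rewrite t_neq0 nu_neq0.
  have -> : dx = t r * (dx / t r + 2 * (x r ^+ 2 - x r) / t r ^+ 2) - 2 * (x r ^+ 2 - x r) / t r by field.
  by rewrite H; field; rewrite t_neq0 nu_neq0.
have fE := coframe_ThetaE L s t nu Dp r_gt0.
have Fform (e e' e'' : ext R (4 + 4)) k : dx *: (dr_ \w e) + x r *: (- (s / 24) *: rtsd k) +
    (2 * (x r ^+ 2 - x r)) *: (e' \w e'') =
    (dx / t r) *: (dr_ \w (t r *: e)) + (- 2 * x r / nu r ^+ 2) *: rsd f (rot u) k +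
    (2 * (x r ^+ 2 - x r) / t r ^+ 2) *: ((t r *: e') \w (t r *: e'')).
  rewrite rsd_rtsd !(ext_wedgeZl, ext_wedgeZr, scalerA).
  by congr (_ *: _ + _ *: _ + _ *: _); field; rewrite ?t_neq0 ?nu_neq0.
have H1 : is_hodge_dual f (wedge (Theta L s t nu i) (Theta L s t nu i) p)
    (q1 (curv (radial_connection L x i)) p) (- wedge (q1 (curv (radial_connection L x i))) (Theta L s t nu i) p) <->
    dx = 2 * x r * (1 - 2 * t r ^+ 2 / nu r ^+ 2 - x r) / t r.
  rewrite /wedge F1 ThetaE /= Fform -key.
  by have := HI 0%N (dx / t r) (- 2 * x r / nu r ^+ 2) (2 * (x r ^+ 2 - x r) / t r ^+ 2) isT;
    rewrite /cyc3 /= !fE.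
split=> [[_ h1 _ _]|xE]; first exact/H1.
split; last 2 first.
- rewrite /wedge F2 ThetaE /= Fform; move/key: xE.
  by have := HI 1%N (dx / t r) (- 2 * x r / nu r ^+ 2) (2 * (x r ^+ 2 - x r) / t r ^+ 2) isT;
    rewrite /cyc3 /= !fE // => ->.
- rewrite /wedge F3 ThetaE /= Fform; move/key: xE.
  by have := HI 2%N (dx / t r) (- 2 * x r / nu r ^+ 2) (2 * (x r ^+ 2 - x r) / t r ^+ 2) isT;
    rewrite /cyc3 /= !fE // => ->.
- rewrite /wedge F0 /= ext_wedge0l oppr0.
  by exists (fun=> 0); split; rewrite big1 // => S _; rewrite ?mulr0 scale0r.
- exact/H1.
Qed.

End InstantonAtPoint.

Section QuatCk.
Context {R : realType} {V : normedModType R} {I : Type} (dir : I -> V).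
Implicit Types (D : set V) (c d : V -> quat R).

Definition qCk m D c : Prop :=
  [/\ Ck dir m D (fun x => q0 (c x)), Ck dir m D (fun x => q1 (c x)),
      Ck dir m D (fun x => q2 (c x)) & Ck dir m D (fun x => q3 (c x))].

Lemma qCk_cst m D (k : quat R) : qCk m D (fun=> k).
Proof. by split; exact: Ck_cst. Qed.

Lemma qCk_real m D (g : V -> R) : Ck dir m D g -> qCk m D (fun x => qreal (g x)).
Proof. by move=> gC; split=> //; exact: Ck_cst. Qed.

Lemma qCk_conj m D c : qCk m D c -> qCk m D (fun x => qconj (c x)).
Proof. by move=> [????]; split=> //; exact: CkN. Qed.

Lemma qCk_im m D c : qCk m D c -> qCk m D (fun x => qim (c x)).
Proof. by move=> [????]; split=> //; exact: Ck_cst. Qed.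

Lemma qCkD m D c d : qCk m D c -> qCk m D d -> qCk m D (fun x => c x + d x).
Proof. by move=> [????] [????]; split; exact: CkD. Qed.

Lemma qCkM m D c d : qCk m D c -> qCk m D d -> qCk m D (fun x => c x * d x).
Proof.
move=> [c0 c1 c2 c3] [d0 d1 d2 d3]; split.
- by apply: CkB (CkM c3 d3); apply: CkB (CkM c2 d2); apply: CkB (CkM c1 d1); exact: CkM.
- by apply: CkB (CkM c3 d2); apply: CkD (CkM c2 d3); apply: CkD (CkM c1 d0); exact: CkM.
- by apply: CkD (CkM c3 d1); apply: CkD (CkM c2 d0); apply: CkB (CkM c1 d3); exact: CkM.
- by apply: CkD (CkM c3 d0); apply: CkB (CkM c2 d1); apply: CkD (CkM c1 d2); exact: CkM.
Qed.

Lemma qCk_sub m D D' c : D' `<=` D -> qCk m D c -> qCk m D' c.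
Proof. by move=> sD [????]; split; exact: Ck_sub sD _. Qed.

Lemma qCk_smooth_hform n (E : set 'rV[R]_n) (A : hform (R := R) n) (c : 'rV[R]_n -> 'I_n -> quat R) :
  open E -> (forall x, E x -> heval A x = qone_form (c x)) ->
  (forall a m, [/\ Ck (@basis_vec R n) m E (fun x => q0 (c x a)), Ck (@basis_vec R n) m E (fun x => q1 (c x a)),
      Ck (@basis_vec R n) m E (fun x => q2 (c x a)) & Ck (@basis_vec R n) m E (fun x => q3 (c x a))]) ->
  qall (smooth_form_on E) A.
Proof.
move=> oE AE cS; split.
- apply: (smooth_one_form (c := fun x a => q0 (c x a)) oE) => [x /AE/heval_comp[]//|a m].
  by have [] := cS a m.
- apply: (smooth_one_form (c := fun x a => q1 (c x a)) oE) => [x /AE/heval_comp[]//|a m].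
  by have [] := cS a m.
- apply: (smooth_one_form (c := fun x a => q2 (c x a)) oE) => [x /AE/heval_comp[]//|a m].
  by have [] := cS a m.
- apply: (smooth_one_form (c := fun x a => q3 (c x a)) oE) => [x /AE/heval_comp[]//|a m].
  by have [] := cS a m.
Qed.

Lemma smooth_hform_qCk n (E : set 'rV[R]_n) (A : hform (R := R) n) (c : 'rV[R]_n -> 'I_n -> quat R) :
  open E -> (forall x, E x -> heval A x = qone_form (c x)) -> qall (smooth_form_on E) A ->
  forall a m, [/\ Ck (@basis_vec R n) m E (fun x => q0 (c x a)), Ck (@basis_vec R n) m E (fun x => q1 (c x a)),
      Ck (@basis_vec R n) m E (fun x => q2 (c x a)) & Ck (@basis_vec R n) m E (fun x => q3 (c x a))].
Proof.
move=> oE AE [s0 s1 s2 s3] a m; split.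
- by apply: (smooth_form_coef (c := fun x a => q0 (c x a)) oE _ s0) => x /AE/heval_comp[].
- by apply: (smooth_form_coef (c := fun x a => q1 (c x a)) oE _ s1) => x /AE/heval_comp[].
- by apply: (smooth_form_coef (c := fun x a => q2 (c x a)) oE _ s2) => x /AE/heval_comp[].
- by apply: (smooth_form_coef (c := fun x a => q3 (c x a)) oE _ s3) => x /AE/heval_comp[].
Qed.

End QuatCk.

Section InstantonOde.
Context {R : realType} {Z : topologicalType} {O : orbifold R Z} {M : spin_metric O}.
Context (L : levi_civita M) (s : R) (nu0 : R) (t nu : R -> R).
Hypothesis s_gt0 : 0 < s.
Hypothesis ES : einstein L s.
Hypothesis AS : anti_self_dual L.
Hypothesis nu0_gt0 : 0 < nu0.
Hypothesis P : profile_solution nu0 t nu.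
Local Notation e_ := (@basis_vec R (4 + 4)).

Lemma sig8_qCk i a m : qCk e_ m [set p | cdom i (base p)] (fun p => sig8 L i p a).
Proof.
rewrite /sig8 /lift4; case: (fintype.split a) => j; last exact: qCk_cst.
have [c0 c1 c2 c3] := sig_smooth L i j.
split.
- exact: (base_Ck (c0 m)).
- exact: (base_Ck (c1 m)).
- exact: (base_Ck (c2 m)).
- exact: (base_Ck (c3 m)).
Qed.

Lemma fibre_qCk m D : qCk e_ m D (@fibre R).
Proof. exact: fibre_smooth. Qed.

Lemma open_annulus J i : open J -> open (annulus (O := O) J i).
Proof.
by move=> oJ; apply: openI; [apply: open_base; exact: cdom_open|exact: open_radius].
Qed.

Lemma etac_qCk J i a m : (forall r, J r -> 0 < r) ->
  qCk e_ m (annulus J i) (fun p => etac L i p a).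
Proof.
move=> J0; apply: qCkM.
  apply: qCk_real; apply: CkV => [p [_ /J0 r0]|]; first by rewrite expf_neq0 // gt_eqF.
  by apply: CkX; apply: Ck_sub (radius_Ck m) => p [_ /J0].
apply: qCk_im; apply: qCkM; first by apply: qCk_conj; exact: fibre_qCk.
apply: qCkD; first exact: qCk_cst.
by apply: qCkM; [apply: qCk_sub (@sig8_qCk i a m) => p []|exact: fibre_qCk].
Qed.

Lemma q1_real_mul (k : R) (x : quat R) : q1 (qreal k * x) = k * q1 x.
Proof. by rewrite /=; ring. Qed.

(** The point at distance r along the unit 1 of the fibre over z. There the unit fibre coordinate is
    1, so the coefficients of eta are explicit. *)
Definition fibre_point (z : 'rV[R]_4) (r : R) : 'rV[R]_(4 + 4) :=
  row_mx z (row_of_quat (Quat r 0 0 0)).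

Lemma base_fibre_point z r : base (fibre_point z r) = z.
Proof. by rewrite /base row_mxKl. Qed.

Lemma fibre_fibre_point z r : fibre (fibre_point z r) = Quat r 0 0 0.
Proof.
rewrite /fibre row_mxKr /quat_of_row /row_of_quat !mxE /o4 !inordK //.
Qed.

Lemma radius_fibre_point z r : 0 <= r -> radius (fibre_point z r) = r.
Proof.
move=> r0; rewrite /Defs.radius fibre_fibre_point /qnorm2 /=.
by rewrite expr0n /= !addr0 sqrtr_sqr ger0_norm.
Qed.

Lemma fibre_point_line z r h : h *: e_ (rshift 4 (o4 0)) + fibre_point z r = fibre_point z (h + r).
Proof.
apply/rowP => a; rewrite !mxE eqxx /=; case: splitP => j aj; rewrite ?mxE.
  rewrite -val_eqE /= aj /o4 inordK // addn0.
  by case: eqP => [E|_]; [have := ltn_ord j; rewrite E|rewrite mulr0 add0r].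
rewrite -val_eqE /= aj eqn_add2l /o4 inordK //.
by case: j aj => -[|[|[|[|//]]]] ? _ /=; rewrite ?mulr1 ?mulr0 ?add0r.
Qed.

Lemma dq_rshift a k : (k < 4)%N -> a = rshift 4 (o4 k) -> dq (R := R) a =
  Quat (k == 0)%N%:R (k == 1)%N%:R (k == 2)%N%:R (k == 3)%N%:R.
Proof.
move=> k4 ->; rewrite /dq; have E m : (m < 4)%N -> (rshift 4 (o4 k) == rshift 4 (o4 m)) = (k == m).
  by move=> m4; rewrite (inj_eq (@rshift_inj _ _)) o4_eq.
by rewrite !E.
Qed.

Lemma sig8_rshift i p k : sig8 L i p (rshift 4 k) = 0.
Proof.
rewrite /sig8 /lift4; case: splitP => [j /= kj|//].
by have := ltn_ord j; rewrite -kj ltnNge leq_addr.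
Qed.

Lemma etac_fibre_point i z r : 0 < r ->
  q1 (etac L i (fibre_point z r) (rshift 4 (o4 1))) = r^-1.
Proof.
move=> r0; rewrite /etac sig8_rshift (@dq_rshift _ 1%N) // fibre_fibre_point radius_fibre_point ?ltW //=.
by field; rewrite gt_eqF.
Qed.

Hypothesis Z_nonempty : [set: Z] !=set0.

Lemma instanton_ode (J : set R) (x : R -> R) : open J -> (forall r : R, J r -> 0 < r) ->
  spin7_instanton L s t nu J (radial_connection L x) -> ode t (nu2 nu) J x.
Proof.
move=> oJ J0 inst r Jr; have r0 := J0 _ Jr.
have [y _] := Z_nonempty; have [i [z [Dz _]]] := cproj_cover O y.
have [AS' AH] := inst i; have pJ h : J h -> annulus J i (fibre_point z h).
  by move=> Jh; split; rewrite ?base_fibre_point // radius_fibre_point // ltW // J0.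
have oA : open (annulus J i) by exact: open_annulus.
have [_ C1 _ _] := smooth_hform_qCk oA
  (fun p _ => radial_connectionE L i x p) AS' (rshift 4 (o4 1)) 1.
have [_ /(_ (rshift 4 (o4 0)))[g gE _]] := C1.
have := gE _ (pJ _ Jr) => /isd_line D.
(* Differentiability of x is not assumed. Along the ray one coefficient of the smooth connection
   form is x(h)/h, so x is h times a differentiable function. *)
have xd : exists dx, is_derive r (1 : R) x dx.
  have D' : is_derive r (1 : R) (fun h : R => x h / h) (g (fibre_point z r)).
    apply/isd_line; apply: isd_near D.
    have /nbhs0P : nbhs r J by exact: open_nbhs_nbhs.
    apply: filterS => h Jh.
    rewrite fibre_point_line -[_ *: 1]/(h * 1) mulr1 [h + r]addrC.
    by rewrite q1_real_mul etac_fibre_point ?J0 // radius_fibre_point // ltW // J0.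
  exists (g (fibre_point z r) * r + x r / r * 1).
  apply: isd_near (isdM D' (is_derive_id r (1 : R))).
  apply: (open_near oJ Jr) => h /J0 h0 /=; by field; rewrite gt_eqF.
have [dx xD] := xd.
have rp := radius_fibre_point z (ltW r0); have := AH _ (pJ _ Jr).
have tn : t (radius (fibre_point z r)) != 0 by rewrite rp gt_eqF // (t_gt0 nu0_gt0 P).
have nn : nu (radius (fibre_point z r)) != 0 by rewrite rp gt_eqF // (profile_pos P) // ltW.
have xD' : is_derive (radius (fibre_point z r)) (1 : R) x dx by rewrite rp.
have Dz' : cdom i (base (fibre_point z r)) by rewrite base_fibre_point.
have r0' : 0 < radius (fibre_point z r) by rewrite rp.
by move/(instanton_at_point s_gt0 ES AS Dz' r0' tn nn xD'); rewrite rp => <-.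
Qed.

Lemma ode_instanton (J : set R) (x : R -> R) : open J -> (forall r : R, J r -> 0 < r) -> ode t (nu2 nu) J x ->
  spin7_instanton L s t nu J (radial_connection L x).
Proof.
move=> oJ J0 xd i; split.
  have oA : open (annulus J i) by exact: open_annulus.
  apply: (qCk_smooth_hform oA (fun p _ => radial_connectionE L i x p)) => a m.
  apply: (qCkM (c := fun p => qreal (x (radius p)))); last exact: etac_qCk.
  apply: qCk_real; apply: (@Ck_comp _ _ _ e_ m _ J) => [p []//||].
    exact: (ode_smooth nu0_gt0 P m J0 xd).
  by apply: Ck_sub (radius_Ck m) => p [_ /J0].
move=> p [Dp Jp]; have r0 := J0 _ Jp.
have tn : t (radius p) != 0 by rewrite gt_eqF // (t_gt0 nu0_gt0 P).
have nn : nu (radius p) != 0 by rewrite gt_eqF // (profile_pos P) // ltW.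
exact/(instanton_at_point s_gt0 ES AS Dp r0 tn nn (xd _ Jp)).
Qed.

End InstantonOde.

(** * Extension across the zero section *)

Section Extension.
Context {R : realType} {Z : topologicalType} {O : orbifold R Z} {M : spin_metric O}.
Context (L : levi_civita M).
Local Notation e_ := (@basis_vec R (4 + 4)).
Variables (J U : set R).
Hypothesis oJ : open J.
Hypothesis oU : open U.
Hypothesis JU : forall r : R, J r <-> 0 < r /\ U r.
Hypothesis U0 : U 0.

Local Notation one_fun := (@frame_change R TrivialBundle).

Let J0 (r : R) : J r -> 0 < r. Proof. by move=> /JU[]. Qed.

(** The tube is the preimage of [U] under the radius. [U] is the whole line for global solutions and
    the half-line below eps for local ones. *)
Lemma open_tube (i : chart O) : open (tube J i).
Proof.
rewrite (_ : tube J i = [set p | cdom i (base p)] `&` [set p | U (radius p)]).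
  by apply: openI; [apply: open_base; exact: cdom_open|exact: open_radius].
apply/seteqP; split=> p [Dp].
- by move=> [r0|/JU[_ ?]]; split; rewrite //= r0.
- move=> Up; split=> //; have := radius_ge0 p; rewrite le_eqVlt => /predU1P[<-|r0]; first by left.
  by right; exact/JU.
Qed.

(** The radius is not smooth on the zero section but its square is a polynomial. Near Z the function
    is [Y] of that polynomial; elsewhere it is a composite with the smooth radius. *)
Lemma radius_even_Ck (y Y : R -> R) (d : R) i m : 0 < d ->
  (forall n, Ck1 n [set w : R | `|w| < d ^+ 2] Y) -> (forall r, 0 <= r < d -> y r = Y (r ^+ 2)) ->
  (forall n, Ck1 n J y) -> Ck e_ m (tube (O := O) J i) (fun p => y (radius p)).
Proof.
move=> d0 YS yY yS.
have oT : open (tube (O := O) J i) by exact: open_tube.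
suff S : smooth_on ([set p | radius p < d] `|` [set p | J (radius p)]) (fun p => y (radius p)).
  apply: ((smooth_onP _ oT).1 _ m); apply: smooth_on_sub S => p [_].
  by move=> [r0|Jp]; [left; rewrite /= r0|right].
apply: smooth_onU.
- have o : open [set p : 'rV[R]_(4 + 4) | radius p < d] by exact: (open_radius (@open_lt R d)).
  apply/(smooth_onP _ o) => n.
  apply: (@Ck_eq _ _ _ e_ n _ (fun p => Y (qnorm2 (fibre p)))) => // [p rd|].
    by rewrite -radius_sq -yY // radius_ge0.
  apply: (@Ck_comp _ _ _ e_ n _ [set w : R | `|w| < d ^+ 2]) (YS n) (qnorm2_fibre_Ck n _) => p /= rd.
  rewrite -radius_sq ger0_norm ?sqr_ge0 // ltr_sqr // nnegrE ?radius_ge0 // ltW //.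
- apply/(smooth_onP _ (open_radius oJ)) => n.
  apply: (@Ck_comp _ _ _ e_ n _ J) => //.
  by apply: Ck_sub (radius_Ck n) => p /= /J0.
Qed.

Lemma radius0_fibre (p : 'rV[R]_(4 + 4)) : radius p = 0 -> fibre p = 0.
Proof.
move=> r0; have : qnorm2 (fibre p) = 0 by rewrite -radius_sq r0 expr0n.
case: (fibre p) => a b c d; rewrite /qnorm2 /= => E.
have := sqr_ge0 a; have := sqr_ge0 b; have := sqr_ge0 c; have := sqr_ge0 d => d0 c0 b0 a0.
by apply: quat_ext => /=; apply/eqP; rewrite -sqrf_eq0; apply/eqP; lra.
Qed.

Lemma qeval_one p : qeval one_fun p = 1. Proof. by []. Qed.

Lemma qpartial_one a p : qpartial one_fun a p = 0.
Proof. by apply: quat_ext => /=; exact: derive_cst. Qed.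

Lemma gauge_act_one (A : hform (R := R) (4 + 4)) c p : heval A p = qone_form c ->
  heval (gauge_act one_fun A) p = qone_form c.
Proof.
move=> /gauge_act_qone_form ->; apply: eq_qone_form => a.
rewrite qeval_one qpartial_one mulr0 addr0 mulr1.
by rewrite (_ : qconj 1 = 1) ?mul1r //; apply: quat_ext; rewrite //= oppr0.
Qed.

Lemma gauge_transformation_one : gauge_transformation M J (fun=> one_fun).
Proof.
split=> // i.
- have oA : open (annulus (O := O) J i) by exact: open_annulus.
  by split; apply/(smooth_onP _ oA) => m; exact: Ck_cst.
- by move=> p _; rewrite qeval_one /qnorm2 /= expr0n /= !addr0 expr1n.
Qed.

Definition hcoef n (A : hform (R := R) n) (p : 'rV[R]_n) (a : 'I_n) : quat R :=
  Quat (q0 A p [set a]%SET) (q1 A p [set a]%SET) (q2 A p [set a]%SET) (q3 A p [set a]%SET).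

Lemma hcoefE n (A : hform (R := R) n) c p a : heval A p = qone_form c -> hcoef A p a = c a.
Proof.
by move=> /heval_comp[A0 A1 A2 A3]; rewrite /hcoef A0 A1 A2 A3 !one_form_set1; case: (c a).
Qed.

Lemma zero_section_restr_coef (B : hform (R := R) (4 + 4)) z :
  heval (zero_section_restr B) z = qone_form (fun j => hcoef B (row_mx z 0) (lshift 4 j)).
Proof.
have D (j : 'I_(4 + 4)) (b : 'I_4) :
    'D_(@basis_vec R 4 b) (fun y : 'rV[R]_4 => row_mx y (0 : 'rV[R]_4) 0 j) z = (j == lshift 4 b)%:R.
  case: (splitP j) => k jk.
    have -> : j = lshift 4 k by apply: val_inj.
    under eq_fun do rewrite row_mxEl.
    by rewrite (derive_val (is_derive := is_derive_coord _ _ _)) (inj_eq (@lshift_inj _ _)) eq_sym.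
  have -> : j = rshift 4 k by apply: val_inj.
  under eq_fun do rewrite row_mxEr mxE; rewrite derive_cst.
  by case: eqP => // /(congr1 val) /= E; have := ltn_ord b; rewrite -E ltnNge leq_addr.
have E (w : Defs.form R (4 + 4)) :
    pullback1 (fun y : 'rV[R]_4 => row_mx y (0 : 'rV[R]_4)) w z =
    one_form (fun j => w (row_mx z 0) [set lshift 4 j]%SET).
  rewrite pullback1E; apply: eq_one_form => b.
  under eq_bigr do rewrite D.
  by rewrite (bigD1 (lshift 4 b)) //= eqxx mulr1 big1 ?addr0 // => j /negPf ->; rewrite mulr0.
by apply: quat_eq; exact: E.
Qed.

Lemma zero_section_restrE (B : hform (R := R) (4 + 4)) c z :
  heval B (row_mx z 0) = qone_form c ->
  heval (zero_section_restr B) z = qone_form (fun j => c (lshift 4 j)).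
Proof.
by move=> BE; rewrite zero_section_restr_coef; apply: eq_qone_form => j; exact: hcoefE.
Qed.

(** The factor r^2 of x cancels the r^-2 in eta, and the remaining expression is smooth on the whole
    tube. *)
Lemma radial_tube (y x : R -> R) i p a : (forall r : R, x r = r ^+ 2 * y r) ->
  qreal (x (radius p)) * etac L i p a =
  qreal (y (radius p)) * qim (qconj (fibre p) * (dq a + sig8 L i p a * fibre p)).
Proof.
move=> xy; rewrite /etac xy; have [r0|r0] := eqVneq (radius p) 0.
  rewrite (radius0_fibre r0); move: (sig8 L i p a) (dq a) (y _) (_ ^-1) => S d k l.
  by rewrite !mulr0 addr0; apply: quat_ext => /=; ring.
move: (qim _) => v; apply: quat_ext => /=; field => //.
Qed.

(** The connection form extends as it stands, with the trivial gauge transformation, and vanishes on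
    Z because q does. *)
Lemma flat_extension (y Y x : R -> R) (d : R) : 0 < d ->
  (forall n, Ck1 n [set w : R | `|w| < d ^+ 2] Y) -> (forall r, 0 <= r < d -> y r = Y (r ^+ 2)) ->
  (forall n, Ck1 n J y) -> (forall r : R, x r = r ^+ 2 * y r) ->
  restricts_to_flat M J (radial_connection L x).
Proof.
move=> d0 YS yY yS xy; exists (radial_connection L x); last first.
  move=> i z Dz; have := zero_section_restrE (radial_connectionE L i x (row_mx z 0)) => ->.
  rewrite (@eq_qone_form _ _ _ (fun=> 0)).
    by apply: quat_eq; rewrite /= /one_form big1 // => j _; rewrite scale0r.
  move=> j; rewrite (radial_tube _ _ _ xy).
  have -> : fibre (row_mx z (0 : 'rV[R]_4)) = 0.
    by rewrite /fibre row_mxKr /quat_of_row !mxE.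
  by apply: quat_ext => /=; ring.
split=> [i|].
  have oT : open (tube (O := O) J i) by exact: open_tube.
  apply: (qCk_smooth_hform oT (c := fun p a => qreal (y (radius p)) *
      qim (qconj (fibre p) * (dq a + sig8 L i p a * fibre p)))) => [p Tp|a m].
    rewrite (radial_connectionE L i x p); apply: eq_qone_form => a; exact: radial_tube.
  apply: (qCkM (dir := e_) (c := fun p => qreal (y (radius p)))).
    by apply: qCk_real; exact: radius_even_Ck d0 YS yY yS.
  apply: qCk_im; apply: qCkM; first by apply: qCk_conj; exact: fibre_qCk.
  apply: qCkD; first exact: qCk_cst.
  by apply: qCkM; [apply: qCk_sub (sig8_qCk L i a m) => p []|exact: fibre_qCk].
exists (fun=> one_fun); first exact: gauge_transformation_one.
move=> i p Ap; rewrite (radial_connectionE L i x p).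
by rewrite (gauge_act_one (gauge_act_one (radial_connectionE L i x p))).
Qed.

Lemma conj_unit_fibre_partial (p : 'rV[R]_(4 + 4)) a : 0 < radius p ->
  qpartial (qconj (@unit_fibre R)) a p = qconj (qpartial (@unit_fibre R) a p).
Proof.
move=> r0; have := qd_conj (qpartial_derive a (open_radius (@open_gt R 0)) (@unit_fibre_smooth R) r0).
move=> [d0 d1 d2 d3]; apply: quat_ext.
- exact: (derive_val (is_derive := d0)).
- exact: (derive_val (is_derive := d1)).
- exact: (derive_val (is_derive := d2)).
- exact: (derive_val (is_derive := d3)).
Qed.

(** In the frame of the pullback bundle x eta becomes x S + (x - 1) du u^-1, with du u^-1 = r^-2
    Im(dq conj(q)). Substituting x = 1 + r^2 g removes the singular factor. *)
Definition lc_coef (g : R -> R) i p a : quat R :=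
  qreal (g (radius p)) * qim (dq a * qconj (fibre p)) +
  qreal (1 + radius p ^+ 2 * g (radius p)) * sig8 L i p a.

Definition lc_hform (g : R -> R) (i : chart O) : hform (R := R) (4 + 4) :=
  Quat (fun p => one_form (fun a => q0 (lc_coef g i p a)))
       (fun p => one_form (fun a => q1 (lc_coef g i p a)))
       (fun p => one_form (fun a => q2 (lc_coef g i p a)))
       (fun p => one_form (fun a => q3 (lc_coef g i p a))).

Lemma lc_gauge (g x : R -> R) i p a : 0 < radius p ->
  x (radius p) = 1 + radius p ^+ 2 * g (radius p) ->
  qconj (qeval (qconj (@unit_fibre R)) p) * (qreal (x (radius p)) * etac L i p a) *
    qeval (qconj (@unit_fibre R)) p +
  qconj (qeval (qconj (@unit_fibre R)) p) * qpartial (qconj (@unit_fibre R)) a p = lc_coef g i p a.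
Proof.
move=> r0 xg; have -> : qeval (qconj (@unit_fibre R)) p = qconj (qeval (@unit_fibre R) p) by [].
rewrite conj_unit_fibre_partial // qconjK (eta_gauged L i a r0) /gauged.
have u1 := unit_fibre_unit r0; have [vu uv] := unit_qconj u1.
have o := open_radius (@open_gt R 0).
have D := qpartial_derive a o (@unit_fibre_smooth R) r0.
have nu1 : \forall y \near p, qnorm2 (qeval (@unit_fibre R) y) = 1.
  by apply: open_near o r0 _; exact: unit_fibre_unit.
rewrite (unit_derive nu1 D).
have E : qpartial (@unit_fibre R) a p * qconj (qeval (@unit_fibre R) p) =
    qreal (radius p ^+ 2)^-1 * qim (dq a * qconj (fibre p)).
  have -> := qd_unique D (unit_fibre_derive a r0); rewrite qeval_unit_fibre.
  have : radius p ^+ 2 = qnorm2 (fibre p) := radius_sq p.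
  have : radius p != 0 by rewrite gt_eqF.
  move: (radius p) (fibre p) (dq a) => r q d rn0; rewrite /qnorm2 => rE.
  have rE' : r ^+ 3 = (q0 q ^+ 2 + q1 q ^+ 2 + q2 q ^+ 2 + q3 q ^+ 2) * r by rewrite -rE -exprSr.
  have n0 : q0 q ^+ 2 + q1 q ^+ 2 + q2 q ^+ 2 + q3 q ^+ 2 != 0 by rewrite -rE expf_neq0.
  have conjE : qconj (qreal r^-1 * q) = qreal r^-1 * qconj q by apply: quat_ext => /=; ring.
  rewrite conjE mulrA.
  have -> : (qreal r^-1 * d - qreal (q0 (qconj q * d) / r ^+ 3) * q) * qreal r^-1 =
      qreal (r ^+ 2)^-1 * d - qreal (q0 (qconj q * d) / (r ^+ 2 * r ^+ 2)) * q.
    by apply: quat_ext => /=; field.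
  by rewrite rE; apply: quat_ext => /=; field.
rewrite /lc_coef; move: (qeval _ _) (qpartial _ _ _) (sig8 L i p a) vu uv E => u du S vu uv E.
have qrC c (x' : quat R) : x' * qreal c = qreal c * x' by apply: quat_ext => /=; ring.
rewrite mulrA qrC -!mulrA (mulrDl _ _ (qconj u)) -!mulrA uv mulr1 (mulrDr u) !mulrA uv !mul1r.
rewrite mulrN !mulrA uv mul1r E xg.
move: (qim _) => w; have rn0 : radius p != 0 by rewrite gt_eqF.
by apply: quat_ext => /=; field.
Qed.

Lemma lc_extension (g G x : R -> R) (d : R) : 0 < d ->
  (forall n, Ck1 n [set w : R | `|w| < d ^+ 2] G) -> (forall r, 0 <= r < d -> g r = G (r ^+ 2)) ->
  (forall n, Ck1 n J g) -> (forall r : R, J r -> x r = 1 + r ^+ 2 * g r) ->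
  restricts_to_LC L J (radial_connection L x).
Proof.
move=> d0 GS gG gS xg; exists (lc_hform g); last first.
  move=> i z Dz; have := @zero_section_restrE (lc_hform g i) (lc_coef g i (row_mx z 0)) z erefl => ->.
  rewrite spin_connectionE //; apply: eq_qone_form => j; rewrite /lc_coef.
  have F0 : fibre (row_mx z (0 : 'rV[R]_4)) = 0.
    by rewrite /fibre row_mxKr /quat_of_row !mxE.
  have -> : radius (row_mx z (0 : 'rV[R]_4)) = 0.
    by rewrite /Defs.radius F0 /qnorm2 /= expr0n /= !addr0 sqrtr0.
  have -> : sig8 L i (row_mx z (0 : 'rV[R]_4)) (lshift 4 j) = sig L i z j.
    rewrite /sig8 /base row_mxKl /lift4; case: splitP => [k jk|k jk].
      by congr (sig L i z _); apply: val_inj.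
    by have := ltn_ord j; move: jk => /= ->; rewrite ltnNge leq_addr.
  by rewrite F0; apply: quat_ext => /=; ring.
have gC i m : Ck e_ m (tube (O := O) J i) (fun p => g (radius p)).
  exact: radius_even_Ck d0 GS gG gS.
split=> [i|].
  have oT : open (tube (O := O) J i) by exact: open_tube.
  apply: (qCk_smooth_hform oT (c := lc_coef g i)) => [//|a m].
  apply: (qCkD (dir := e_)); apply: qCkM.
  - by apply: qCk_real; exact: gC.
  - by apply: qCk_im; apply: qCkM; [exact: qCk_cst|apply: qCk_conj; exact: fibre_qCk].
  - apply: qCk_real; apply: CkD; [exact: Ck_cst|apply: CkM; last exact: gC].
    apply: (@Ck_eq _ _ _ e_ m _ (fun p => qnorm2 (fibre p))) (qnorm2_fibre_Ck m _).
      exact: open_tube.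
    by move=> p _; rewrite radius_sq.
  - by apply: qCk_sub (sig8_qCk L i a m) => p [].
exists (fun=> one_fun); first exact: gauge_transformation_one.
move=> i p [Dp Jp].
have := gauge_act_qone_form (qconj (@unit_fibre R)) (gauge_act_one (radial_connectionE L i x p)).
move=> ->; apply: (@eq_qone_form _ _ (lc_coef g i p)) => a.
by apply: esym; apply: lc_gauge; [exact: J0|exact: xg].
Qed.

End Extension.

(** * The curvature norm at the zero section, which separates the two cases *)

Section Exclusivity.
Context {R : realType} {Z : topologicalType} {O : orbifold R Z} {M : spin_metric O}.
Context (L : levi_civita M) (s : R).
Hypothesis ES : einstein L s.
Hypothesis AS : anti_self_dual L.
Local Notation e_ := (@basis_vec R (4 + 4)).
Local Notation all_radii := [set r : R | 0 < r].

Let o_all : open all_radii. Proof. exact: open_gt. Qed.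

Lemma frame_change_smooth b : qall (smooth_on [set p | 0 < radius p]) (@frame_change R b).
Proof.
have o := open_radius o_all.
case: b; last first.
  have [s0 s1 s2 s3] := @unit_fibre_smooth R.
  have N (f : 'rV[R]_(4 + 4) -> R) : smooth_on [set p | 0 < radius p] f ->
      smooth_on [set p | 0 < radius p] (- f).
    by move=> fS; apply/(smooth_onP _ o) => m; apply: CkN; exact: (smooth_onP _ o).1.
  by split; [exact: s0|exact: N s1|exact: N s2|exact: N s3].
by split; apply/(smooth_onP _ o) => m; exact: Ck_cst.
Qed.

Lemma frame_change_unit b : unit_on [set p | 0 < radius p] (@frame_change R b).
Proof.
move=> p r0; case: b; first by rewrite /qnorm2 /= expr0n /= !addr0 expr1n.
rewrite -[qeval _ p]/(qconj (qeval (@unit_fibre R) p)) qnorm2_conj.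
exact: unit_fibre_unit.
Qed.

Lemma dq_lshift j : dq (R := R) (lshift 4 j) = 0.
Proof.
have E k : (lshift 4 j == rshift 4 k) = false by rewrite -val_eqE /=; have := ltn_ord j; case: eqP => // ->; rewrite ltnNge leq_addr.
by rewrite /dq !E.
Qed.

Lemma lift4_lshift {T : Type} (zero : T) c j : lift4 zero c (lshift 4 j) = c j.
Proof.
rewrite /lift4; case: splitP => k /= jk; first by congr c; apply: val_inj.
by have := ltn_ord j; rewrite jk ltnNge leq_addr.
Qed.

Lemma etac_lshift i z (r : R) j : 0 < r -> etac L i (fibre_point z r) (lshift 4 j) = sig L i z j.
Proof.
move=> r0; rewrite /etac dq_lshift fibre_fibre_point radius_fibre_point ?ltW // /sig8 lift4_lshift base_fibre_point.
have : q0 (sig L i z j) = 0 by [].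
by case: (sig L i z j) => a b c d /= ->; apply: quat_ext => /=; field; rewrite gt_eqF.
Qed.

Lemma unit_fibre_point z (r : R) : 0 < r -> qeval (@unit_fibre R) (fibre_point z r) = 1.
Proof.
move=> r0; rewrite qeval_unit_fibre fibre_fibre_point radius_fibre_point ?ltW //.
by apply: quat_ext => /=; rewrite ?mulVf ?gt_eqF //; ring.
Qed.

Definition boundary_field i z j k (x : R) : quat R :=
  qreal x * field_strength (sig L i z) (dsig L i z) j k +
  qreal (x ^+ 2 - x) * (sig L i z j * sig L i z k - sig L i z k * sig L i z j).

(** At a point with u = 1 the base coefficients of eta are those of the spin connection, and dr has
    none, so the term with x' drops out. *)
Lemma radial_field_strength i z j k (x : R -> R) (dx r : R) : 0 < r -> cdom i z ->
  is_derive r (1 : R) x dx ->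
  exists2 dc : 'I_(4 + 4) -> 'I_(4 + 4) -> quat R,
    forall a b, is_qderive (fibre_point z r) (e_ a)
      (fun y => qreal (x (radius y)) * etac L i y b) (dc a b) &
    field_strength (fun a => qreal (x (radius (fibre_point z r))) * etac L i (fibre_point z r) a) dc
      (lshift 4 j) (lshift 4 k) = boundary_field i z j k (x r).
Proof.
move=> r0 Dz xd; have rp := radius_fibre_point z (ltW r0).
have Dz' : cdom i (base (fibre_point z r)) by rewrite base_fibre_point.
have r0' : 0 < radius (fibre_point z r) by rewrite rp.
have xd' : is_derive (radius (fibre_point z r)) (1 : R) x dx by rewrite rp.
have [deta dE dK] := eta_field_strength ES AS Dz' r0'.
exists (fun a b => qreal (dx * drc (fibre_point z r) a) * etac L i (fibre_point z r) b +
    qreal (x (radius (fibre_point z r))) * deta a b) => [a b|].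
  exact: (radial_derive r0' xd' dE).
have := dK (lshift 4 j) (lshift 4 k).
rewrite unit_fibre_point // mulr1 (_ : qconj 1 = 1); last by apply: quat_ext; rewrite //= oppr0.
rewrite mul1r -(sig8_field_strength _ _ ES AS Dz').
have -> : field_strength (sig8 L i (fibre_point z r)) (dsig8 L i (fibre_point z r)) (lshift 4 j) (lshift 4 k)
    = field_strength (sig L i z) (dsig L i z) j k.
  by rewrite /field_strength /sig8 /dsig8 !lift4_lshift base_fibre_point.
rewrite /boundary_field => <-; rewrite /field_strength.
rewrite !etac_lshift // rp /drc !dq_lshift mulr0 /= !mul0r !mulr0.
move: (deta _ _) (deta _ _) (sig L i z j) (sig L i z k) => d d' S S'.
by rewrite (_ : qreal 0 = 0) // !mul0r !add0r; apply: quat_ext => /=; ring.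
Qed.

(** [B] arises from the radial connection by two unit gauge transformations; they conjugate the
    field strength and preserve its norm. *)
Lemma extension_field_strength b i z j k (x : R -> R) (dx r : R) B : 0 < r -> cdom i z ->
  is_derive r (1 : R) x dx -> extends_to M all_radii b (radial_connection L x) B ->
  forall gjk gkj, is_qderive (fibre_point z r) (e_ (lshift 4 j)) (fun y => hcoef (B i) y (lshift 4 k)) gjk ->
  is_qderive (fibre_point z r) (e_ (lshift 4 k)) (fun y => hcoef (B i) y (lshift 4 j)) gkj ->
  let c a := hcoef (B i) (fibre_point z r) (lshift 4 a) in
  qnorm2 (gjk - gkj + (c j * c k - c k * c j)) = qnorm2 (boundary_field i z j k (x r)).
Proof.
move=> r0 Dz xd [BS [u [uS u1 _] BE]] gjk gkj Djk Dkj c.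
have oA : open (annulus all_radii i) by exact: open_annulus.
have pA : annulus all_radii i (fibre_point z r).
  by split; rewrite ?base_fibre_point //= radius_fibre_point // ltW.
have sA : annulus all_radii i `<=` [set p | 0 < radius p] by move=> p [].
have fS : qall (smooth_on (annulus all_radii i)) (@frame_change R b).
  by have [s0 s1 s2 s3] := frame_change_smooth b; split; exact: smooth_on_sub sA _.
have f1 : unit_on (annulus all_radii i) (@frame_change R b) by move=> p /sA; exact: frame_change_unit.
have [dc dcE dcK] := radial_field_strength j k r0 Dz xd.
pose c0 := fun y a => qreal (x (radius y)) * etac L i y a.
have [d1 d1E d1K] := gauge_field_strength oA (uS i) (u1 i) pA dcE.
have [d2 d2E d2K] := gauge_field_strength oA fS f1 pA d1E.
have cE p a : annulus all_radii i p ->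
    hcoef (B i) p a = gauged (frame_change b) (gauged (u i) c0) p a.
  move=> Ap; have H0 : heval (radial_connection L x i) p = qone_form (c0 p) by exact: radial_connectionE.
  have H1 := gauge_act_qone_form (u i) H0.
  have H2 := gauge_act_qone_form (frame_change b) H1.
  by rewrite (hcoefE a (etrans (BE i p Ap) H2)).
have dE a a' : is_qderive (fibre_point z r) (e_ a) (fun y => hcoef (B i) y a') (d2 a a').
  by apply: qd_near (d2E a a'); apply: (open_near oA pA) => y Ay; rewrite cE.
have -> : gjk = d2 (lshift 4 j) (lshift 4 k) := qd_unique Djk (dE _ _).
have -> : gkj = d2 (lshift 4 k) (lshift 4 j) := qd_unique Dkj (dE _ _).
rewrite /c !cE //.
have := d2K (lshift 4 j) (lshift 4 k); rewrite {1}/field_strength => ->.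
rewrite d1K dcK !qnorm2M !qnorm2_conj (f1 _ pA) (u1 _ _ pA).
by rewrite !mulr1 !mul1r.
Qed.

Lemma hcoef_qCk1 (D : set 'rV[R]_(4 + 4)) (B : hform (R := R) (4 + 4)) : open D ->
  qall (smooth_form_on D) B -> forall a m, qCk e_ m D (fun p => hcoef B p a).
Proof.
move=> oD [s0 s1 s2 s3] a m; split.
- exact: (smooth_onP _ oD).1 (s0 _) m.
- exact: (smooth_onP _ oD).1 (s1 _) m.
- exact: (smooth_onP _ oD).1 (s2 _) m.
- exact: (smooth_onP _ oD).1 (s3 _) m.
Qed.

Lemma qCk_derive m (D : set 'rV[R]_(4 + 4)) c a : qCk e_ m.+1 D c ->
  exists2 g, forall p, D p -> is_qderive p (e_ a) c (g p) & qCk e_ m D g.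
Proof.
move=> [[_ /(_ a)[g0 G0 C0]] [_ /(_ a)[g1 G1 C1]] [_ /(_ a)[g2 G2 C2]] [_ /(_ a)[g3 G3 C3]]].
exists (fun p => Quat (g0 p) (g1 p) (g2 p) (g3 p)) => // p Dp.
by split; [exact: G0|exact: G1|exact: G2|exact: G3].
Qed.

(** Both norms have a limit as r tends to 0: the left one since [B] is smooth on the tube, the right
    one since it is polynomial in x. No control of the gauge transformation near Z is required. *)
Lemma boundary_limit b i z j k (x : R -> R) (x0 : R) B (c : 'rV[R]_4 -> 'I_4 -> quat R)
    (dc : 'I_4 -> 'I_4 -> quat R) : cdom i z ->
  (forall r : R, 0 < r -> exists dx, is_derive r (1 : R) x dx) -> x r @[r --> 0^'+] --> x0 ->
  extends_to M all_radii b (radial_connection L x) B ->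
  (forall z', cdom i z' -> heval (zero_section_restr (B i)) z' = qone_form (c z')) ->
  (forall j k, is_qderive z (@basis_vec R 4 j) (fun y => c y k) (dc j k)) ->
  qnorm2 (field_strength (c z) dc j k) = qnorm2 (boundary_field i z j k x0).
Proof.
move=> Dz xd xc E BZ dcE; have [BS _] := E.
have oT : open (tube all_radii i).
  by apply: (@open_tube _ _ _ all_radii setT); [exact: openT|move=> r; split=> [|[]]|].
have pT r : 0 <= r -> tube all_radii i (fibre_point z r).
  rewrite le_eqVlt => r0; split; first by rewrite base_fibre_point.
  by case/predU1P: r0 => [<-|r0]; [left|right]; rewrite /= radius_fibre_point // ltW.
have C a m := hcoef_qCk1 oT (BS i) a m.
have [gjk jkE jkC] := qCk_derive (lshift 4 j) (C (lshift 4 k) 1%N).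
have [gkj kjE kjC] := qCk_derive (lshift 4 k) (C (lshift 4 j) 1%N).
pose K p := gjk p + - gkj p + (hcoef (B i) p (lshift 4 j) * hcoef (B i) p (lshift 4 k) +
   - (hcoef (B i) p (lshift 4 k) * hcoef (B i) p (lshift 4 j))).
have qN m (D : set 'rV[R]_(4 + 4)) c' : qCk e_ m D c' -> qCk e_ m D (fun p => - c' p).
  by move=> [????]; split; exact: CkN.
have [K0 K1 K2 K3] : qCk e_ 0 (tube all_radii i) K.
  have c1 := qCkM (C (lshift 4 j) 0%N) (C (lshift 4 k) 0%N).
  have c2 := qCkM (C (lshift 4 k) 0%N) (C (lshift 4 j) 0%N).
  exact: qCkD (qCkD jkC (qN _ _ _ kjC)) (qCkD c1 (qN _ _ _ c2)).
have KC : Ck e_ 0 (tube all_radii i) (fun p => qnorm2 (K p)).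
  exact: CkD (CkD (CkD (CkX 2 K0) (CkX 2 K1)) (CkX 2 K2)) (CkX 2 K3).
have KL : qnorm2 (K (fibre_point z r)) @[r --> 0^'+] --> qnorm2 (K (fibre_point z 0)).
  apply: cvg_at_right_filter.
  have cont : {for (0 : R), continuous (fibre_point z)}.
    rewrite (_ : fibre_point z = fun r : R => r *: e_ (rshift 4 (o4 0)) + fibre_point z 0); last first.
      by apply/funext => r; rewrite fibre_point_line addr0.
    apply: continuousD; last exact: cvg_cst.
    by apply: continuousZl; exact: cvg_id.
  exact: (@continuous_comp _ _ _ (fibre_point z) (fun p => qnorm2 (K p)) 0 cont (Ck_cont KC (pT 0 (lexx 0)))).
have FL : qnorm2 (boundary_field i z j k (x r)) @[r --> 0^'+] --> qnorm2 (boundary_field i z j k x0).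
  apply: (@cvg_comp _ _ _ x (fun y => qnorm2 (boundary_field i z j k y)) _ _ _ xc).
  have : Ck1 0 setT (fun y => qnorm2 (boundary_field i z j k y)).
    rewrite /boundary_field; move: (field_strength _ _ _ _) (_ - _) => F G.
    have idC : Ck1 0 setT (fun y : R => y) by exact: Ck1_id.
    have sqC : Ck1 0 setT (fun y : R => y ^+ 2 - y) := CkB (CkX 2 idC) idC.
    have [F0 F1 F2 F3] := qCkD (qCkM (qCk_real idC) (qCk_cst _ 0 setT F)) (qCkM (qCk_real sqC) (qCk_cst _ 0 setT G)).
    exact: CkD (CkD (CkD (CkX 2 F0) (CkX 2 F1)) (CkX 2 F2)) (CkX 2 F3).
  by move=> /Ck_cont/(_ (I : setT x0)).
have KF : \forall r \near 0^'+, qnorm2 (boundary_field i z j k (x r)) = qnorm2 (K (fibre_point z r)).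
  near=> r; have r0 : 0 < r by near: r; exact: nbhs_right_gt.
  have [dx xD] := xd r r0; apply: esym.
  exact: (extension_field_strength r0 Dz xD E (jkE _ (pT r (ltW r0))) (kjE _ (pT r (ltW r0)))).
have : qnorm2 (K (fibre_point z 0)) = qnorm2 (boundary_field i z j k x0).
  apply: (cvg_unique (@Rhausdorff R) KL); apply: cvg_trans FL; exact: near_eq_cvg KF.
move=> <-; have FZ z' : fibre_point z' 0 = row_mx z' 0.
  rewrite /fibre_point; congr row_mx; apply/rowP => l; rewrite !mxE.
  by case: l => -[|[|[|[|//]]]].
have cE z' l : cdom i z' -> hcoef (B i) (row_mx z' 0) (lshift 4 l) = c z' l.
  move=> Dz'; have := etrans (esym (zero_section_restr_coef (B i) z')) (BZ z' Dz').
  by move/qone_form_inj/(_ l).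
(* Moving in a base direction stays on the zero section, so these derivatives of [B] depend only on
   its restriction. *)
have dcU l m g : is_qderive (fibre_point z 0) (e_ (lshift 4 l)) (fun y => hcoef (B i) y (lshift 4 m)) g ->
    g = dc l m.
  move=> H; apply: qd_unique (dcE l m).
  have line (h : R) : h *: e_ (lshift 4 l) + row_mx z 0 = row_mx (h *: @basis_vec R 4 l + z) 0.
    apply/rowP => a; rewrite !mxE; case: splitP => w aw; rewrite !mxE eqxx /=.
      by congr (_ * (_%:R) + _); rewrite -!val_eqE /= aw.
    rewrite -val_eqE /= aw addr0; case: eqP => [E'|_]; last by rewrite mulr0.
    by have := ltn_ord l; rewrite -E' ltnNge leq_addr.
  have nearD : \forall h \near (0 : R), cdom i (h *: @basis_vec R 4 l + z).
    have ct : {for (0 : R), continuous (fun h : R => h *: @basis_vec R 4 l + z)}.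
      by apply: continuousD; [apply: continuousZl; exact: cvg_id|exact: cvg_cst].
    apply: ct; rewrite scale0r add0r; apply: open_nbhs_nbhs; split=> //; exact: cdom_open.
  have tr (F : quat R -> R) df : is_derive (fibre_point z 0) (e_ (lshift 4 l))
      (fun y => F (hcoef (B i) y (lshift 4 m))) df ->
      is_derive z (@basis_vec R 4 l) (fun y => F (c y m)) df.
    move=> /isd_line D; apply/isd_line; apply: isd_near D.
    by apply: filterS nearD => h Dh; rewrite FZ line cE.
  case: H => H0 H1 H2 H3; split.
  - exact: (tr (@q0 R)) H0.
  - exact: (tr (@q1 R)) H1.
  - exact: (tr (@q2 R)) H2.
  - exact: (tr (@q3 R)) H3.
rewrite /K (dcU _ _ _ (jkE _ (pT 0 (lexx 0)))) (dcU _ _ _ (kjE _ (pT 0 (lexx 0)))).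
by rewrite FZ !cE.
Unshelve. all: by end_near.
Qed.

Hypothesis s_gt0 : 0 < s.

(** Contracting e0^e1 + e2^e3 with the vector dual to e1 leaves e0. If the curvature vanished at z,
    so would e0, against the invertibility of the coframe. *)
Lemma sig_curvature_neq0 i z : cdom i z ->
  exists j k, qnorm2 (field_strength (sig L i z) (dsig L i z) j k) != 0.
Proof.
move=> Dz; have [Q [_ QE]] := cof_inverse (M := M) Dz.
have [//|H] := pselect (exists j k, qnorm2 (field_strength (sig L i z) (dsig L i z) j k) != 0).
have V j k : cof2 (M := M) i (o4 0) (o4 1) z j k + cof2 (M := M) i (o4 2) (o4 3) z j k = 0.
  have : qnorm2 (field_strength (sig L i z) (dsig L i z) j k) = 0.
    by apply/eqP/negPn/negP => H'; apply: H; exists j, k.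
  have sn : s / 24 != 0 by rewrite gt_eqF // divr_gt0.
  rewrite (spin_curvature j k ES AS Dz) qnorm2M => /eqP; rewrite mulf_eq0 => /orP[].
    by rewrite /qnorm2 /= expr0n /= !addr0 sqrrN sqrf_eq0 (negPf sn).
  rewrite /qnorm2 /=; move: (cof2 _ _ _ _ _ _ + _) (cof2 _ _ _ _ _ _ + _) (cof2 _ _ _ _ _ _ + _).
  move=> a b c /eqP E; apply/eqP; rewrite -sqrf_eq0; apply/eqP.
  have := sqr_ge0 a; have := sqr_ge0 b; have := sqr_ge0 c.
  by move: E; rewrite expr0n /= add0r; lra.
have V0 j : cof (M := M) i (o4 0) z j = 0.
  transitivity (\sum_k (cof2 (M := M) i (o4 0) (o4 1) z j k + cof2 (M := M) i (o4 2) (o4 3) z j k) * Q k (o4 1)).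
    transitivity (\sum_k (cof (M := M) i (o4 0) z j * (cof (M := M) i (o4 1) z k * Q k (o4 1)) -
        cof (M := M) i (o4 1) z j * (cof (M := M) i (o4 0) z k * Q k (o4 1)) +
        (cof (M := M) i (o4 2) z j * (cof (M := M) i (o4 3) z k * Q k (o4 1)) -
        cof (M := M) i (o4 3) z j * (cof (M := M) i (o4 2) z k * Q k (o4 1))))).
      by rewrite !(big_split, sumrN) /= -!mulr_sumr !QE !o4_eq //=; ring.
    by apply: eq_bigr => k _; rewrite /cof2; ring.
  by rewrite big1 // => k _; rewrite V mul0r.
have := QE (o4 0) (o4 0); rewrite eqxx big1; last by move=> j _; rewrite V0 mul0r.
by move/eqP; rewrite eq_sym oner_eq0.
Qed.

End Exclusivity.

(** * The two kinds of solution and their behaviour at the zero section *)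

Section Solutions.
Context {R : realType} {Z : topologicalType} {O : orbifold R Z} {M : spin_metric O}.
Context (L : levi_civita M) (s : R) (nu0 : R) (t nu : R -> R).
Hypothesis s_gt0 : 0 < s.
Hypothesis ES : einstein L s.
Hypothesis AS : anti_self_dual L.
Hypothesis nu0_gt0 : 0 < nu0.
Hypothesis P : profile_solution nu0 t nu.
Hypothesis Z_nonempty : [set: Z] !=set0.
Local Notation all_radii := [set r : R | 0 < r].
Local Notation N := (nu2 nu).
Local Notation n0 := (nu0 ^+ 2).

Lemma eq_extends_to J b B (x x' : R -> R) : (forall r, J r -> x r = x' r) ->
  extends_to M J b (radial_connection L x) B -> extends_to M J b (radial_connection L x') B.
Proof.
move=> xx' [BS [u uG uE]]; split; first exact: BS.
exists u => [|i p Ap]; first exact: uG.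
apply: etrans (uE i p Ap) _.
have E y := gauge_act_qone_form (frame_change b) (gauge_act_qone_form (u i) (radial_connectionE L i y p)).
apply: etrans (E x) (esym (etrans (E x') _)).
by apply: eq_qone_form => a; rewrite xx' //; case: Ap.
Qed.

Lemma eq_restricts_to_flat J (x x' : R -> R) : (forall r, J r -> x r = x' r) ->
  restricts_to_flat M J (radial_connection L x) -> restricts_to_flat M J (radial_connection L x').
Proof. by move=> xx' [B BE B0]; exists B; [exact: eq_extends_to xx' BE|exact: B0]. Qed.

Lemma eq_restricts_to_LC J (x x' : R -> R) : (forall r, J r -> x r = x' r) ->
  restricts_to_LC L J (radial_connection L x) -> restricts_to_LC L J (radial_connection L x').
Proof. by move=> xx' [B BE B0]; exists B; [exact: eq_extends_to xx' BE|exact: B0]. Qed.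

Let some_chart : exists i z, cdom (o := O) i z.
Proof. by have [y _] := Z_nonempty; have [i [z [Dz _]]] := cproj_cover O y; exists i, z. Qed.

(** For x = 1 the boundary field is the curvature of the spin connection, which is nonzero
    somewhere, while a flat restriction forces it to vanish. *)
Lemma flat_limit_neq1 (x : R -> R) : (forall r : R, 0 < r -> exists dx, is_derive r (1 : R) x dx) ->
  x r @[r --> 0^'+] --> (1 : R) -> ~ restricts_to_flat M all_radii (radial_connection L x).
Proof.
move=> xd x1 [B BE BZ]; have [i [z Dz]] := some_chart.
have [j [k /eqP]] := sig_curvature_neq0 ES AS s_gt0 Dz; apply.
have BZ' z' : cdom i z' -> heval (zero_section_restr (B i)) z' = qone_form (fun=> 0).
  by move=> Dz'; rewrite BZ //; apply: quat_eq; rewrite /= /one_form big1 // => l _; rewrite scale0r.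
have := boundary_limit (c := fun _ _ => 0) (dc := fun _ _ => 0) ES AS j k Dz xd x1 BE BZ' (fun _ _ => qd_cst _ _ _).
rewrite /boundary_field expr1n subrr qreal1 mul1r (_ : qreal 0 = 0) // mul0r addr0 => <-.
by rewrite /field_strength !mulr0 !subr0 addr0 /qnorm2 /= expr0n /= !addr0.
Qed.

(** For x = 0 the boundary field vanishes, while the restriction has the nonzero curvature of the
    spin connection. *)
Lemma LC_limit_neq0 (x : R -> R) : (forall r : R, 0 < r -> exists dx, is_derive r (1 : R) x dx) ->
  x r @[r --> 0^'+] --> (0 : R) -> ~ restricts_to_LC L all_radii (radial_connection L x).
Proof.
move=> xd x1 [B BE BZ]; have [i [z Dz]] := some_chart.
have [j [k /eqP]] := sig_curvature_neq0 ES AS s_gt0 Dz; apply.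
have BZ' z' : cdom i z' -> heval (zero_section_restr (B i)) z' = qone_form (sig L i z').
  by move=> Dz'; rewrite BZ // spin_connectionE.
have := boundary_limit (dc := dsig L i z) ES AS j k Dz xd x1 BE BZ' (fun j k => sig_derive L j k Dz).
move=> ->; rewrite /boundary_field expr0n subr0 (_ : qreal 0 = 0) // !mul0r addr0.
by rewrite /qnorm2 /= expr0n /= !addr0.
Qed.

Definition csol (C r : R) : R := t r ^+ 2 / (N r / 3 + C).

Lemma csol_den (C r : R) : - n0 / 3 <= C -> 0 < r -> 0 < N r / 3 + C.
Proof.
by move=> C0 r0; have := N_gt nu0_gt0 P r0; move: C0; move: (N r) => a; lra.
Qed.

Lemma csol_ode (C : R) : - n0 / 3 <= C -> ode t N all_radii (csol C).
Proof.
move=> C0; apply: (ode_solution nu0_gt0 P) => // r r0.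
by rewrite gt_eqF // csol_den.
Qed.

Lemma csol_cvg0 (C : R) : - n0 / 3 < C -> csol C r @[r --> 0^'+] --> (0 : R).
Proof.
move=> C0; have E : 0 = t 0 ^+ 2 / (N 0 / 3 + C) by rewrite (profile_t0 P) expr0n mul0r.
rewrite [X in _ --> X]E; apply: cvgM.
  by apply: cvgM; exact: profile_t_right_cont P.
apply: cvgV; first by rewrite (profile_N0 P) gt_eqF //; lra.
by apply: cvgD; [apply: cvgM; [exact: N_right_cont P|exact: cvg_cst]|exact: cvg_cst].
Qed.

(** The two denominators differ by the factor y0, so they vanish together; there both sides are 0 by
    the convention for the inverse of 0. *)
Lemma xsol_csol (y0 r : R) : y0 != 0 -> xsol nu0 t nu y0 r = csol (y0^-1 - n0 / 3) r.
Proof.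
move=> y00; rewrite /xsol /csol /xden; congr (_ * _).
have [E|E] := eqVneq (1 + y0 * (N r - n0) / 3) 0.
  have -> : N r / 3 + (y0^-1 - n0 / 3) = (1 + y0 * (N r - n0) / 3) / y0 by field.
  by rewrite E mul0r !invr0 mulr0.
have -> : N r / 3 + (y0^-1 - n0 / 3) = (1 + y0 * (N r - n0) / 3) / y0 by field.
by rewrite invfM invrK mulrC.
Qed.

Lemma ysol_xsol (y0 r : R) : 0 < r -> r ^+ 2 * ysol nu0 t nu y0 r = xsol nu0 t nu y0 r.
Proof.
by move=> r0; rewrite /ysol gt_eqF // mulrCA divff ?mulr1 // expf_neq0 // gt_eqF.
Qed.

Lemma ysol_ode (J : set R) y0 : open J -> (forall r : R, J r -> 0 < r) ->
  (forall r, J r -> xden nu0 nu y0 r != 0) ->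
  ode t N J (fun r => r ^+ 2 * ysol nu0 t nu y0 r).
Proof.
move=> oJ J0 D0; apply: (ode_eq (x := xsol nu0 t nu y0) oJ) => [r /J0 r0|]; first by rewrite ysol_xsol.
have [->|y00] := eqVneq y0 0.
  apply: (ode_eq (x := fun=> 0) oJ) => [r _|r _]; first by rewrite /xsol mul0r mulr0.
  by apply: isd_eq (isd_cst (0 : R) r 1) _; rewrite mulr0 !mul0r.
apply: (ode_eq (x := csol (y0^-1 - n0 / 3)) oJ) => [r _|]; first by rewrite xsol_csol.
apply: (ode_solution nu0_gt0 P) => // r Jr.
have -> : nu2 nu r / 3 + (y0^-1 - n0 / 3) = xden nu0 nu y0 r / y0 by rewrite /xden; field.
by rewrite mulf_neq0 ?invr_eq0 // D0.
Qed.

Lemma ysol_Ck (J : set R) y0 n : open J -> (forall r : R, J r -> 0 < r) ->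
  (forall r, J r -> xden nu0 nu y0 r != 0) -> Ck1 n J (ysol nu0 t nu y0).
Proof.
move=> oJ J0 D0; have [tS NS] := profile_smooth P n.
have idS : Ck1 n J (fun r : R => r) by exact: Ck1_id.
have sJ : J `<=` all_radii by move=> r /J0.
have := Ck_sub sJ tS; have := Ck_sub sJ NS => NS' tS'.
apply: (@Ck_eq _ _ _ _ n J (fun r => xsol nu0 t nu y0 r * (r ^+ 2)^-1) _ oJ) => [r /J0 r0|].
  by rewrite /ysol gt_eqF.
apply: CkM; last by apply: CkV; [move=> r /J0 r0; rewrite expf_neq0 // gt_eqF|exact: CkX].
apply: CkM; first exact: CkX.
apply: CkM; first exact: Ck_cst.
apply: CkV => //; apply: CkD; first exact: Ck_cst.
apply: CkM; last exact: Ck_cst.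
by apply: CkM; [exact: Ck_cst|apply: CkB => //; exact: Ck_cst].
Qed.

Lemma ysol_flat (J U : set R) (y0 b : R) : open J -> open U ->
  (forall r : R, J r <-> 0 < r /\ U r) -> U 0 -> 0 < b ->
  (forall r, J r \/ 0 <= r <= b -> xden nu0 nu y0 r != 0) ->
  restricts_to_flat M J (radial_connection L (fun r => r ^+ 2 * ysol nu0 t nu y0 r)).
Proof.
move=> oJ oU JU U0 b0 D0.
have [d [Y [d0 YS yY]]] := @ysol_even _ _ _ _ P y0 b b0 (fun r rb => D0 r (or_intror rb)).
have J0 r : J r -> 0 < r by move=> /JU[].
apply: (flat_extension L oJ oU JU U0 d0 YS yY) => // n.
by apply: ysol_Ck => // r Jr; apply: D0; left.
Qed.

Lemma xden_gt0 (y0 r : R) : 0 <= y0 -> 0 <= r -> 0 < xden nu0 nu y0 r.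
Proof.
move=> y00 r0; have NN : 0 <= N r - n0.
  by have := N_ge nu0_gt0 P r0; have := sqr_ge0 r; move: (N r) (r ^+ 2) => a b; lra.
by rewrite /xden ltr_pwDl // divr_ge0 // mulr_ge0.
Qed.

Definition xlim : R -> R := csol (- n0 / 3).

Lemma xlim_even_alg (r a b : R) : r != 0 -> 1 + r ^+ 2 * b != 0 ->
  (r * (1 + r ^+ 2 * a)) ^+ 2 / (3 * r ^+ 2 * (1 + r ^+ 2 * b) / 3) =
  1 + r ^+ 2 * ((2 * a + r ^+ 2 * a ^+ 2 - b) / (1 + r ^+ 2 * b)).
Proof. by move=> r0 D; field; rewrite D r0. Qed.

(** At r = 0 both t^2 and (N - n0)/3 vanish to second order with equal leading coefficient, so their
    quotient is 1 plus r^2 times a smooth function of r^2. *)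
Lemma xlim_even : exists (d : R) (G : R -> R), [/\ 0 < d,
  forall n, Ck1 n [set w : R | `|w| < d ^+ 2] G &
  forall r, 0 < r < d -> xlim r = 1 + r ^+ 2 * G (r ^+ 2)].
Proof.
have [d [T1 [P1 [d0 T1S P1S E]]]] := profile_even P.
have d20 : 0 < d ^+ 2 by rewrite exprn_gt0.
have D0 : [set w : R | `|w| < d ^+ 2] 0 by rewrite /= normr0.
have [e e0 eP] : exists2 e : R, 0 < e & forall w, `|w| < e -> 1 + w * P1 w != 0.
  have c : {for (0 : R), continuous (fun w : R => 1 + w * P1 w)}.
    apply: cvgD; first exact: cvg_cst.
    by apply: cvgM; [exact: cvg_id|exact: Ck_cont (P1S 0%N) D0].
  have : \forall w \near (0 : R), 1 + w * P1 w != 0.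
    apply: (c [set v : R | v != 0]); apply: open_nbhs_nbhs; split; first exact: open_neq.
    by rewrite /= mul0r addr0 oner_eq0.
  move=> /nbhs_ballP[e e0 H]; exists e => // w we; apply: H.
  by rewrite /ball /= sub0r normrN.
(* In w = r^2 the series live on |w| < d^2, and the denominator is nonzero on |w| < e. *)
pose d' := Num.min d (Num.sqrt e).
have d'0 : 0 < d' by rewrite lt_min d0 sqrtr_gt0.
have d'd : d' ^+ 2 <= d ^+ 2 by rewrite ler_sqr ?nnegrE ?(ltW d'0) ?(ltW d0) // ge_min lexx.
have d'e : d' ^+ 2 <= e.
  by rewrite -[leRHS](sqr_sqrtr (ltW e0)) ler_sqr ?nnegrE ?(ltW d'0) ?sqrtr_ge0 // ge_min lexx orbT.
exists d', (fun w => (2 * T1 w + w * T1 w ^+ 2 - P1 w) / (1 + w * P1 w)); split=> // [n|r /andP[r0 rd]].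
  have sD : [set w : R | `|w| < d' ^+ 2] `<=` [set w : R | `|w| < d ^+ 2].
    by move=> w /= /lt_le_trans; apply.
  have TS := Ck_sub sD (T1S n); have PS := Ck_sub sD (P1S n).
  have idS : Ck1 n [set w : R | `|w| < d' ^+ 2] (fun r : R => r) by exact: Ck1_id.
  apply: CkM.
    apply: CkB => //; apply: CkD; first by apply: CkM => //; exact: Ck_cst.
    by apply: CkM => //; exact: CkX.
  apply: CkV; first by move=> w /= wd; apply: eP; exact: lt_le_trans wd d'e.
  by apply: CkD; [exact: Ck_cst|exact: CkM].
have rd' : r < d by apply: lt_le_trans rd _; rewrite ge_min lexx.
have [tE NE] : t r = r * (1 + r ^+ 2 * T1 (r ^+ 2)) /\ N r - n0 = 3 * r ^+ 2 * (1 + r ^+ 2 * P1 (r ^+ 2)).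
  by apply: E; rewrite (ltW r0).
have D : 1 + r ^+ 2 * P1 (r ^+ 2) != 0.
  apply: eP; rewrite ger0_norm ?sqr_ge0 //; apply: lt_le_trans d'e.
  by rewrite ltr_sqr ?nnegrE ?(ltW d'0) ?(ltW r0).
have r00 : r != 0 by rewrite gt_eqF.
rewrite /xlim /csol (_ : N r / 3 + - n0 / 3 = (N r - n0) / 3); last by field.
by rewrite NE tE xlim_even_alg.
Qed.

Lemma xlim_cvg1 : xlim r @[r --> 0^'+] --> (1 : R).
Proof.
have [d [G [d0 GS xG]]] := xlim_even.
have D0 : [set w : R | `|w| < d ^+ 2] 0 by rewrite /= normr0 exprn_gt0.
have c : {for (0 : R), continuous (fun r : R => 1 + r ^+ 2 * G (r ^+ 2))}.
  have sq : {for (0 : R), continuous (fun r : R => r ^+ 2)} by exact: exprn_continuous.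
  apply: cvgD; first exact: cvg_cst.
  apply: cvgM; first exact: sq.
  apply: (@continuous_comp _ _ _ (fun r : R => r ^+ 2) G 0 sq).
  by rewrite expr0n; exact: Ck_cont (GS 0%N) D0.
have : 1 + r ^+ 2 * G (r ^+ 2) @[r --> 0^'+] --> (1 : R).
  by have := cvg_at_right_filter c; rewrite expr0n mul0r addr0.
apply: cvg_trans; apply: near_eq_cvg; near=> r.
apply: esym; apply: xG; apply/andP; split; near: r; [exact: nbhs_right_gt|exact: nbhs_right_lt].
Unshelve. all: by end_near.
Qed.

Lemma xlim_LC : restricts_to_LC L all_radii (radial_connection L xlim).
Proof.
have [d [G [d0 GS xG]]] := xlim_even; have oJ : open all_radii by exact: open_gt.
pose g r := if r == 0 then G 0 else (xlim r - 1) / r ^+ 2.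
have JT r : all_radii r <-> 0 < r /\ [set: R] r by split=> [|[]].
apply: (lc_extension L oJ openT JT I d0 GS (g := g)) => [r /andP[r0 rd]|n|r r0].
- rewrite /g; have [->|r00] := eqVneq r 0; first by rewrite expr0n.
  have r0' : 0 < r by rewrite lt_def r00.
  by rewrite xG ?r0' //; move: (G _) => v; field.
- apply: (@Ck_eq _ _ _ _ n all_radii (fun r => (xlim r - 1) * (r ^+ 2)^-1) _ oJ) => [r r0|].
    by rewrite /g gt_eqF.
  have idS : Ck1 n all_radii (fun r : R => r) by exact: Ck1_id.
  apply: CkM.
    apply: CkB; last exact: Ck_cst.
    by apply: (ode_smooth nu0_gt0 P) => //; exact: csol_ode.
  by apply: CkV; [move=> r r0; rewrite expf_neq0 // gt_eqF|exact: CkX].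
- by rewrite /g gt_eqF //; field; rewrite gt_eqF.
Qed.

Lemma ode_dichotomy (x : R -> R) : ode t N all_radii x ->
  (forall r : R, 0 < r -> x r = xlim r) \/
  exists2 y0 : R, 0 <= y0 & forall r : R, 0 < r -> x r = r ^+ 2 * ysol nu0 t nu y0 r.
Proof.
move=> /(ode_global nu0_gt0 P)[x0|[C]].
  right; exists 0 => // r r0; rewrite x0 // ysol_xsol // /xsol mul0r mulr0 //.
rewrite le_eqVlt => /predU1P[<- xC|C0 xC]; first by left.
have y0 : 0 < C + n0 / 3 by lra.
right; exists (C + n0 / 3)^-1; first by rewrite invr_ge0 ltW.
move=> r r0; rewrite xC // ysol_xsol // xsol_csol ?invr_neq0 ?gt_eqF // invrK.
by rewrite /csol addrK.
Qed.

Lemma ysol_cvg0 (y0 : R) : 0 <= y0 -> r ^+ 2 * ysol nu0 t nu y0 r @[r --> 0^'+] --> (0 : R).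
Proof.
move=> y00; have H : xsol nu0 t nu y0 r @[r --> 0^'+] --> (0 : R).
  have [->|yn0] := eqVneq y0 0.
    rewrite (_ : xsol nu0 t nu 0 = fun=> 0); first exact: cvg_cst.
    by apply/funext => r; rewrite /xsol mul0r mulr0.
  rewrite (_ : xsol nu0 t nu y0 = csol (y0^-1 - n0 / 3)); last first.
    by apply/funext => r; rewrite xsol_csol.
  apply: csol_cvg0; have : 0 < y0^-1 by rewrite invr_gt0 lt_def yn0.
  lra.
apply: cvg_trans H; apply: near_eq_cvg; near=> r.
by rewrite ysol_xsol //; near: r; exact: nbhs_right_gt.
Unshelve. all: by end_near.
Qed.

Lemma ode_ex_derive (x : R -> R) : ode t N all_radii x ->
  forall r : R, 0 < r -> exists dx, is_derive r (1 : R) x dx.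
Proof. by move=> xd r r0; eexists; exact: xd. Qed.

Lemma ysol_ode_all y0 : 0 <= y0 -> ode t N all_radii (fun r => r ^+ 2 * ysol nu0 t nu y0 r).
Proof.
move=> y00; apply: ysol_ode => [|//|r r0]; first exact: open_gt.
by rewrite gt_eqF // xden_gt0 // ltW.
Qed.

Lemma xlim_not_flat : ~ restricts_to_flat M all_radii (radial_connection L xlim).
Proof.
by apply: flat_limit_neq1; [apply: ode_ex_derive; exact: csol_ode|exact: xlim_cvg1].
Qed.

Lemma ysol_not_LC y0 : 0 <= y0 ->
  ~ restricts_to_LC L all_radii (radial_connection L (fun r => r ^+ 2 * ysol nu0 t nu y0 r)).
Proof.
by move=> y00; apply: LC_limit_neq0; [apply: ode_ex_derive; exact: ysol_ode_all|exact: ysol_cvg0].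
Qed.

Lemma ysol_flat_all y0 : 0 <= y0 ->
  restricts_to_flat M all_radii (radial_connection L (fun r => r ^+ 2 * ysol nu0 t nu y0 r)).
Proof.
move=> y00; apply: (@ysol_flat _ setT y0 1); [exact: open_gt|exact: openT|by move=> r; split=> [|[]]|by []|by []|].
by move=> r [r0|/andP[r0 _]]; rewrite gt_eqF // xden_gt0 // ltW.
Qed.

Lemma ysol_analytic (D : set R) y0 : (forall r0, D r0 -> 0 <= r0 /\ exists2 b, r0 < b &
    forall r, 0 <= r <= b -> xden nu0 nu y0 r != 0) -> real_analytic_on D (ysol nu0 t nu y0).
Proof.
move=> DE r0 /DE[r00 [b r0b D0]].
have [a [d [d0 H]]] := ysol_analytic_at P (introT andP (conj r00 r0b)) D0.
by exists a, d; split=> // r /DE[rr _]; exact: H.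
Qed.

(** A single radius determines the parameter: after cancelling t^2, cross-multiplying y0/[xden]
    leaves a linear identity that forces equality. *)
Lemma ysol_inj y0 y1 (r : R) : 0 < r -> 0 <= y0 -> 0 <= y1 ->
  r ^+ 2 * ysol nu0 t nu y0 r = r ^+ 2 * ysol nu0 t nu y1 r -> y0 = y1.
Proof.
move=> r0 y00 y10; rewrite !ysol_xsol // /xsol => /mulfI E.
have tr : t r ^+ 2 != 0 by rewrite expf_neq0 // gt_eqF // (t_gt0 nu0_gt0 P).
have D0 : xden nu0 nu y0 r != 0 by rewrite gt_eqF // xden_gt0 // ltW.
have D1 : xden nu0 nu y1 r != 0 by rewrite gt_eqF // xden_gt0 // ltW.
have := E tr => /eqP; rewrite eqr_div // /xden => /eqP; lra.
Qed.

Lemma xden_near (y0 : R) : y0 < 0 -> exists2 eps : R, 0 < eps &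
  forall r, 0 <= r < eps -> 0 < xden nu0 nu y0 r.
Proof.
move=> y00; have c : xden nu0 nu y0 r @[r --> 0^'+] --> xden nu0 nu y0 0.
  apply: cvgD; first exact: cvg_cst.
  apply: cvgM; last exact: cvg_cst.
  apply: cvgM; first exact: cvg_cst.
  by apply: cvgB; [exact: N_right_cont P|exact: cvg_cst].
have : \forall r \near (0 : R)^'+, 0 < xden nu0 nu y0 r.
  apply: (c [set v : R | 0 < v]); apply: open_nbhs_nbhs; split; first exact: open_gt.
  by rewrite /= (xden0 P).
move=> H'; have /nbhs_ballP[e e0 H] : nbhs (0 : R) [set r | 0 < r -> 0 < xden nu0 nu y0 r] by exact: H'.
exists e => // r /andP[].
rewrite le_eqVlt => /predU1P[<- _|r0 re]; first by rewrite (xden0 P).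
by apply: H => //; rewrite /ball /= sub0r normrN gtr0_norm.
Qed.

End Solutions.

(** The premise that x is nonzero somewhere excludes the trivial solution y0 = 0, which does not
    tend to 3/5. For negative y0, being only locally defined is expressed by saying that no
    instanton on all radii restricts to the local one. *)
Theorem theorem7 (R : realType) (Z : topologicalType)
  (Z_nonempty : [set: Z] !=set0)
  (Z_compact : compact [set: Z]) (Z_hausdorff : hausdorff_space Z)
  (O : orbifold R Z) (M : spin_metric O) (L : levi_civita M)
  (s : R) (s_gt0 : 0 < s)
  (Z_einstein : einstein L s) (Z_asd : anti_self_dual L)
  (nu0 : R) (nu0_gt0 : 0 < nu0) (t nu : R -> R)
  (t_nu : profile_solution nu0 t nu) :
  let all_radii := [set r : R | 0 < r] in
  let instanton J x := spin7_instanton L s t nu J (radial_connection L x) in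
  let smooth J x := smooth_on_E M J (radial_connection L x) in
  let case_LC J x := restricts_to_LC L J (radial_connection L x) in
  let case_flat J x := restricts_to_flat M J (radial_connection L x) in
  [/\ forall x : R -> R, instanton all_radii x -> smooth all_radii x ->
        ((exists2 r : R, 0 < r & x r != 0) -> x r @[r --> +oo] --> (3 / 5 : R)) /\
        ((case_LC all_radii x /\ ~ case_flat all_radii x) \/
         (case_flat all_radii x /\ ~ case_LC all_radii x)),
      exists x_lim : R -> R,
        [/\ instanton all_radii x_lim, case_LC all_radii x_lim &
            forall x, instanton all_radii x -> case_LC all_radii x ->
              forall r : R, 0 < r -> x r = x_lim r],
      exists y : R -> R -> R,
        (forall y0 : R, 0 <= y0 ->
          [/\ real_analytic_on [set r : R | 0 <= r] (y y0), y y0 0 = y0,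
              instanton all_radii (fun r => r ^+ 2 * y y0 r) &
              case_flat all_radii (fun r => r ^+ 2 * y y0 r)]) /\
        (forall x, instanton all_radii x -> case_flat all_radii x ->
          exists! y0 : R, 0 <= y0 /\ forall r : R, 0 < r -> x r = r ^+ 2 * y y0 r) &
      forall y0 : R, y0 < 0 ->
        exists (eps : R) (y : R -> R), let near_Z := [set r : R | 0 < r < eps] in
        [/\ 0 < eps /\ real_analytic_on [set r : R | 0 <= r < eps] y, y 0 = y0,
            instanton near_Z (fun r => r ^+ 2 * y r),
            case_flat near_Z (fun r => r ^+ 2 * y r) &
            ~ exists2 x, instanton all_radii x &
                forall r : R, 0 < r < eps -> x r = r ^+ 2 * y r]].
Proof.
have o_all : open [set r : R | 0 < r] by exact: open_gt.
have inst_ode x : spin7_instanton L s t nu [set r : R | 0 < r] (radial_connection L x) ->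
    ode t (nu2 nu) [set r : R | 0 < r] x.
  by move=> H; exact: (instanton_ode s_gt0 Z_einstein Z_asd nu0_gt0 t_nu Z_nonempty o_all (fun _ r0 => r0) H).
have ode_inst x : ode t (nu2 nu) [set r : R | 0 < r] x ->
    spin7_instanton L s t nu [set r : R | 0 < r] (radial_connection L x).
  by move=> H; exact: (ode_instanton s_gt0 Z_einstein Z_asd nu0_gt0 t_nu o_all (fun _ r0 => r0) H).
pose xl := xlim nu0 t nu; pose y := ysol nu0 t nu.
have xlLC : restricts_to_LC L [set r : R | 0 < r] (radial_connection L xl) := xlim_LC L nu0_gt0 t_nu.
have xlnF : ~ restricts_to_flat M [set r : R | 0 < r] (radial_connection L xl) :=
  xlim_not_flat s_gt0 Z_einstein Z_asd nu0_gt0 t_nu Z_nonempty.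
have yF y0 (y00 : 0 <= y0) : restricts_to_flat M [set r : R | 0 < r] (radial_connection L (fun r => r ^+ 2 * y y0 r)) :=
  ysol_flat_all L nu0_gt0 t_nu y00.
have ynLC y0 (y00 : 0 <= y0) : ~ restricts_to_LC L [set r : R | 0 < r] (radial_connection L (fun r => r ^+ 2 * y y0 r)) :=
  ysol_not_LC s_gt0 Z_einstein Z_asd nu0_gt0 t_nu Z_nonempty y00.
move=> all_radii instanton smooth case_LC case_flat.
split.
- move=> x /inst_ode xd _; split.
    move=> [r r0 xr]; have [x0|[C _ xC]] := ode_global nu0_gt0 t_nu xd.
      by move: xr; rewrite x0 // eqxx.
    apply: cvg_trans (solution_cvg nu0_gt0 t_nu C); apply: near_eq_cvg.
    near=> u; apply: esym; apply: xC; near: u; exact: nbhs_pinfty_gt.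
  have [xE|[y0 y00 xE]] := ode_dichotomy nu0_gt0 t_nu xd; [left|right].
    split; first by apply: eq_restricts_to_LC xlLC => r r0; apply: esym; exact: xE.
    by move=> H; apply: xlnF; apply: eq_restricts_to_flat H => r r0; exact: xE.
  split; first by apply: eq_restricts_to_flat (yF y0 y00) => r r0; apply: esym; exact: xE.
  by move=> H; apply: (ynLC y0 y00); apply: eq_restricts_to_LC H => r r0; exact: xE.
- exists xl; split; first by apply: ode_inst; exact: (csol_ode nu0_gt0 t_nu).
    exact: xlLC.
  move=> x /inst_ode xd H r r0.
  have [xE|[y0 y00 xE]] := ode_dichotomy nu0_gt0 t_nu xd; first exact: xE.
  exfalso; apply: (ynLC y0 y00); apply: eq_restricts_to_LC H => u u0; exact: xE.
- exists y; split.
    move=> y0 y00; split.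
    + apply: (ysol_analytic t_nu) => r0 r00; split; first exact: r00.
      exists (r0 + 1) => [|r /andP[r0' _]]; first by rewrite ltrDl.
      by rewrite gt_eqF // (xden_gt0 nu0_gt0 t_nu).
    + by rewrite /y /ysol eqxx.
    + by apply: ode_inst; exact: (ysol_ode_all nu0_gt0 t_nu).
    + exact: yF.
  move=> x /inst_ode xd H.
  have [xE|[y0 y00 xE]] := ode_dichotomy nu0_gt0 t_nu xd.
    by exfalso; apply: xlnF; apply: eq_restricts_to_flat H => r r0; exact: xE.
  exists y0; split; first by split.
  move=> y1 [y10 xE']; apply: (ysol_inj nu0_gt0 t_nu (ltr01 : 0 < 1 :> R) y00 y10).
  exact: etrans (esym (xE 1 ltr01)) (xE' 1 ltr01).
- move=> y0 y0_lt0; have [eps eps0 D0] := xden_near t_nu y0_lt0.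
  exists eps, (y y0); have oJ : open [set r : R | 0 < r < eps].
    rewrite (_ : [set r : R | 0 < r < eps] = [set r | 0 < r] `&` [set r | r < eps]).
      by apply: openI; [exact: open_gt|exact: open_lt].
    by apply/seteqP; split=> r /=; [move=> /andP[]|move=> [-> ->]].
  have J0 r : [set r : R | 0 < r < eps] r -> 0 < r by move=> /andP[].
  have DJ r : [set r : R | 0 < r < eps] r -> xden nu0 nu y0 r != 0.
    by move=> /andP[r0 re]; rewrite gt_eqF // D0 // (ltW r0).
  split.
  + split; first exact: eps0.
    apply: (ysol_analytic t_nu) => r0 /andP[r00 re]; split; first exact: r00.
    (* The denominator is known to be positive only below eps, so the interval around r0 has to end
       before it. *)
    exists ((r0 + eps) / 2) => [|r /andP[r0' rb]]; first by move: re; lra.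
    by rewrite gt_eqF // D0 // r0' (le_lt_trans rb) //; move: re; lra.
  + by rewrite /y /ysol eqxx.
  + apply: (ode_instanton s_gt0 Z_einstein Z_asd nu0_gt0 t_nu oJ J0).
    exact: (ysol_ode nu0_gt0 t_nu oJ J0 DJ).
  + have oU : open [set r : R | r < eps] by exact: open_lt.
    have JU r : [set r : R | 0 < r < eps] r <-> 0 < r /\ [set r : R | r < eps] r.
      by split=> [/andP[]|[r0 re]]; [|rewrite /= r0].
    have b0 : 0 < eps / 2 by rewrite divr_gt0.
    have D r : [set r : R | 0 < r < eps] r \/ 0 <= r <= eps / 2 -> xden nu0 nu y0 r != 0.
      move=> [/DJ//|/andP[r0 rb]].
      by rewrite gt_eqF // D0 // r0 (le_lt_trans rb) //; move: eps0; lra.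
    exact: (ysol_flat L t_nu oJ oU JU eps0 b0 D).
  (* By [ode_global] every solution on all radii is nonnegative, whereas the local one is negative
     at eps/2. *)
  + move=> [x /inst_ode xd xE]; have e2 : 0 < eps / 2 < eps by rewrite divr_gt0 //=; move: eps0; lra.
    have /andP[e20 _] := e2.
    have xneg : x (eps / 2) < 0.
      rewrite xE // /y (ysol_xsol nu0 t nu y0 e20) /xsol pmulr_rlt0 ?exprn_gt0 ?(t_gt0 nu0_gt0 t_nu) //.
      by rewrite pmulr_llt0 // invr_gt0 D0 // (ltW e20); case/andP: e2.
    suff : 0 <= x (eps / 2) by rewrite leNgt xneg.
    have [x0|[C C0 xC]] := ode_global nu0_gt0 t_nu xd; first by rewrite x0.
    by rewrite xC // divr_ge0 ?sqr_ge0 // ltW // (csol_den nu0_gt0 t_nu C0 e20).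
Unshelve. all: by end_near.
Qed.
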